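(* Let $p\ge2$ be an even number. The restriction of the operator $\mathcal P^*:(DH_p)^*\to(L_p(\Pi))^*$ to the space $L_2\subset(DH_p)^*$ is bounded from $L_2$ to $L_2(\Pi)$; it can be represented in the form $$\mathcal P^*(\chi)(t,\omega,y)=\int_t^1\mu(s,t,\omega,y)\,ds,$$ where $\chi=\chi_1+\tilde{\mathcal P}(\mu)$, $\chi_1\in L_2^\perp(\nu)$, $\mu\in\overline{T_2(\nu)}$.
   Context: $(\Omega,\mathfrak F,\mathbf P)$ is a complete probability space, $\mathbf M$ is expectation, $\{\mathfrak F_t,\ t\in[0,1]\}$ is a right-continuous filtration, $\mathfrak{BF}$ is the $\sigma$-field of progressively measurable subsets of $[0,1]\times\Omega$; $\mathcal B$ and $\mathcal B^l$ are the Borel $\sigma$-fields on $R^1$ and $R^l$. $\Pi$ is a $\sigma$-finite measure on $R^l$; $\nu(t,A)$ is a Poisson random measure with parameter $\Pi(A)t$, adapted to $\{\mathfrak F_t\}$, with $\nu(s,A)-\nu(t,A)$ independent of $\mathfrak F_t$ for $s>t$; $\tilde\nu(t,A)=\nu(t,A)-\Pi(A)t$ is the centered measure. $L_2$: (classes of) $\mathfrak{BF}$-measurable $f(t,\omega)$ with norm $\{\mathbf M\int_0^1f^2dt\}^{1/2}$. $DH_p$: (classes of indistinguishable) $\mathfrak{BF}$-measurable functions whose trajectories are a.s. right-continuous with finite left limits on $[0,1]$, with norm $\{\mathbf M\sup_{0\le t\le1}|f(t)|^p\}^{1/p}$. $L_p(\Pi)$: (classes of) $\mathfrak{BF}\times\mathcal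 B^l$-measurable functions $\psi(t,\omega,y)$ with norm $\left\{\mathbf M\int_0^1\left[\int|\psi|^p\Pi(dy)+\left(\int|\psi|^2\Pi(dy)\right)^{p/2}\right]dt\right\}^{1/p}$. $\mathcal P:L_p(\Pi)\to DH_p$ is the bounded operator $\mathcal P(\alpha)(t)=\int_0^t\int\alpha(s,\omega,y)\,\tilde\nu(ds,dy)$ (stochastic integral with respect to the centered Poisson measure, with $\mathbf M|\int_0^1\int\alpha\,d\tilde\nu|^2=\mathbf M\int_0^1\int\alpha^2\,\Pi(dy)ds$), and $\mathcal P^*:(DH_p)^*\to(L_p(\Pi))^*$ is its adjoint. $\chi\in L_2$ is regarded as the functional $g\mapsto\mathbf M\int_0^1\chi g\,ds$ on $DH_p$ and $\beta\in L_2(\Pi)$ as the functional $\alpha\mapsto\mathbf M\int_0^1\int\beta\alpha\,\Pi(dy)ds$ on $L_p(\Pi)$. $N_2(\mathcal B\times\mathcal{BF}\times\mathcal B^l)$ is the Hilbert space of (classes of) measurable functions $\mu(t,s,\omega,y)$, $0\le s\le t\le1$, $\omega\in\Omega$, $y\in R^l$ ($\mathcal B$ in $t$, $\mathfrak{BF}$ in $(s,\omega)$, $\mathcal B^l$ in $y$, product $\sigma$-field) with norm $|||\mu|||_\Pi=\{\mathbf M\int_0^1\int_0^t\int\mu^2(t,s,\omega,y)\Pi(dy)\,ds\,dt\}^{1/2}$. $T_2(\nu)$ is the linear manifold of functions $\mu=\sum_{k=0}^{n-1}\chi_{\Delta_k}(t)\alpha_k(s,\omega,y)$, with $\chi_{\Delta_k}$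 the indicator of $\Delta_k=[t_k,t_{k+1})$, $0=t_0<\dots<t_n=1$, $\alpha_k$ being $\mathfrak{BF}\times\mathcal B^l$-measurable, $\alpha_0\equiv0$, $\alpha_k=0$ for $s\in(t_k,1]$, $\mathbf M\int_0^{t_k}\int\alpha_k^2\,\Pi(dy)ds<\infty$. $\overline{T_2(\nu)}$ is its closure. $\tilde{\mathcal P}:\overline{T_2(\nu)}\to L_2$ is the continuous extension of $\tilde{\mathcal P}(\mu)(t,\omega)=\sum_k\chi_{\Delta_k}(t)\int_0^{t_k}\int\alpha_k(s,\omega,y)\,\tilde\nu(ds,dy)$; it satisfies $\|\tilde{\mathcal P}(\mu)\|_2=|||\mu|||_\Pi$. $L_2(\nu)=\{\tilde{\mathcal P}(\mu):\mu\in\overline{T_2(\nu)}\}$ is a closed subspace of $L_2$, and $L_2^\perp(\nu)$ is its orthogonal complement in $L_2$. *)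

(* Defs.v *)
From HB Require Import structures.
From mathcomp Require Import all_boot all_order all_algebra.
From mathcomp Require Import all_classical all_reals all_analysis.
From mathcomp Require Import measurable_realfun.

Set Implicit Arguments.
Unset Strict Implicit.
Unset Printing Implicit Defensive.

Import Order.TTheory GRing.Theory Num.Theory.
Import numFieldNormedType.Exports.

Local Open Scope classical_set_scope.
Local Open Scope ring_scope.

Definition Rvec (R : realType) (l : nat) :=
  g_sigma_algebraType (@open 'rV[R]_l).

(* Elements of the spaces below are represented by functions, not by
   equivalence classes: two representatives are identified when their difference
   has norm 0.  Values outside the time interval [0, 1] are irrelevant. *)
Definition process (R : realType) (Omega : Type) := R -> Omega -> R.

Definition integrand (R : realType) (Omega : Type) (l : nat) :=
  R -> Omega -> Rvec R l -> R.

Section filtration.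
Context {R : realType} {d : measure_display} {Omega : measurableType d}.

Definition right_continuous_filtration (F : R -> set (set Omega)) :=
  [/\ forall t : R, 0 <= t <= 1 -> sigma_algebra setT (F t),
      forall t : R, 0 <= t <= 1 -> F t `<=` measurable,
      forall s t : R, 0 <= s -> s <= t -> t <= 1 -> F s `<=` F t &
      forall t : R, 0 <= t < 1 -> \bigcap_(s in `]t, 1]) F s = F t].

(* Progressively measurable sets, as subsets of R * Omega; only their trace on
   [0, 1] * Omega is constrained. *)
Definition progressive (F : R -> set (set Omega)) : set (set (R * Omega)) :=
  [set A | forall t : R, 0 <= t <= 1 ->
     @measurable _ (R * g_sigma_algebraType (F t))%type
       (A `&` (`[0, t] `*` setT))].

(* BF F is convertible to R * Omega, which carries another (product)
   sigma-field; hence the explicit domains of measurable_fun below. *)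
Definition BF (F : R -> set (set Omega)) :=
  g_sigma_algebraType (progressive F).

Definition BF_measurable (F : R -> set (set Omega)) (f : process R Omega) :=
  @measurable_fun _ _ (BF F) R
    [set z : R * Omega | 0 <= z.1 <= 1]
    (fun z : R * Omega => f z.1 z.2).

Definition BFl_measurable (F : R -> set (set Omega)) (l : nat)
    (psi : integrand R Omega l) :=
  @measurable_fun _ _ (BF F * Rvec R l)%type R
    [set z : (R * Omega) * Rvec R l | 0 <= z.1.1 <= 1]
    (fun z : (R * Omega) * Rvec R l => psi z.1.1 z.1.2 z.2).

Definition independent_of (P : probability Omega R) (G : set (set Omega))
    (X : Omega -> \bar R) :=
  forall (E : set Omega) (B : set (\bar R)), G E -> measurable B ->
    P (E `&` X @^-1` B) = (P E * P (X @^-1` B))%E.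

(* Subfamilies are covered by taking
   some of the B_i equal to the whole space. *)
Definition mutually_independent (P : probability Omega R) (n : nat)
    (X : 'I_n -> Omega -> \bar R) :=
  forall B : 'I_n -> set (\bar R), (forall i, measurable (B i)) ->
    P (\bigcap_i (X i @^-1` B i)) = (\prod_i P (X i @^-1` B i))%E.

End filtration.

Section poisson_measure.
Context {R : realType} {d : measure_display} {Omega : measurableType d}.
Context {l : nat}.
Variables (P : probability Omega R) (F : R -> set (set Omega)).
Variable Pi : {sigma_finite_measure set (Rvec R l) -> \bar R}.
Variable N : R.-ker Omega ~> (R * Rvec R l)%type.

Definition nu (t : R) (A : set (Rvec R l)) (w : Omega) : \bar R :=
  N w (`]0, t] `*` A).

(* The centered measure; used only for Pi(A) finite, when nu(t, A) is almost
   surely finite. *)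
Definition nu_tilde (t : R) (A : set (Rvec R l)) (w : Omega) : R :=
  fine (nu t A w) - fine (Pi A) * t.

(* N is a Poisson random measure on ]0, 1] * R^l with intensity dt * Pi(dy).
   The second argument of poisson_prob is a dummy; poisson_prob is used rather
   than poisson_pmf because the latter is not a probability at rate 0. *)
Definition poisson_random_measure :=
  (forall B : set (R * Rvec R l), measurable B -> B `<=` `]0, 1] `*` setT ->
     ((lebesgue_measure \x Pi) B < +oo)%E ->
     forall k : nat, P [set w | N w B = k%:R%:E] =
       poisson_prob (fine ((lebesgue_measure \x Pi)%E B)) 0%N [set k]) /\
  (forall (n : nat) (B : 'I_n -> set (R * Rvec R l)),
     (forall i, measurable (B i)) ->
     (forall i, B i `<=` `]0, 1] `*` setT) ->
     trivIset setT B ->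
     mutually_independent P (fun i w => N w (B i))).

(* N w (]t, s] * A) is nu(s, A) - nu(t, A), without the indeterminate form
   when nu(t, A) is infinite. *)
Definition adapted_poisson_measure :=
  [/\ poisson_random_measure,
      forall (t : R) (A : set (Rvec R l)), 0 <= t <= 1 -> measurable A ->
        @measurable_fun _ _ (g_sigma_algebraType (F t)) (\bar R)
          setT (nu t A) &
      forall (t s : R) (A : set (Rvec R l)), 0 <= t -> t < s -> s <= 1 -> measurable A ->
        independent_of P (F t) (fun w => N w (`]t, s] `*` A))].

End poisson_measure.

Section spaces.
Context {R : realType} {d : measure_display} {Omega : measurableType d}.
Context {l : nat}.
Variables (P : probability Omega R) (F : R -> set (set Omega)).
Variable Pi : {sigma_finite_measure set (Rvec R l) -> \bar R}.

Local Notation leb := (@lebesgue_measure R).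

Definition L2_norm (f : process R Omega) : \bar R :=
  ((\int[P]_w \int[leb]_(t in `[0%R, 1%R]) (f t w ^+ 2)%:E) `^ 2^-1)%E.

Definition L2 : set (process R Omega) :=
  [set f | BF_measurable F f /\ (L2_norm f < +oo)%E].

Definition cadlag (x : R -> R) :=
  (forall t : R, 0 <= t < 1 -> x s @[s --> t^'+] --> x t) /\
  (forall t : R, 0 < t <= 1 -> cvg (x s @[s --> t^'-])).

Definition DH_norm (p : nat) (f : process R Omega) : \bar R :=
  ((\int[P]_w ereal_sup [set (`|f t w| ^+ p)%:E | t in `[0%R, 1%R]])
    `^ p%:R^-1)%E.

Definition DH (p : nat) : set (process R Omega) :=
  [set f | [/\ BF_measurable F f, \forall w \ae P, cadlag (f ^~ w) &
               (DH_norm p f < +oo)%E]].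

Definition Lp_norm (p : nat) (psi : integrand R Omega l) : \bar R :=
  ((\int[P]_w \int[leb]_(t in `[0%R, 1%R])
      (\int[Pi]_y (`|psi t w y| ^+ p)%:E +
       (\int[Pi]_y (`|psi t w y| ^+ 2)%:E) `^ (p%:R / 2)))
    `^ p%:R^-1)%E.

Definition Lp (p : nat) : set (integrand R Omega l) :=
  [set psi | BFl_measurable F psi /\ (Lp_norm p psi < +oo)%E].

(* The functionals attached to chi in L_2 and to beta in L_2(Pi). *)
Definition process_functional (chi : process R Omega) :
    process R Omega -> R :=
  fun g => \int[P]_w \int[leb]_(s in `[0, 1]) (chi s w * g s w).

Definition integrand_functional (beta : integrand R Omega l) :
    integrand R Omega l -> R :=
  fun alpha => \int[P]_w \int[leb]_(s in `[0, 1])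
    \int[Pi]_y (beta s w y * alpha s w y).

(* The dual space of DH_p: functionals that are linear and bounded on DH_p. *)
Definition DH_dual (p : nat) : set (process R Omega -> R) :=
  [set phi |
    (forall (a : R) f g, DH p f -> DH p g ->
       phi (fun t w => a * f t w + g t w) = a * phi f + phi g) /\
    exists C : R, forall f, DH p f -> (`|phi f|%:E <= C%:E * DH_norm p f)%E].

Definition Lp_dual (p : nat) : set (integrand R Omega l -> R) :=
  [set phi |
    (forall (a : R) f g, Lp p f -> Lp p g ->
       phi (fun t w y => a * f t w y + g t w y) = a * phi f + phi g) /\
    exists C : R, forall f, Lp p f -> (`|phi f|%:E <= C%:E * Lp_norm p f)%E].

Definition bounded_Lp_DH (p : nat)
    (J : integrand R Omega l -> process R Omega) :=
  (forall alpha, Lp p alpha -> DH p (J alpha)) /\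
  exists C : R, forall alpha, Lp p alpha ->
    (DH_norm p (J alpha) <= C%:E * Lp_norm p alpha)%E.

Definition adjoint (J : integrand R Omega l -> process R Omega)
    (phi : process R Omega -> R) : integrand R Omega l -> R :=
  fun alpha => phi (J alpha).

End spaces.

Section stochastic_integral.
Context {R : realType} {d : measure_display} {Omega : measurableType d}.
Context {l : nat}.
Variables (P : probability Omega R) (F : R -> set (set Omega)).
Variable Pi : {sigma_finite_measure set (Rvec R l) -> \bar R}.
Variable N : R.-ker Omega ~> (R * Rvec R l)%type.

(* The elementary integrand c(omega) 1_{]a, b]}(s) 1_A(y). *)
Record elementary := Elementary {
  el_coef : Omega -> R;
  el_start : R;
  el_stop : R;
  el_set : set (Rvec R l) }.

Definition admissible (e : elementary) :=
  [/\ [/\ 0 <= el_start e, el_start e <= el_stop e & el_stop e <= 1],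
      @measurable_fun _ _ (g_sigma_algebraType (F (el_start e))) R
        setT (el_coef e),
      (exists C : R, forall w, `|el_coef e w| <= C),
      measurable (el_set e) &
      (Pi (el_set e) < +oo)%E].

Definition simple_integrand (n : nat) (e : nat -> elementary) :
    integrand R Omega l :=
  fun s w y => \sum_(i < n)
    el_coef (e i) w * \1_(`]el_start (e i), el_stop (e i)]) s *
    \1_(el_set (e i)) y.

Definition simple_integral (n : nat) (e : nat -> elementary) : process R Omega :=
  fun t w => \sum_(i < n) el_coef (e i) w *
    (nu_tilde Pi N (Num.min (el_stop (e i)) t) (el_set (e i)) w -
     nu_tilde Pi N (Num.min (el_start (e i)) t) (el_set (e i)) w).

(* X is (a version of) the process
   t |-> \int_0^t \int alpha(s, omega, y) nu~(ds, dy). *)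
Definition is_stochastic_integral (alpha : integrand R Omega l)
    (X : process R Omega) :=
  [/\ BF_measurable F X,
      \forall w \ae P, cadlag (X ^~ w) &
      exists (K : nat -> nat) (e : nat -> nat -> elementary),
        [/\ forall n i, (i < K n)%N -> admissible (e n i),
            Lp_norm P Pi 2 (fun s w y =>
               simple_integrand (K n) (e n) s w y - alpha s w y)
              @[n --> \oo] --> 0%E &
            forall t : R, 0 <= t <= 1 ->
              (\int[P]_w ((simple_integral (K n) (e n) t w - X t w) ^+ 2)%:E)%E
                @[n --> \oo] --> 0%E]].

(* J selects a version of the integral process of every square integrable
   integrand. *)
Definition stochastic_integration (J : integrand R Omega l -> process R Omega)
  := forall alpha, Lp P F Pi 2 alpha -> is_stochastic_integral alpha (J alpha).

End stochastic_integral.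

Section volterra.
Context {R : realType} {d : measure_display} {Omega : measurableType d}.
Context {l : nat}.
Variables (P : probability Omega R) (F : R -> set (set Omega)).
Variable Pi : {sigma_finite_measure set (Rvec R l) -> \bar R}.
Variable J : integrand R Omega l -> process R Omega.

Local Notation leb := (@lebesgue_measure R).

(* mu t is the function (s, omega, y) |-> mu(t, s, omega, y), relevant for
   0 <= s <= t <= 1 only. *)
Definition N2_norm (mu : R -> integrand R Omega l) : \bar R :=
  ((\int[P]_w \int[leb]_(t in `[0%R, 1%R]) \int[leb]_(s in `[0%R, t])
      \int[Pi]_y (mu t s w y ^+ 2)%:E) `^ 2^-1)%E.

Definition N2 : set (R -> integrand R Omega l) :=
  [set mu |
    @measurable_fun _ _ (R * (BF F * Rvec R l))%type R
      [set z : R * ((R * Omega) * Rvec R l) |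
        [/\ 0 <= z.2.1.1, z.2.1.1 <= z.1 & z.1 <= 1]]
      (fun z : R * ((R * Omega) * Rvec R l) =>
         mu z.1 z.2.1.1 z.2.1.2 z.2.2) /\
    (N2_norm mu < +oo)%E].

(* Data for \sum_{k < n} 1_{[t_k, t_{k+1}[}(t) alpha_k(s, omega, y). *)
Record step := Step {
  st_size : nat;
  st_node : nat -> R;
  st_coef : nat -> integrand R Omega l }.

Definition T2 (m : step) :=
  [/\ st_node m 0%N = 0,
      st_node m (st_size m) = 1,
      (forall k, (k < st_size m)%N -> st_node m k < st_node m k.+1),
      (forall (s : R) w y, 0 <= s <= 1 -> st_coef m 0%N s w y = 0) &
      forall k, (k < st_size m)%N ->
        [/\ BFl_measurable F (st_coef m k),
            (forall (s : R) w y, st_node m k < s <= 1 -> st_coef m k s w y = 0) &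
            (\int[P]_w \int[leb]_(s in `[0%R, st_node m k])
               \int[Pi]_y (st_coef m k s w y ^+ 2)%:E < +oo)%E]].

Definition step_fun (m : step) : R -> integrand R Omega l :=
  fun t s w y => \sum_(k < st_size m)
    \1_(`[st_node m k, st_node m k.+1[) t * st_coef m k s w y.

Definition P_tilde_step (m : step) : process R Omega :=
  fun t w => \sum_(k < st_size m)
    \1_(`[st_node m k, st_node m k.+1[) t * J (st_coef m k) (st_node m k) w.

Definition T2_closure : set (R -> integrand R Omega l) :=
  [set mu | N2 mu /\
    exists m : nat -> step, (forall n, T2 (m n)) /\
      N2_norm (fun t s w y => step_fun (m n) t s w y - mu t s w y)
        @[n --> \oo] --> 0%E].

(* P_tilde mu f: f is a representative of the value at mu of the continuous
   extension of P_tilde_step to the closure of T_2(nu). *)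
Definition P_tilde (mu : R -> integrand R Omega l) (f : process R Omega) :=
  [/\ T2_closure mu, L2 P F f &
    exists m : nat -> step,
      [/\ forall n, T2 (m n),
          N2_norm (fun t s w y => step_fun (m n) t s w y - mu t s w y)
            @[n --> \oo] --> 0%E &
          L2_norm P (fun t w => P_tilde_step (m n) t w - f t w)
            @[n --> \oo] --> 0%E]].

Definition L2_nu : set (process R Omega) :=
  [set f | exists mu, P_tilde mu f].

Definition L2_nu_perp : set (process R Omega) :=
  [set f | L2 P F f /\
    forall g, L2_nu g -> \int[P]_w \int[leb]_(t in `[0, 1]) (f t w * g t w) = 0].

Definition decomposition (chi chi1 : process R Omega)
    (mu : R -> integrand R Omega l) :=
  L2_nu_perp chi1 /\ P_tilde mu (fun t w => chi t w - chi1 t w).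

Definition volterra_integral (mu : R -> integrand R Omega l) :
    integrand R Omega l :=
  fun t w y => \int[leb]_(s in `[t, 1]) mu s t w y.

End volterra.

(* Main.v *)
Require Import Defs.
From HB Require Import structures.
From mathcomp Require Import all_boot all_order all_algebra.
From mathcomp Require Import all_classical all_reals all_analysis.
From mathcomp Require Import measurable_realfun.
From mathcomp Require Import ring lra.

Set Implicit Arguments.
Unset Strict Implicit.
Unset Printing Implicit Defensive.

Import Order.TTheory GRing.Theory Num.Theory.
Import numFieldNormedType.Exports.

Local Open Scope classical_set_scope.
Local Open Scope ring_scope.

(* The compensated measure has orthogonal increments with covariance
   |I| Pi(A `&` B), which gives the Ito isometry for simple integrands and, by
   density, for J.  Integrating it over the time t shows that
   <f, g> = <mu, eta> whenever f t and g t are the integrals over ]0, t] of mu t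
   and eta t.  This covers the steps (f = P_tilde_step m, mu = step_fun m) and
   the integral processes (f = J alpha, mu t = alpha); the latter belong to
   L2_nu, by approximation with the uniform subdivisions of [0, 1].
   If chi = chi1 + P_tilde mu with chi1 orthogonal to L2_nu, then
   <chi, J alpha> = <P_tilde mu, J alpha>
     = M \int_0^1 \int_0^t \int mu(t, s, y) alpha(s, y) Pi(dy) ds dt,
   and exchanging the integrals in s and t gives the formula.  The bound follows
   from the Cauchy-Schwarz inequality in t together with
   |||mu||| = |chi - chi1| <= |chi|; the decomposition exists because L2_nu is
   the closure of the linear space of the P_tilde_step m. *)

(** * Square integrable functions *)

(** Everything takes place at exponent 2: the probability and the time interval have mass 1, so [Lp]
    at p lies in [Lp] at 2 and [DH] lies in [L2], and p enters only through the bounds of the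
    functionals. For the Hilbert norms, the map from [mu] to its Volterra integral is a contraction;
    the factor sqrt 2 of the final bound only reflects that [Lp_norm] at p = 2 counts the integral
    of the square twice. The obstacle is that functions replace classes. [J] selects versions, so
    linearity of [J] and of [P_tilde_step] holds only at distance 0. The isometry provides it: a
    combination of integrals has the norm of the same combination of integrands, which is 0.
    Moreover, limits must be progressively measurable, while the Hilbert space arguments take place
    over ordinary product measures; hence limits are given by a formula that commutes with the
    cut-offs. The supremum in [DH_norm] is never shown to be measurable: it is integrated as a
    supremum over simple minorants. *)

Section square_integrable.
Context {d} {T : measurableType d} {R : realType}.
Variable m : {measure set T -> \bar R}.
Implicit Types (f g h : T -> R) (a : R).

Definition sqint f :=
  measurable_fun setT f /\ (\int[m]_x (f x ^+ 2)%:E < +oo)%E.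

Definition ip f g : R := \int[m]_x (f x * g x).

Lemma sqint_integrable f g : sqint f -> sqint g ->
  m.-integrable setT (fun x => (f x * g x)%:E).
Proof.
move=> [mf If] [mg Ig]; apply/integrableP; split.
  by apply/measurable_EFinP; exact: measurable_funM.
have msq (h : T -> R) : measurable_fun setT h ->
    measurable_fun setT (fun x => (h x ^+ 2)%:E).
  by move=> mh; apply/measurable_EFinP; exact: measurable_funX.
apply: (@le_lt_trans _ _ (\int[m]_x ((f x ^+ 2)%:E + (g x ^+ 2)%:E))%E).
  apply: ge0_le_integral => //=.
  - by apply/measurable_EFinP; apply: measurableT_comp => //; exact: measurable_funM.
  - by apply: emeasurable_funD; exact: msq.
  - move=> x _; rewrite -EFinD lee_fin.
    have := sqr_ge0 (f x + g x); have := sqr_ge0 (f x - g x) => ? ?.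
    have ? : 0 <= f x ^+ 2 + g x ^+ 2 by rewrite addr_ge0// sqr_ge0.
    by rewrite ler_norml; apply/andP; split; nra.
rewrite ge0_integralD//; [|by move=> x _; rewrite lee_fin sqr_ge0|exact: msq|
  by move=> x _; rewrite lee_fin sqr_ge0|exact: msq].
by rewrite lte_add_pinfty.
Qed.

Lemma sqint_le f g : measurable_fun setT f -> sqint g ->
  (forall x, `|f x| <= `|g x|) -> sqint f.
Proof.
move=> mf [mg Ig] fg; split=> //; apply: le_lt_trans Ig.
apply: ge0_le_integral => //=.
- by move=> x _; rewrite lee_fin sqr_ge0.
- by apply/measurable_EFinP; exact: measurable_funX.
- by apply/measurable_EFinP; exact: measurable_funX.
- by move=> x _; rewrite lee_fin -(real_normK (num_real (f x))) -(real_normK (num_real (g x))) lerXn2r ?nnegrE.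
Qed.

Lemma sqint0 : sqint (fun=> 0).
Proof. by split=> //; rewrite integral0_eq// => x _; rewrite expr0n. Qed.

Lemma sqintZ a f : sqint f -> sqint (fun x => a * f x).
Proof.
move=> [mf If]; split; first exact: measurable_funM.
under eq_integral do rewrite exprMn EFinM.
rewrite ge0_integralZl_EFin ?sqr_ge0//.
- by apply: lte_mul_pinfty; rewrite ?lee_fin ?sqr_ge0.
- by move=> x _; rewrite lee_fin sqr_ge0.
- by apply/measurable_EFinP; exact: measurable_funX.
Qed.

Lemma sqintD f g : sqint f -> sqint g -> sqint (fun x => f x + g x).
Proof.
move=> sf sg; have [mf If] := sf; have [mg Ig] := sg.
split; first exact: measurable_funD.
have msq (h : T -> R) : measurable_fun setT h ->
    measurable_fun setT (fun x => (h x ^+ 2)%:E).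
  by move=> mh; apply/measurable_EFinP; exact: measurable_funX.
apply: (@le_lt_trans _ _ (2%:E * \int[m]_x ((f x ^+ 2)%:E + (g x ^+ 2)%:E))%E).
  rewrite -ge0_integralZl_EFin//.
  - apply: ge0_le_integral => //=.
    + by move=> x _; rewrite lee_fin sqr_ge0.
    + by apply: msq; exact: measurable_funD.
    + by apply: measurable_funeM; apply: emeasurable_funD; exact: msq.
    + move=> x _; rewrite -EFinD -EFinM lee_fin.
      by have := sqr_ge0 (f x - g x) => ?; nra.
  - by move=> x _; rewrite -EFinD lee_fin addr_ge0// sqr_ge0.
  - by apply: emeasurable_funD; exact: msq.
rewrite ge0_integralD//; [|by move=> x _; rewrite lee_fin sqr_ge0|exact: msq|
  by move=> x _; rewrite lee_fin sqr_ge0|exact: msq].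
by apply: lte_mul_pinfty => //; rewrite lte_add_pinfty.
Qed.

Lemma sqintB f g : sqint f -> sqint g -> sqint (fun x => f x - g x).
Proof.
move=> sf /(sqintZ (-1)) sg; have := sqintD sf sg.
by under eq_fun do rewrite mulN1r.
Qed.

Lemma sqint_sum (I : Type) (r : seq I) (F : I -> T -> R) :
  (forall i, sqint (F i)) -> sqint (fun x => \sum_(i <- r) F i x).
Proof.
move=> sF; elim: r => [|i r IH]; first by under eq_fun do rewrite big_nil; exact: sqint0.
by under eq_fun do rewrite big_cons; exact: sqintD.
Qed.

Lemma ipC f g : ip f g = ip g f.
Proof. by rewrite /ip; under eq_Rintegral do rewrite mulrC. Qed.

Lemma ipDl f g h : sqint f -> sqint g -> sqint h ->
  ip (fun x => f x + g x) h = ip f h + ip g h.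
Proof.
move=> sf sg sh; rewrite /ip; under eq_Rintegral do rewrite mulrDl.
by apply: RintegralD => //; exact: sqint_integrable.
Qed.

Lemma ipZl a f h : sqint f -> sqint h -> ip (fun x => a * f x) h = a * ip f h.
Proof.
move=> sf sh; rewrite /ip; under eq_Rintegral do rewrite -mulrA.
by apply: RintegralZl => //; exact: sqint_integrable.
Qed.

Lemma ipBl f g h : sqint f -> sqint g -> sqint h ->
  ip (fun x => f x - g x) h = ip f h - ip g h.
Proof.
move=> sf sg sh; rewrite /ip; under eq_Rintegral do rewrite mulrBl.
by apply: RintegralB => //; exact: sqint_integrable.
Qed.

Lemma ipDr f g h : sqint f -> sqint g -> sqint h ->
  ip h (fun x => f x + g x) = ip h f + ip h g.
Proof. by move=> sf sg sh; rewrite ipC ipDl// !(ipC h). Qed.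

Lemma ipZr a f h : sqint f -> sqint h -> ip h (fun x => a * f x) = a * ip h f.
Proof. by move=> sf sh; rewrite ipC ipZl// (ipC h). Qed.

Lemma ipBr f g h : sqint f -> sqint g -> sqint h ->
  ip h (fun x => f x - g x) = ip h f - ip h g.
Proof. by move=> sf sg sh; rewrite ipC ipBl// !(ipC h). Qed.

Lemma ip0l h : ip (fun=> 0) h = 0.
Proof. by rewrite /ip /Rintegral integral0_eq// => x _; rewrite mul0r. Qed.

Lemma ip_suml (I : Type) (r : seq I) (F : I -> T -> R) h :
  (forall i, sqint (F i)) -> sqint h ->
  ip (fun x => \sum_(i <- r) F i x) h = \sum_(i <- r) ip (F i) h.
Proof.
move=> sF sh; elim: r => [|i r IH].
  by under eq_fun do rewrite big_nil; rewrite big_nil ip0l.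
under eq_fun do rewrite big_cons.
by rewrite big_cons ipDl ?IH//; exact: sqint_sum.
Qed.

Lemma ip_sumr (I : Type) (r : seq I) (F : I -> T -> R) h :
  (forall i, sqint (F i)) -> sqint h ->
  ip h (fun x => \sum_(i <- r) F i x) = \sum_(i <- r) ip h (F i).
Proof.
by move=> sF sh; rewrite ipC ip_suml//; apply: eq_bigr => i _; rewrite ipC.
Qed.

Lemma ip_ge0 f : 0 <= ip f f.
Proof. by apply: Rintegral_ge0 => x _; rewrite -expr2 sqr_ge0. Qed.

Lemma sqint_ipE f : sqint f -> (\int[m]_x (f x ^+ 2)%:E = (ip f f)%:E)%E.
Proof.
move=> sf; rewrite /ip /Rintegral fineK; last first.
  by apply: integrable_fin_num => //; exact: sqint_integrable.
by under [RHS]eq_integral do rewrite -expr2.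
Qed.

Lemma ipB2 f g : sqint f -> sqint g ->
  ip (fun x => f x - g x) (fun x => f x - g x) =
  ip f f - 2 * ip f g + ip g g.
Proof.
move=> sf sg; have sfg := sqintB sf sg.
by rewrite ipBl// !ipBr// (ipC g f); ring.
Qed.

Lemma ip_CS f g : sqint f -> sqint g -> ip f g ^+ 2 <= ip f f * ip g g.
Proof.
move=> sf sg.
have key t : 0 <= ip f f - 2 * (t * ip f g) + t ^+ 2 * ip g g.
  have stg := sqintZ t sg.
  have := ip_ge0 (fun x => f x - t * g x).
  rewrite ipB2// ipZr// ipZl// ipZr//.
  by congr (_ <= _); ring.
have [g0|gn0] := eqVneq (ip g g) 0.
  have f0 := ip_ge0 f.
  suff -> : ip f g = 0 by rewrite g0 mulr0 expr0n.
  apply/eqP; apply: contraT => fg0.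
  (* When <g, g> = 0 the quadratic is affine in t, and at this t it equals - <f, f> - 2 < 0. *)
  have := key ((ip f f + 1) / ip f g); rewrite g0 divfK// => ?; nra.
have g1 : 0 < ip g g by rewrite lt_neqAle eq_sym gn0 ip_ge0.
have := key (ip f g / ip g g).
rewrite -(pmulr_rge0 _ g1) => h.
have -> : ip f f * ip g g = ip g g * (ip f f - 2 * (ip f g / ip g g * ip f g) + (ip f g / ip g g) ^+ 2 * ip g g) + ip f g ^+ 2.
  by field.
by rewrite lerDr.
Qed.

Lemma ip_eq0l f g : sqint f -> sqint g -> ip f f = 0 -> ip f g = 0.
Proof.
move=> sf sg f0; apply/eqP; rewrite -sqrf_eq0 eq_le sqr_ge0 andbT.
by rewrite (le_trans (ip_CS sf sg))// f0 mul0r.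
Qed.

Lemma ip_cvg (f_ g_ : nat -> T -> R) f g :
  (forall n, sqint (f_ n)) -> (forall n, sqint (g_ n)) -> sqint f -> sqint g ->
  ip (fun x => f_ n x - f x) (fun x => f_ n x - f x) @[n --> \oo] --> 0 ->
  ip (fun x => g_ n x - g x) (fun x => g_ n x - g x) @[n --> \oo] --> 0 ->
  ip (f_ n) (g_ n) @[n --> \oo] --> ip f g.
Proof.
move=> sf_ sg_ sf sg cf cg.
have z (u : nat -> R) (v : nat -> R) : (forall n, u n ^+ 2 <= v n) ->
    v n @[n --> \oo] --> 0 -> u n @[n --> \oo] --> 0.
  move=> uv cv; apply/norm_cvg0P.
  have cs : Num.sqrt (v n) @[n --> \oo] --> 0.
    rewrite -(@sqrtr0 R); apply: continuous_cvg => //; exact: sqrt_continuous.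
  apply: (squeeze_cvgr _ (cvg_cst 0) cs).
  by near=> n; rewrite normr_ge0/= -sqrtr_sqr ler_wsqrtr.
have E n : ip (f_ n) (g_ n) =
   ip (fun x => f_ n x - f x) (fun x => g_ n x - g x) +
   ip (fun x => f_ n x - f x) g + ip f (fun x => g_ n x - g x) + ip f g.
  rewrite ipBl// ?ipBr//; last exact: sqintB.
  by rewrite ipBl//; ring.
under eq_fun do rewrite E.
set w := ip f g; have -> : nbhs w = nbhs (0 + 0 + 0 + w) by rewrite !add0r.
apply: cvgD; last exact: cvg_cst.
apply: cvgD; [apply: cvgD|].
- apply: (z _ (fun n => ip (fun x => f_ n x - f x) (fun x => f_ n x - f x) *
    ip (fun x => g_ n x - g x) (fun x => g_ n x - g x))).
    by move=> n; apply: ip_CS => //; exact: sqintB.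
  by rewrite -(mul0r 0); apply: cvgM.
- apply: (z _ (fun n => ip (fun x => f_ n x - f x) (fun x => f_ n x - f x) * ip g g)).
    by move=> n; apply: ip_CS => //; exact: sqintB.
  by rewrite -(mul0r (ip g g)); apply: cvgM => //; exact: cvg_cst.
- apply: (z _ (fun n => ip f f * ip (fun x => g_ n x - g x) (fun x => g_ n x - g x))).
    by move=> n; apply: ip_CS => //; exact: sqintB.
  by rewrite -(mulr0 (ip f f)); apply: cvgM => //; exact: cvg_cst.
Unshelve. all: by end_near. Qed.

End square_integrable.

(** * Completeness and orthogonal projection for square integrable functions *)

Section square_integrable_limits.
Context {d} {T : measurableType d} {R : realType}.
Variable m : {measure set T -> \bar R}.
Implicit Types (f g h : T -> R) (a : R).

Local Notation sqint := (sqint m).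
Local Notation ip := (ip m).

(** Functions at distance 0 are interchangeable: this is how equality of classes is used on
    representatives. *)
Lemma ip_congr f g h : sqint f -> sqint g -> sqint h ->
  ip (fun x => f x - g x) (fun x => f x - g x) = 0 -> ip f h = ip g h.
Proof.
move=> sf sg sh fg0; apply/eqP; rewrite -subr_eq0 -ipBl//.
by apply/eqP; apply: ip_eq0l => //; exact: sqintB.
Qed.

(** The weight turns square summability into absolute summability of the increments, by |x| <= 2^-k
    + 2^k x^2. *)
Lemma cvgn_sq_weighted (u : nat -> R) :
  (\sum_(0 <= k <oo) (2 ^+ k * (u k.+1 - u k) ^+ 2)%:E < +oo)%E -> cvgn u.
Proof.
move=> Hs.
have t0 k : 0 <= 2 ^+ k * (u k.+1 - u k) ^+ 2 :> R.
  by rewrite mulr_ge0 ?sqr_ge0 ?exprn_ge0.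
have cvt : cvgn (series (fun k => 2 ^+ k * (u k.+1 - u k) ^+ 2)).
  apply: nondecreasing_is_cvgn.
    by apply/nondecreasing_seqP => n; rewrite !seriesEnat/= big_nat_recr//= lerDl.
  exists (fine (\sum_(0 <= k <oo) (2 ^+ k * (u k.+1 - u k) ^+ 2)%:E)%E).
  move=> _ [n _ <-]; rewrite -lee_fin fineK; last first.
    by rewrite ge0_fin_numE//; apply: nneseries_ge0 => k _ _; rewrite lee_fin.
  rewrite /series/= -sumEFin.
  by apply: nneseries_lim_ge => k _ _; rewrite lee_fin.
have cvs : cvgn (series (telescope u)).
  apply: normed_cvg.
  apply: (@series_le_cvg _ _ (fun k => geometric 1 (2^-1) k + 2 ^+ k * (u k.+1 - u k) ^+ 2)).
  - by move=> n /=.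
  - by move=> n; rewrite addr_ge0//= mul1r exprn_ge0.
  - move=> n /=; rewrite mul1r exprVn.
    have p0 : 0 < 2 ^+ n :> R by rewrite exprn_gt0.
    rewrite /telescope/=; set y := u n.+1 - u n.
    rewrite -(real_normK (num_real y)); set z := `|y|.
    have z0 : 0 <= z by exact: normr_ge0.
    rewrite -(ler_pM2l p0) mulrDr mulfV ?gt_eqF//.
    set c : R := 2 ^+ n in p0 *.
    by have := sqr_ge0 (1 - c * z) => ?; have ? : 0 <= c * z by [rewrite mulr_ge0// ltW]; nra.
  - have -> : series (fun k => geometric 1 2^-1 k + 2 ^+ k * (u k.+1 - u k) ^+ 2) =
      series (geometric 1 2^-1) + series (fun k => 2 ^+ k * (u k.+1 - u k) ^+ 2).
      by rewrite -seriesD.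
    apply: is_cvgD => //; apply: is_cvg_geometric_series.
    by rewrite ger0_norm// invf_lt1// ltr1n.
have -> : u = (fun n => u 0%N + series (telescope u) n).
  by apply/funext => n; exact: eq_sum_telescope.
by apply: is_cvgD => //; exact: is_cvg_cst.
Qed.

(* The limit is given by an explicit formula so that it inherits every
   measurability shared by the sequence, not only the one carried by T. *)
Lemma L2_complete (f : nat -> T -> R) : (forall n, sqint (f n)) ->
  (forall e, 0 < e -> exists N, forall i j, (N <= i)%N -> (N <= j)%N ->
     ip (fun x => f i x - f j x) (fun x => f i x - f j x) <= e) ->
  exists phi : nat -> nat,
    let g x := fine (limn_esup (fun k => (f (phi k) x)%:E)) in
    sqint g /\ ip (fun x => f n x - g x) (fun x => f n x - g x) @[n --> \oo] --> 0.
Proof.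
move=> sf Cf.
(* The rate 8^-k beats the weight 2^k of [cvgn_sq_weighted]: the weighted squares of the increments
   have a total integral of at most the sum of 4^-k. *)
have e0 k : 0 < 8^-1 ^+ k :> R by rewrite exprn_gt0// invr_gt0.
have [M HM] : exists M : nat -> nat, forall k i j, (M k <= i)%N -> (M k <= j)%N ->
     ip (fun x => f i x - f j x) (fun x => f i x - f j x) <= 8^-1 ^+ k.
  have := choice (fun k => Cf _ (e0 k)) => -[M HM].
  by exists M => k i j; exact: HM.
pose phi k := (\max_(i < k.+1) M i)%N.
have phiM j k : (j <= k)%N -> (M j <= phi k)%N.
  by move=> jk; rewrite /phi -[j]/(nat_of_ord (Ordinal (jk : (j < k.+1)%N))); exact: (leq_bigmax (F := fun i : 'I_k.+1 => M i)).
exists phi => g.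
have mE (h : T -> R) : measurable_fun setT h ->
    measurable_fun setT (fun x => (h x)%:E) by move=> mh; exact/measurable_EFinP.
have mg : measurable_fun setT g.
  apply: measurableT_comp => //.
  by apply: measurable_fun_limn_esup => n; apply: mE; have [] := sf (phi n).
pose D k x : R := f (phi k.+1) x - f (phi k) x.
have sD k : sqint (D k) by exact: sqintB.
have mD k : measurable_fun setT (fun x => (2 ^+ k * D k x ^+ 2)%:E).
  by apply/mE/measurable_funM => //; apply: measurable_funX; have [] := sD k.
have D0 k x : (0 <= (2 ^+ k * D k x ^+ 2)%:E)%E.
  by rewrite lee_fin mulr_ge0 ?sqr_ge0 ?exprn_ge0.
have aecvg : {ae m, forall x, (fun k => f (phi k) x) @ \oo --> g x}.
  have int : m.-integrable setT (fun x => \sum_(0 <= k <oo) (2 ^+ k * D k x ^+ 2)%:E)%E.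
    apply/integrableP; split.
      by apply: ge0_emeasurable_sum => //.
    under eq_integral do rewrite gee0_abs ?nneseries_ge0//.
    rewrite integral_nneseries//.
    apply: (@le_lt_trans _ _ (\sum_(0 <= k <oo) ((4^-1 ^+ k)%:E))%E).
      apply: lee_nneseries => [k _ _|k _]; first by apply: integral_ge0 => x _; exact: D0.
      under eq_integral do rewrite EFinM.
      rewrite ge0_integralZl_EFin ?exprn_ge0//; last 2 first.
        - by move=> x _; rewrite lee_fin sqr_ge0.
        - by apply/mE; apply: measurable_funX; have [] := sD k.
      rewrite sqint_ipE// -EFinM lee_fin.
      have := HM k _ _ (phiM _ _ (leqnSn k)) (phiM _ _ (leqnn k)).
      have -> : 4^-1 = 2 * 8^-1 :> R by lra.
      by rewrite exprMn ler_pM2l ?exprn_gt0.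
    rewrite (_ : \sum_(0 <= k <oo) _ = (\sum_(0 <= k <oo) (geometric 1 4^-1 k)%:E))%E; last first.
      by apply: eq_eseriesr => k _ /=; rewrite mul1r.
    have := @cvg_geometric_series R 1 4^-1.
    rewrite ger0_norm// invf_lt1// ltr1n => /(_ isT) cg.
    have -> : (\sum_(0 <= k <oo) (geometric 1 4^-1 k)%:E = (1 / (1 - 4^-1))%:E :> \bar R)%E.
      apply: cvg_lim => //; under eq_cvg do rewrite sumEFin.
      by apply: cvg_EFin; [exact: nearW|exact: cg].
    by rewrite ltry.
  have [Z [mZ Z0 ZP]] := integrable_ae measurableT int.
  exists Z; split => // x /= ncv; apply: ZP => /= /(_ I) fin; apply: ncv.
  have cv : cvgn (fun k => f (phi k) x).
    by apply: cvgn_sq_weighted; rewrite -ge0_fin_numE ?nneseries_ge0// => k _ _; exact: D0.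
  have cvE : (fun k => (f (phi k) x)%:E) @ \oo --> (limn (fun k => f (phi k) x))%:E.
    by apply: cvg_EFin => //; exact: nearW.
  by rewrite /g (cvg_limn_einf_sup cvE).2.
(* Fatou in k for fixed n: [f (phi k)] tends to g almost everywhere, and [phi], a running maximum of
   [M], exceeds [M j] as soon as k >= j. *)
have fatou_bound j n : (M j <= n)%N ->
    (\int[m]_x ((f n x - g x) ^+ 2)%:E <= (8^-1 ^+ j)%:E)%E.
  move=> jn.
  have msub h : measurable_fun setT h -> measurable_fun setT (fun x => ((f n x - h x) ^+ 2)%:E).
    by move=> mh; apply/mE; apply: measurable_funX; apply: measurable_funB => //; have [] := sf n.
  have mk k : measurable_fun setT (fun x => ((f n x - f (phi k) x) ^+ 2)%:E).
    by apply: msub; have [] := sf (phi k).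
  rewrite (@ge0_ae_eq_integral _ _ _ m setT _ (fun x => limn_einf (fun k => ((f n x - f (phi k) x) ^+ 2)%:E)))//.
  - apply: (le_trans (fatou _ _ mk _)) => //.
      by move=> k x _; rewrite lee_fin sqr_ge0.
    rewrite limn_einf_lim; apply: lime_le; first exact: is_cvg_einfs.
    near=> k; apply: (le_trans (ereal_inf_lbound _)).
      by exists (maxn k j) => //=; exact: leq_maxl.
    rewrite sqint_ipE; last exact: sqintB.
    by rewrite lee_fin; apply: HM => //; apply: phiM; exact: leq_maxr.
  - exact: msub.
  - apply: measurableT_comp => //; apply: measurable_fun_limn_esup => k.
    by apply: (@measurableT_comp _ _ _ _ _ _ (@oppe R)).
  - by move=> x _; rewrite lee_fin sqr_ge0.
  - move=> x _; rewrite limn_einf_lim; apply: lime_ge; first exact: is_cvg_einfs.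
    apply: nearW => k; apply: le_ereal_inf_tmp => _ [i /= ki <-].
    by rewrite lee_fin sqr_ge0.
  - case: aecvg => Z [mZ Z0 ZP]; exists Z; split => // x /= ncv; apply: ZP => /= cv; apply: ncv => _.
    apply/esym; apply: (cvg_limn_einf_sup _).1.
    apply: cvg_EFin; first exact: nearW.
    have cvd : f n x - f (phi k) x @[k --> \oo] --> f n x - g x.
      by apply: cvgB => //; exact: cvg_cst.
    by under eq_fun do rewrite /= expr2; rewrite expr2; exact: cvgM.
have sfg n : (M 0 <= n)%N -> sqint (fun x => f n x - g x).
  move=> Mn; split; first by apply: measurable_funB => //; have [] := sf n.
  by rewrite (le_lt_trans (fatou_bound _ _ Mn))// ltry.
have sg : sqint g.
  have := sqintB (sf (M 0)) (sfg _ (leqnn _)).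
  by under eq_fun do rewrite subKr.
split => //; apply/cvgrPdist_le => e ep.
have [j Hj] : exists j, 8^-1 ^+ j <= e :> R.
  have : (8^-1 ^+ j : R) @[j --> \oo] --> 0.
    by apply: cvg_expr; rewrite ger0_norm// invf_lt1// ltr1n.
  move=> /cvgr0_norm_le /(_ _ ep) [j _ /(_ j (leqnn _))].
  by rewrite /= ger0_norm ?exprn_ge0//; exists j.
near=> n; rewrite sub0r normrN ger0_norm ?ip_ge0// (le_trans _ Hj)//.
by rewrite -lee_fin -sqint_ipE ?fatou_bound//; [near: n; exact: nbhs_infty_ge|exact: sqintB].
Unshelve. all: by end_near. Qed.

(** [V] describes a linear space up to distance 0 only. The minimizing sequence is returned rather
    than its limit, because the same indices are followed later in a second space, that of the
    integrands. *)
Lemma L2_projection (I : Type) (i0 : I) (V : I -> T -> R) (chi : T -> R) :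
  (forall i, sqint (V i)) -> sqint chi ->
  (forall a i j, exists k,
     ip (fun x => V k x - (V i x + a * V j x)) (fun x => V k x - (V i x + a * V j x)) = 0) ->
  exists s : nat -> I,
    (forall e, 0 < e -> exists N, forall i j, (N <= i)%N -> (N <= j)%N ->
       ip (fun x => V (s i) x - V (s j) x) (fun x => V (s i) x - V (s j) x) <= e) /\
    (forall j, ip (fun x => chi x - V (s n) x) (V j) @[n --> \oo] --> 0).
Proof.
move=> sV schi lin.
pose Phi i := ip (fun x => chi x - V i x) (fun x => chi x - V i x).
have sB i : sqint (fun x => chi x - V i x) by exact: sqintB.
pose S := [set Phi i | i in setT].
have S0 : has_inf S.
  by split; [exists (Phi i0), i0|exists 0 => _ [i _ <-]; exact: ip_ge0].
pose d0 := inf S.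
(* Moving [V i] along [V j] cannot bring the squared distance to chi below its infimum [d0]; the
   best coefficient a gives this bound. Both conclusions follow from it. *)
have key i j : ip (fun x => chi x - V i x) (V j) ^+ 2 <= (Phi i - d0) * ip (V j) (V j).
  have low a : d0 <= Phi i - 2 * (a * ip (fun x => chi x - V i x) (V j)) + a ^+ 2 * ip (V j) (V j).
    have [k Hk] := lin a i j.
    have saj := sqintZ a (sV j); have sij := sqintD (sV i) saj.
    have : d0 <= Phi k by apply: ge_inf; [case: S0|exists k].
    have sck := sqintB schi sij.
    have e1 : ip (fun x => (chi x - V k x) - (chi x - (V i x + a * V j x)))
        (fun x => (chi x - V k x) - (chi x - (V i x + a * V j x))) = 0.
      rewrite -[RHS]Hk; apply: eq_Rintegral => x _; ring.
    rewrite /Phi (ip_congr (sB k) sck (sB k) e1) ipC (ip_congr (sB k) sck sck e1).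
    have -> : (fun x => chi x - (V i x + a * V j x)) = (fun x => (chi x - V i x) - a * V j x).
      by apply/funext => x; ring.
    by rewrite ipB2// ipZl// !ipZr//; congr (_ <= _); rewrite /Phi; ring.
  have [y0|yn0] := eqVneq (ip (V j) (V j)) 0.
    by rewrite ipC (ip_eq0l (sV j) (sB i) y0) y0 mulr0 expr0n.
  have y1 : 0 < ip (V j) (V j) by rewrite lt_neqAle eq_sym yn0 ip_ge0.
  have := low (ip (fun x => chi x - V i x) (V j) / ip (V j) (V j)).
  set x := ip _ _; set y := ip _ _ in y1 yn0 *.
  have -> : Phi i - 2 * (x / y * x) + (x / y) ^+ 2 * y = Phi i - x ^+ 2 / y by field.
  by rewrite -ler_pdivrMr// => ?; lra.
have n1 n : 0 < n.+1%:R^-1 :> R by rewrite invr_gt0 ltr0n.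
have /choice[s Hs] : forall n, exists i, Phi i < d0 + n.+1%:R^-1.
  move=> n.
  have [_ [i _ <-] h] := inf_adherent (n1 n) S0; by exists i.
have ge_d0 i : d0 <= Phi i by apply: ge_inf; [case: S0|exists i].
exists s; split.
(* This replaces the parallelogram identity. With D = V i - V j one has y = |D|^2 = xj - xi, while
   [key] bounds xi^2 and xj^2 by y times the excess of [Phi] over [d0]; hence y^2 <= 2 (xi^2 + xj^2)
   can be divided by y. *)
- have tri i j : ip (fun x => V i x - V j x) (fun x => V i x - V j x) <= 2 * (Phi i - d0) + 2 * (Phi j - d0).
    have [k Hk] := lin (-1) i j.
    have e : (fun x => V i x + -1 * V j x) = (fun x => V i x - V j x).
      by apply/funext => x; rewrite mulN1r.
    have sij := sqintB (sV i) (sV j).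
    have Hk' : ip (fun x => V k x - (V i x - V j x)) (fun x => V k x - (V i x - V j x)) = 0.
      by rewrite -[RHS]Hk; apply: eq_Rintegral => x _; rewrite mulN1r.
    have := key i k; have := key j k.
    have ck h : sqint h -> ip h (V k) = ip h (fun x => V i x - V j x).
      by move=> sh; rewrite ipC (ip_congr (sV k) sij sh Hk') ipC.
    rewrite (ck _ (sB j)) (ck _ (sB i)) (ck _ (sV k)) (ipC _ (V k)) (ck _ sij).
    set xi := ip (fun x => chi x - V i x) _; set xj := ip (fun x => chi x - V j x) _.
    set y := ip (fun x => V i x - V j x) _.
    have yE : y = xj - xi.
      rewrite /xj /xi -ipBl//; apply: eq_Rintegral => x _; ring.
    have y0 : 0 <= y by exact: ip_ge0.
    have := ge_d0 i; have := ge_d0 j.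
    set p := Phi i; set q := Phi j; set dd := d0 => h1 h2 h3 h4.
    have h5 : y * y <= y * (2 * (p - dd) + 2 * (q - dd)).
      have := sqr_ge0 (xi + xj); have : y * y = (xj - xi) ^+ 2 by rewrite yE expr2.
      move=> -> ?; nra.
    have [y1|y1] := eqVneq y 0; first by rewrite y1; lra.
    by rewrite -(@ler_pM2l _ y) // lt_neqAle eq_sym y1.
  move=> e e0.
  have e4 : 0 < e / 4 by rewrite divr_gt0.
  have [N _ HN] := near_infty_natSinv_lt (PosNum e4).
  exists N => i j Ni Nj; apply: (le_trans (tri _ _)).
  have small k : (N <= k)%N -> Phi (s k) - d0 <= e / 4.
    by move=> Nk; rewrite lerBlDl (le_trans (ltW (Hs k)))// lerD2l ltW// (HN k Nk).
  by have := small i Ni; have := small j Nj; lra.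
- move=> j; set y := ip (V j) (V j).
  have cy : Num.sqrt (n.+1%:R^-1 * y) @[n --> \oo] --> 0.
    rewrite -(@sqrtr0 R); apply: continuous_cvg; first exact: sqrt_continuous.
    by rewrite -(mul0r y); apply: cvgM; [exact: cvg_harmonic|exact: cvg_cst].
  apply/norm_cvg0P; apply: (squeeze_cvgr _ (cvg_cst 0) cy).
  apply: nearW => n; rewrite normr_ge0/= -sqrtr_sqr ler_wsqrtr//.
  apply: (le_trans (key _ _)); rewrite ler_wpM2r ?ip_ge0//.
  by rewrite lerBlDl; exact/ltW.
Qed.

End square_integrable_limits.

(** * Product measures *)

(* The product of sigma-finite measures as a constant of its own: on
   product_measure1 itself the inferred sigma-finite instance is the one of
   products of probabilities, which does not apply here. *)
Section sigma_finite_product.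
Context {d1 d2} {T1 : measurableType d1} {T2 : measurableType d2} {R : realType}.
Variable m1 : {sigma_finite_measure set T1 -> \bar R}.
Variable m2 : {sigma_finite_measure set T2 -> \bar R}.

Definition prodm : set (T1 * T2) -> \bar R := (m1 \x m2)%E.

HB.instance Definition _ := Measure.on prodm.

Let sigma_finite_prodm : sigma_finite setT prodm.
Proof.
have /sigma_finiteP[A [AT ndA fA]] := sigma_finiteT m1.
have /sigma_finiteP[B [BT ndB fB]] := sigma_finiteT m2.
exists (fun n => A n `*` B n) => [|n].
  apply/seteqP; split => // -[x y] _.
  have [i _ Ai] : (\bigcup_n A n) x by rewrite -AT.
  have [j _ Bj] : (\bigcup_n B n) y by rewrite -BT.
  exists (maxn i j) => //; split => /=.
  - exact: (subsetPset _ _ (ndA _ _ (leq_maxl i j))).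
  - exact: (subsetPset _ _ (ndB _ _ (leq_maxr i j))).
have [[mA Aoo] [mB Boo]] := (fA n, fB n).
split; first exact: measurableX.
by rewrite /prodm product_measure1E// lte_mul_pinfty// ge0_fin_numE.
Qed.

HB.instance Definition _ := Measure_isSigmaFinite.Build _ _ _ prodm
  sigma_finite_prodm.

End sigma_finite_product.

Section product_space.
Context {d1 d2} {T1 : measurableType d1} {T2 : measurableType d2} {R : realType}.
Variable m1 : {sigma_finite_measure set T1 -> \bar R}.
Variable m2 : {sigma_finite_measure set T2 -> \bar R}.

(** By integrability, [fine] changes h only on a null set. It applies to the inner integrals of
    Fubini, which may be infinite at some points. *)
Lemma Rintegral_fine (h : T1 -> \bar R) : m1.-integrable setT h ->
  \int[m1]_x fine (h x) = fine (\int[m1]_x h x)%E.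
Proof.
move=> ih; have mh := measurable_int _ ih.
congr fine; apply: ae_eq_integral => //.
  by apply/measurable_EFinP; apply: measurableT_comp.
have [Z [mZ Z0 ZP]] := integrable_ae measurableT ih.
exists Z; split => // x /= H; apply: ZP => /= fin; apply: H => _.
by rewrite fineK//; exact: fin.
Qed.

Lemma integrable_fine (h : T1 -> \bar R) : m1.-integrable setT h ->
  m1.-integrable setT (fun x => (fine (h x))%:E).
Proof.
move=> ih; have mh := measurable_int _ ih.
apply: le_integrable ih => //.
- by apply/measurable_EFinP; apply: measurableT_comp.
- by move=> x _; case: (h x) => [r| |]//=; rewrite normr0 leey.
Qed.

Variable h : T1 * T2 -> R.
Hypothesis ih : (prodm m1 m2).-integrable setT (EFin \o h).

Lemma Rintegral_prod1 :
  \int[prodm m1 m2]_z h z = \int[m1]_x \int[m2]_y h (x, y).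
Proof.
rewrite /Rintegral -(@fubini1 _ _ _ _ _ m1 m2)//.
by rewrite -Rintegral_fine//; exact: (integrable_fubini_F ih).
Qed.

Lemma integrable_Rintegral1 :
  m1.-integrable setT (fun x => (\int[m2]_y h (x, y))%:E).
Proof. by apply: integrable_fine; exact: (integrable_fubini_F ih). Qed.

End product_space.

Section product_square_integrable.
Context {d1 d2} {T1 : measurableType d1} {T2 : measurableType d2} {R : realType}.
Variable m1 : {sigma_finite_measure set T1 -> \bar R}.
Variable m2 : {sigma_finite_measure set T2 -> \bar R}.
Implicit Types f g : T1 * T2 -> R.

Lemma tonelli1 (f : T1 * T2 -> \bar R) :
  measurable_fun setT f -> (forall z, 0 <= f z)%E ->
  (\int[prodm m1 m2]_z f z = \int[m1]_x \int[m2]_y f (x, y))%E.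
Proof. by move=> mf f0; rewrite fubini_tonelli1. Qed.

Lemma measurable_tonelli1 (f : T1 * T2 -> \bar R) :
  measurable_fun setT f -> (forall z, 0 <= f z)%E ->
  measurable_fun setT (fun x => \int[m2]_y f (x, y))%E.
Proof. by move=> mf f0; exact: (measurable_fun_fubini_tonelli_F f). Qed.

Lemma tonelli_sqr f : measurable_fun setT f ->
  (\int[prodm m1 m2]_z (f z ^+ 2)%:E = \int[m1]_x \int[m2]_y (f (x, y) ^+ 2)%:E)%E.
Proof.
move=> mf; rewrite fubini_tonelli1//.
  by apply/measurable_EFinP; exact: measurable_funX.
by move=> z; rewrite lee_fin sqr_ge0.
Qed.

Lemma tonelli_sqr2 f : measurable_fun setT f ->
  (\int[prodm m1 m2]_z (f z ^+ 2)%:E = \int[m2]_y \int[m1]_x (f (x, y) ^+ 2)%:E)%E.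
Proof.
move=> mf; rewrite fubini_tonelli2//.
  by apply/measurable_EFinP; exact: measurable_funX.
by move=> z; rewrite lee_fin sqr_ge0.
Qed.

Lemma integrable_fubini_G (h : T1 * T2 -> \bar R) :
  (prodm m1 m2).-integrable setT h -> m2.-integrable setT (fubini_G m1 h).
Proof.
move=> ih; have mh := measurable_int _ ih.
have mah : measurable_fun setT (abse \o h) by exact: measurableT_comp.
apply/integrableP; split; first exact: (measurable_fubini_G ih).
have /integrable21ltyP := ih => /(_ mh); apply: le_lt_trans.
apply: ge0_le_integral => //.
- by apply: measurableT_comp => //; exact: (measurable_fubini_G ih).
- by apply: (measurable_fun_fubini_tonelli_G (abse \o h)) => // x; exact: abse_ge0.
- move=> y _; apply: le_abse_integral => //.
  exact: measurableT_comp mh _.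
Qed.

Lemma ip_prod1 f g : sqint (prodm m1 m2) f -> sqint (prodm m1 m2) g ->
  ip (prodm m1 m2) f g =
  \int[m1]_x ip m2 (fun y => f (x, y)) (fun y => g (x, y)).
Proof.
by move=> sf sg; rewrite /ip Rintegral_prod1//; exact: sqint_integrable.
Qed.

Lemma ip_prod2 f g : sqint (prodm m1 m2) f -> sqint (prodm m1 m2) g ->
  ip (prodm m1 m2) f g =
  \int[m2]_y ip m1 (fun x => f (x, y)) (fun x => g (x, y)).
Proof.
move=> sf sg; rewrite /ip.
have ih := sqint_integrable sf sg.
rewrite /Rintegral -(@fubini2 _ _ _ _ _ m1 m2)//.
by rewrite -Rintegral_fine//; exact: (integrable_fubini_G ih).
Qed.

Lemma sqint_prod_indep (f : T1 -> R) (g : T2 -> R) :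
  sqint m1 f -> sqint m2 g ->
  sqint (prodm m1 m2) (fun z => f z.1 * g z.2).
Proof.
move=> sf sg; have [mf If] := sf; have [mg Ig] := sg.
have mfg : measurable_fun setT (fun z : T1 * T2 => f z.1 * g z.2).
  by apply: measurable_funM; apply: measurableT_comp.
split=> //; rewrite tonelli_sqr//.
under eq_integral => x _.
  under eq_integral do rewrite /= exprMn EFinM.
  rewrite ge0_integralZl_EFin ?sqr_ge0//; last 2 first.
  - by move=> y _; rewrite lee_fin sqr_ge0.
  - by apply/measurable_EFinP; exact: measurable_funX.
  rewrite sqint_ipE// muleC.
  over.
rewrite ge0_integralZl_EFin ?ip_ge0//; last 2 first.
- by move=> y _; rewrite lee_fin sqr_ge0.
- by apply/measurable_EFinP; exact: measurable_funX.
by rewrite sqint_ipE// ltry.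
Qed.

End product_square_integrable.

Lemma measurable_indic_mul {d} {T : measurableType d} {R : realType}
    (D : set T) (f : T -> R) : measurable D -> measurable_fun D f ->
  measurable_fun setT (fun x => \1_D x * f x).
Proof.
move=> mD mf.
have -> : (fun x => \1_D x * f x) = f \_ D.
  apply/funext => x; rewrite patchE indicE.
  by case: (x \in D); rewrite ?mul1r ?mul0r.
by apply/(measurable_restrictT _ mD).
Qed.

Lemma integral_indic_sqr {d} {T : measurableType d} {R : realType}
    (m : {measure set T -> \bar R}) (D : set T) (f : T -> R) :
  (\int[m]_(x in D) (f x ^+ 2)%:E = \int[m]_x ((\1_D x * f x) ^+ 2)%:E)%E.
Proof.
rewrite integral_mkcond; apply: eq_integral => x _.
rewrite patchE indicE.
by case: (x \in D); rewrite ?mul1r// mul0r expr0n.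
Qed.

Lemma poweR12_cvg0 {R : realType} (u : nat -> \bar R) : (forall n, 0 <= u n)%E ->
  ((u n `^ 2^-1)%E @[n --> \oo] --> 0%E) <-> (u n @[n --> \oo] --> 0%E).
Proof.
have V : 2^-1 != 0 :> R by rewrite invr_neq0.
move=> u0; split => [/fine_cvgP[fin cu]|/fine_cvgP[fin cu]].
- apply/fine_cvgP; split.
    near=> n; rewrite ge0_fin_numE//; apply: (@lty_poweRy _ _ 2^-1) => //.
    by rewrite -ge0_fin_numE ?poweR_ge0//; near: n.
  have -> : fine \o u = (fun n => (fine \o (fun n => (u n `^ 2^-1)%E)) n ^+ 2).
    apply/funext => n /=; rewrite fine_poweR powR12_sqrt ?sqr_sqrtr ?fine_ge0//.
  under eq_fun do rewrite expr2.
  by rewrite -(mulr0 (0 : R)); exact: cvgM.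
- apply/fine_cvgP; split.
    by near=> n; apply: fin_num_poweR; near: n.
  have -> : fine \o (fun n => (u n `^ 2^-1)%E) = (fun n => Num.sqrt ((fine \o u) n)).
    by apply/funext => n /=; rewrite fine_poweR powR12_sqrt// fine_ge0.
  rewrite -(@sqrtr0 R); apply: continuous_cvg => //; exact: sqrt_continuous.
Unshelve. all: by end_near. Qed.

(** * Progressive measurability *)

Section progressive_sets.
Context {R : realType} {d : measure_display} {Omega : measurableType d}.
Variable F : R -> set (set Omega).
Hypothesis hF : right_continuous_filtration F.

Lemma filtration_measurable (t : R) (A : set Omega) : 0 <= t <= 1 ->
  @measurable _ (g_sigma_algebraType (F t)) A <-> F t A.
Proof.
move=> t01; have [sF _ _ _] := hF.
change (<<s F t >> A <-> F t A).
by rewrite (sigma_algebra_id (sF _ t01)).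
Qed.

Lemma filtration_le (s t : R) : 0 <= s -> s <= t -> t <= 1 -> F s `<=` F t.
Proof. by have [_ _ h _] := hF; exact: h. Qed.

Lemma filtration_sub (t : R) : 0 <= t <= 1 -> F t `<=` @measurable _ Omega.
Proof. by have [_ h _ _] := hF; exact: h. Qed.

Lemma filtration_measurable_fun (s t : R) d' (V : measurableType d') (f : Omega -> V) :
  0 <= s -> s <= t -> t <= 1 ->
  @measurable_fun _ _ (g_sigma_algebraType (F s)) V setT f ->
  @measurable_fun _ _ (g_sigma_algebraType (F t)) V setT f.
Proof.
move=> s0 st t1 mf _ B mB.
have s01 : 0 <= s <= 1 by rewrite s0 (le_trans st).
have t01 : 0 <= t <= 1 by rewrite t1 (le_trans s0).
apply/(filtration_measurable _ t01); apply: (filtration_le s0 st t1).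
by apply/(filtration_measurable _ s01); exact: mf.
Qed.

Lemma filtration_measurable_funT (t : R) d' (V : measurableType d') (f : Omega -> V) :
  0 <= t <= 1 ->
  @measurable_fun _ _ (g_sigma_algebraType (F t)) V setT f ->
  measurable_fun setT f.
Proof.
move=> t01 mf _ B mB; apply: (filtration_sub t01).
by apply/(filtration_measurable _ t01); exact: mf.
Qed.

Lemma measurable_timeX (d' : measure_display) (V : measurableType d') (A : set R) :
  measurable A -> measurable (A `*` [set: V]).
Proof. by move=> mA; exact: measurableX. Qed.

Lemma sigma_algebra_progressive : sigma_algebra setT (progressive F).
Proof.
split => [t t01|A pA t t01|A pA t t01]; first by rewrite set0I.
- have -> : ([set: R * Omega] `\` A) `&` `[0, t] `*` [set: Omega] =
      (`[0, t] `*` setT) `\` (A `&` (`[0, t] `*` setT)).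
    by apply/seteqP; split => z /=; tauto.
  by apply: measurableD; [exact: measurable_timeX|exact: pA].
- rewrite setI_bigcupl; apply: bigcup_measurable => n _; exact: pA.
Qed.

Lemma BF_measurableE (A : set (R * Omega)) :
  @measurable _ (BF F) A <-> progressive F A.
Proof.
change (<<s progressive F >> A <-> progressive F A).
by rewrite (sigma_algebra_id sigma_algebra_progressive).
Qed.

Lemma BF_domain (A : set R) : measurable A ->
  @measurable _ (BF F) (A `*` setT).
Proof.
move=> mA; apply/BF_measurableE => t t01.
rewrite -setXI setTI; apply: (@measurable_timeX _ (g_sigma_algebraType (F t))).
exact: measurableI.
Qed.

Lemma BF_time : @measurable_fun _ _ (BF F) R setT (fun z : R * Omega => z.1).
Proof.
move=> _ B mB; rewrite setTI.
have -> : (fun z : R * Omega => z.1) @^-1` B = B `*` setT.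
  by apply/seteqP; split => [[t w]|[t w] []].
exact: BF_domain.
Qed.

(** Leads from Omega * R, where integrals are taken, to R * Omega, which carries the progressive
    sigma-field. Times outside [0, 1] are sent to 0, since [progressive] constrains only the trace
    on [0, 1]. *)
Definition clip (z : Omega * R) : R * Omega := (\1_(`[0, 1]) z.2 * z.2, z.1).

Lemma clip01 (z : Omega * R) : 0 <= (clip z).1 <= 1.
Proof.
rewrite /clip/= indicE; case: (boolP (z.2 \in _)) => [|_]/=; last by rewrite mul0r lexx ler01.
by rewrite inE/= in_itv/= mul1r.
Qed.

Lemma clipE (z : Omega * R) : 0 <= z.2 <= 1 -> clip z = (z.2, z.1).
Proof. by move=> h; rewrite /clip indicE mem_set ?mul1r//= in_itv. Qed.

Lemma clip_in (z : Omega * R) : z.2 \in `[0, 1]%classic -> clip z = (z.2, z.1).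
Proof. by rewrite inE/= in_itv/=; exact: clipE. Qed.

Lemma measurable_clip : measurable_fun setT (clip : _ -> BF F).
Proof.
move=> _ B /BF_measurableE pB; rewrite setTI.
have m1 : measurable_fun setT (clip : _ -> (R * Omega)%type).
  apply: measurable_fun_pair => //.
  apply: measurable_funM => //.
  by apply: (@measurableT_comp _ _ _ _ _ _ (\1_(`[0, 1]%classic) : R -> R)).
(* The horizon 1 is enough because [clip] takes its values in [0, 1] * Omega; measurability for
   [F 1] then passes to Omega. *)
have := pB 1; rewrite ler01 lexx => /(_ isT) pB1.
have mid : measurable_fun setT (fun z : R * Omega => ((z.1, z.2) : R * g_sigma_algebraType (F 1))).
  apply: measurable_fun_pair => //.
  have mi : measurable_fun setT (id : Omega -> g_sigma_algebraType (F 1)).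
    by apply: (@filtration_measurable_funT 1); rewrite ?ler01 ?lexx.
  exact: (measurableT_comp mi measurable_snd).
have -> : clip @^-1` B = clip @^-1` (B `&` (`[0, 1] `*` setT)).
  apply/seteqP; split => z /=; last by case.
  by move=> Bz; split=> //; split => //=; rewrite in_itv/= clip01.
rewrite -[X in measurable X]setTI; apply: m1 => //.
have := mid measurableT _ pB1; rewrite setTI.
by congr (measurable _); apply/seteqP; split => -[].
Qed.
End progressive_sets.

(** * Extension by zero to the full product spaces *)

Section cutoffs.
Context {R : realType} {d : measure_display} {Omega : measurableType d} {l : nat}.
Variables (P : probability Omega R) (F : R -> set (set Omega)).
Variable Pi : {sigma_finite_measure set (Rvec R l) -> \bar R}.
Hypothesis hF : right_continuous_filtration F.

Local Notation leb := (@lebesgue_measure R).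

(* Square integrable representatives on full product spaces: the values outside
   the time domain, which are irrelevant in the spaces of Defs, are set to 0. *)
Definition cutP (f : process R Omega) (z : Omega * R) : R :=
  \1_(`[0, 1]) z.2 * f z.2 z.1.

Definition cutI (A : set R) (f : integrand R Omega l)
    (z : (Omega * R) * Rvec R l) : R :=
  \1_A z.1.2 * f z.1.2 z.1.1 z.2.

Definition cutN (f : R -> integrand R Omega l)
    (z : R * ((Omega * R) * Rvec R l)) : R :=
  \1_(`[0, 1]) z.1 * cutI `[0, z.1] (f z.1) z.2.

Lemma measurable_indic01 (A : set R) d' (V : measurableType d') (f : V -> R) :
  measurable A -> measurable_fun setT f -> measurable_fun setT (fun z => \1_A (f z) : R).
Proof.
by move=> mA mf; apply: (@measurableT_comp _ _ _ _ _ _ (\1_A : R -> R)).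
Qed.

Lemma measurable_cutP f : BF_measurable F f -> measurable_fun setT (cutP f).
Proof.
move=> mf; rewrite /cutP.
have -> : (fun z : Omega * R => \1_(`[0, 1]) z.2 * f z.2 z.1) =
  (fun z => \1_(`[0, 1]) z.2 * ((fun z => f z.1 z.2) \o clip) z).
  apply/funext => z; rewrite /comp indicE.
  case: (boolP (z.2 \in _)) => [h|_]; last by rewrite !mul0r.
  by rewrite (clip_in h).
apply: measurable_funM; first by apply: measurable_indic01 => //; apply: measurableT_comp.
apply: (measurable_comp _ _ mf (measurable_clip hF)).
  have := @BF_domain _ _ _ F _ (measurable_itv `[0, 1]).
  congr (measurable _); apply/seteqP; split => -[t w] /=; rewrite in_itv/=.
  - by case.
  - by [].
by move=> _ [z _ <-]; exact: clip01.
Qed.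

Lemma BFl_domain : @measurable _ (BF F * Rvec R l)%type
  [set z : (R * Omega) * Rvec R l | 0 <= z.1.1 <= 1].
Proof.
have := @measurableX _ _ (BF F) (Rvec R l) _ setT (@BF_domain _ _ _ F _ (measurable_itv `[0, 1])) measurableT.
congr (measurable _); apply/seteqP; split => -[[t w] y] /=; rewrite in_itv/=.
- by case=> -[].
- by [].
Qed.

Definition clipl (z : (Omega * R) * Rvec R l) : (R * Omega) * Rvec R l :=
  (clip z.1, z.2).

Lemma measurable_clipl : measurable_fun setT (clipl : _ -> (BF F * Rvec R l)%type).
Proof.
apply: measurable_fun_pair => //.
apply: (measurableT_comp (measurable_clip hF)) => //.
Qed.

Lemma measurable_cutI (A : set R) f : measurable A -> A `<=` `[0, 1] ->
  BFl_measurable F f -> measurable_fun setT (cutI A f).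
Proof.
move=> mA A01 mf; rewrite /cutI.
have -> : (fun z : (Omega * R) * Rvec R l => \1_A z.1.2 * f z.1.2 z.1.1 z.2) =
  (fun z => \1_A z.1.2 * ((fun z => f z.1.1 z.1.2 z.2) \o clipl) z).
  apply/funext => -[z y].
  transitivity (\1_A z.2 * f z.2 z.1 y) => //.
  transitivity (\1_A z.2 * f (clip z).1 (clip z).2 y) => //.
  rewrite indicE; case: (boolP (z.2 \in _)) => [h|_]; last by rewrite !mul0r.
  by rewrite clip_in// inE; apply: A01; rewrite inE in h.
apply: measurable_funM; first by apply: measurable_indic01 => //; apply: measurableT_comp.
apply: (measurable_comp _ _ mf measurable_clipl).
  exact: BFl_domain.
by move=> _ [z _ <-]; exact: clip01.
Qed.

Lemma N2_domain : @measurable _ (R * (BF F * Rvec R l))%type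
  [set z : R * ((R * Omega) * Rvec R l) | [/\ 0 <= z.2.1.1, z.2.1.1 <= z.1 & z.1 <= 1]].
Proof.
have mt : measurable_fun setT (fun z : R * (BF F * Rvec R l) => z.1) by exact: measurable_fst.
have ms : measurable_fun setT (fun z : R * (BF F * Rvec R l) => (z.2.1 : R * Omega).1).
  apply: (measurableT_comp (@BF_time _ _ _ F)) => //.
  by apply: (measurableT_comp measurable_fst).
have -> : [set z : R * ((R * Omega) * Rvec R l) | [/\ 0 <= z.2.1.1, z.2.1.1 <= z.1 & z.1 <= 1]] =
  ((fun z : R * (BF F * Rvec R l) => (z.2.1 : R * Omega).1) @^-1` `[0, +oo[%classic) `&`
  ((fun z : R * (BF F * Rvec R l) => z.1 - (z.2.1 : R * Omega).1) @^-1` `[0, +oo[%classic) `&`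
  ((fun z : R * (BF F * Rvec R l) => z.1) @^-1` `]-oo, 1]%classic).
  apply/seteqP; split => z /=; rewrite !in_itv/= !andbT subr_ge0.
    by case.
  by case=> -[].
apply: measurableI; last by rewrite -[X in measurable X]setTI; exact: mt.
apply: measurableI; rewrite -[X in measurable X]setTI; first exact: ms.
by apply: (measurable_funB mt ms).
Qed.

Lemma measurable_cutN f :
  @measurable_fun _ _ (R * (BF F * Rvec R l))%type R
    [set z : R * ((R * Omega) * Rvec R l) |
       [/\ 0 <= z.2.1.1, z.2.1.1 <= z.1 & z.1 <= 1]]
    (fun z : R * ((R * Omega) * Rvec R l) => f z.1 z.2.1.1 z.2.1.2 z.2.2) ->
  measurable_fun setT (cutN f).
Proof.
move=> mf.
have := measurable_indic_mul N2_domain mf.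
set D := [set z | _]; set g := (fun z => _ * _) => mg.
pose k (z : R * ((Omega * R) * Rvec R l)) := (z.1, clipl z.2).
have mk : measurable_fun setT (k : _ -> (R * (BF F * Rvec R l))%type).
  apply: measurable_fun_pair => //.
  by apply: (measurableT_comp measurable_clipl).
(* The two cuts in t and s amount to one cut in s and membership in the triangle [D] after clipping.
   The factor in s is needed because clipping sends the times outside [0, 1] to 0, possibly inside
   [D]. *)
have -> : cutN f = (fun z => \1_(`[0, 1]) z.2.1.2 * (g \o k) z).
  apply/funext => -[t [[w s] y]].
  transitivity (\1_(`[0, 1]) t * (\1_(`[0, t]) s * f t s w y)) => //.
  transitivity (\1_(`[0, 1]) s * (\1_D (t, (clip (w, s), y)) *
     f t (clip (w, s)).1 (clip (w, s)).2 y)); last by [].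
  rewrite mulrA [\1_(`[0, 1]) s]indicE.
  case: (boolP (s \in _)) => h.
    rewrite mul1r (clip_in (z := (w, s)) h) !indicE -natrM mulnb.
    congr (_%:R * _); congr nat_of_bool; apply/idP/idP.
      move=> /andP[/set_mem/= + /set_mem/=]; rewrite !in_itv/=.
      by move=> /andP[_ t1] /andP[s0 st]; apply/mem_set; split.
    move=> /set_mem[/= s0 st t1]; apply/andP; split; apply/mem_set => /=;
      by rewrite in_itv/= ?s0 ?st ?t1// (le_trans s0 st).
  rewrite mul0r !indicE -natrM mulnb [X in nat_of_bool X](_ : _ = false) ?mul0r//.
  apply/negbTE; apply: contra h => /andP[]; rewrite !inE/= !in_itv/=.
  by move=> /andP[_ t1] /andP[-> st]; exact: le_trans st t1.
apply: measurable_funM.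
  apply: measurable_indic01 => //.
  apply: (measurableT_comp measurable_snd).
  by apply: (measurableT_comp measurable_fst).
exact: (measurableT_comp mg mk).
Qed.

End cutoffs.

(** * The norms as norms of square integrable functions *)

Section lower_integral.
Context {d} {T : measurableType d} {R : realType}.
Variable m : {measure set T -> \bar R}.

(* The integral of a nonnegative function is defined as a supremum over its
   simple minorants, whether or not the function is measurable. *)
Lemma ge0_le_integral_lower (D : set T) (f g : T -> \bar R) :
  (forall x, D x -> 0 <= f x)%E -> (forall x, D x -> f x <= g x)%E ->
  (\int[m]_(x in D) f x <= \int[m]_(x in D) g x)%E.
Proof.
move=> f0 fg; rewrite !ge0_integralE//; last first.
  by move=> x Dx; rewrite (le_trans (f0 _ Dx))// fg.
apply: ge_ereal_sup => _ [h /= hf <-]; apply: ereal_sup_ubound; exists h => //= x.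
apply: (le_trans (hf x)); rewrite !patchE; case: ifPn => // xD.
by apply: fg; rewrite inE in xD.
Qed.

(** The integral of c + S cannot be split, as S is not assumed to be measurable. The measurable
    function max (0, h - c) lies below S and takes its place. *)
Lemma integral_le_cstD (D : set T) (h S : T -> \bar R) (c : R) :
  measurable D -> m D = 1%E -> measurable_fun D h ->
  (forall x, D x -> 0 <= h x)%E -> 0 <= c -> (forall x, D x -> 0 <= S x)%E ->
  (forall x, D x -> h x <= c%:E + S x)%E ->
  (\int[m]_(x in D) h x <= c%:E + \int[m]_(x in D) S x)%E.
Proof.
move=> mD D1 mh h0 c0 S0 hS.
pose g x := maxe 0%E (h x - c%:E)%E.
have mg : measurable_fun D g.
  by apply: measurable_maxe => //; apply: emeasurable_funB.
have g0 x : D x -> (0 <= g x)%E by move=> _; rewrite /g le_max lexx.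
apply: (@le_trans _ _ (\int[m]_(x in D) (c%:E + g x))%E).
  apply: ge0_le_integral_lower => // x Dx.
  by rewrite -leeBlDl// /g le_max lexx orbT.
rewrite ge0_integralD; [|exact: mD|by move=> x _; rewrite lee_fin|exact: measurable_cst|exact: g0|exact: mg].
rewrite integral_cst// D1 mule1; apply: leeD => //.
apply: ge0_le_integral_lower => // x Dx.
rewrite /g ge_max; apply/andP; split; first exact: S0.
by rewrite leeBlDl//; exact: hS.
Qed.

Lemma sqr_cvg_ip (f : nat -> T -> R) : (forall n, sqint m (f n)) ->
  ((\int[m]_x (f n x ^+ 2)%:E)%E @[n --> \oo] --> 0%E) <->
  (ip m (f n) (f n) @[n --> \oo] --> 0).
Proof.
move=> sf; rewrite (_ : (fun n => \int[m]_x (f n x ^+ 2)%:E)%E = (fun n => (ip m (f n) (f n))%:E)); last first.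
  by apply/funext => n; rewrite sqint_ipE.
split; first by move/fine_cvgP => [].
by move=> cf; apply: cvg_EFin => //; exact: nearW.
Qed.

End lower_integral.

Section norms.
Context {R : realType} {d : measure_display} {Omega : measurableType d} {l : nat}.
Variables (P : probability Omega R) (F : R -> set (set Omega)).
Variable Pi : {sigma_finite_measure set (Rvec R l) -> \bar R}.
Hypothesis hF : right_continuous_filtration F.

Local Notation leb := (@lebesgue_measure R).
Local Notation mP := (prodm P leb).
Local Notation mI := (prodm mP Pi).
Local Notation mN := (prodm leb mI).

Let lt_poweR12 (x : \bar R) : (x `^ 2^-1 < +oo)%E <-> (x < +oo)%E.
Proof. by split; [apply: lty_poweRy; rewrite invr_neq0|exact: poweR_lty]. Qed.

Lemma L2_normE f : BF_measurable F f ->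
  (L2_norm P f = (\int[mP]_z (cutP f z ^+ 2)%:E) `^ 2^-1)%E.
Proof.
move=> mf; rewrite /L2_norm tonelli_sqr; last exact: (measurable_cutP hF mf).
congr (_ `^ _)%E; apply: eq_integral => w _.
by rewrite integral_indic_sqr.
Qed.

Lemma L2P f : L2 P F f <-> BF_measurable F f /\ sqint mP (cutP f).
Proof.
split => [[mf Lf]|[mf [_ Lf]]]; split => //.
  split; first exact: (measurable_cutP hF mf).
  by move: Lf; rewrite L2_normE// => /lt_poweR12.
by rewrite L2_normE//; apply/lt_poweR12.
Qed.

Lemma L2_norm_cvg (f : nat -> process R Omega) : (forall n, L2 P F (f n)) ->
  (L2_norm P (f n) @[n --> \oo] --> 0%E) <->
  (ip mP (cutP (f n)) (cutP (f n)) @[n --> \oo] --> 0).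
Proof.
move=> Lf.
have -> : (fun n => L2_norm P (f n)) = (fun n => (\int[mP]_z (cutP (f n) z ^+ 2)%:E) `^ 2^-1)%E.
  by apply/funext => n; rewrite L2_normE//; have [] := Lf n.
rewrite poweR12_cvg0; last by move=> n; apply: integral_ge0 => z _; rewrite lee_fin sqr_ge0.
by apply: sqr_cvg_ip => n; have /L2P[] := Lf n.
Qed.

(** At p = 2 the two terms of the norm coincide, hence the factor 2. *)
Lemma Lp2_normE f : BFl_measurable F f ->
  (Lp_norm P Pi 2 f =
   (2%:E * \int[mI]_z (cutI `[0%R, 1%R] f z ^+ 2)%:E) `^ 2^-1)%E.
Proof.
move=> mf; have mc := measurable_cutI hF (measurable_itv `[0, 1]) (@subset_refl _ _) mf.
rewrite /Lp_norm; congr (_ `^ _)%E.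
have mc2 : measurable_fun setT (fun z => (cutI `[0, 1] f z ^+ 2)%:E).
  by apply/measurable_EFinP; exact: measurable_funX.
have mG : measurable_fun setT (fun x : Omega * R => \int[Pi]_y (cutI `[0%R, 1%R] f (x, y) ^+ 2)%:E)%E.
  apply: (measurable_tonelli1 Pi mc2).
  by move=> z; rewrite lee_fin sqr_ge0.
have G0 x : (0 <= \int[Pi]_y (cutI `[0%R, 1%R] f (x, y) ^+ 2)%:E)%E.
  by apply: integral_ge0 => y _; rewrite lee_fin sqr_ge0.
rewrite (tonelli_sqr mP Pi mc) -ge0_integralZl ?lee_fin//.
rewrite (tonelli1 P leb (measurable_funeM 2%:E mG)); last first.
  by move=> x; rewrite mule_ge0// lee_fin.
apply: eq_integral => w _; rewrite integral_mkcond; apply: eq_integral => t _.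
rewrite patchE; case: ifPn => tI.
  rewrite divff// poweRe1; last by apply: integral_ge0 => y _; rewrite lee_fin exprn_ge0.
  rewrite -mule2n -mule_natl; congr (_ * _)%E; apply: eq_integral => y _.
  by rewrite /cutI/= indicE tI mul1r real_normK// num_real.
rewrite integral0_eq ?mule0// => y _.
by rewrite /cutI/= indicE (negbTE tI) mul0r expr0n.
Qed.

Lemma Lp2P f : Lp P F Pi 2 f <-> BFl_measurable F f /\ sqint mI (cutI `[0, 1] f).
Proof.
have h0 : (0 <= \int[mI]_z (cutI `[0%R, 1%R] f z ^+ 2)%:E)%E.
  by apply: integral_ge0 => z _; rewrite lee_fin sqr_ge0.
split => [[mf Lf]|[mf [_ Lf]]]; split => //.
  split; first exact: (measurable_cutI hF _ _ mf).
  move: Lf; rewrite Lp2_normE// => /lt_poweR12.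
  by move: h0; move: (\int[_]_z _)%E => [r| |] _ //; rewrite ?ltry ?gt0_muley.
by rewrite Lp2_normE//; apply/lt_poweR12; rewrite lte_mul_pinfty// lee_fin.
Qed.

Lemma Lp2_norm_cvg (f : nat -> integrand R Omega l) : (forall n, Lp P F Pi 2 (f n)) ->
  (Lp_norm P Pi 2 (f n) @[n --> \oo] --> 0%E) <->
  (ip mI (cutI `[0, 1] (f n)) (cutI `[0, 1] (f n)) @[n --> \oo] --> 0).
Proof.
move=> Lf.
have -> : (fun n => Lp_norm P Pi 2 (f n)) = (fun n => (2%:E * \int[mI]_z (cutI `[0%R, 1%R] (f n) z ^+ 2)%:E) `^ 2^-1)%E.
  by apply/funext => n; rewrite Lp2_normE//; have [] := Lf n.
rewrite poweR12_cvg0; last first.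
  by move=> n; rewrite mule_ge0 ?lee_fin//; apply: integral_ge0 => z _; rewrite lee_fin sqr_ge0.
rewrite -sqr_cvg_ip; last by move=> n; have /Lp2P[] := Lf n.
split => [|c]; last by rewrite -(mule0 2%:E); exact: cvgeZl.
move=> /(@cvgeZl _ _ _ _ _ (2^-1)%:E isT); rewrite mule0.
by under eq_cvg do rewrite muleA -EFinM mulVf// mul1e.
Qed.

Definition N2_measurable (f : R -> integrand R Omega l) :=
  @measurable_fun _ _ (R * (BF F * Rvec R l))%type R
    [set z : R * ((R * Omega) * Rvec R l) |
       [/\ 0 <= z.2.1.1, z.2.1.1 <= z.1 & z.1 <= 1]]
    (fun z : R * ((R * Omega) * Rvec R l) => f z.1 z.2.1.1 z.2.1.2 z.2.2).

Lemma N2_normE f : N2_measurable f ->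
  (N2_norm P Pi f = (\int[mN]_z (cutN f z ^+ 2)%:E) `^ 2^-1)%E.
Proof.
move=> mf; have mc := measurable_cutN hF mf.
rewrite /N2_norm; congr (_ `^ _)%E.
have sq0 z : (0 <= (cutN f z ^+ 2)%:E)%E by rewrite lee_fin sqr_ge0.
have mc2 : measurable_fun setT (fun z => (cutN f z ^+ 2)%:E).
  by apply/measurable_EFinP; exact: measurable_funX.
(* [N2_norm] integrates over y, s, t and omega, from the inside out, whereas [mN] has t outermost; r
   reorders the variables so that the inner integrals are measurable in (omega, t). *)
pose r (z : ((Omega * R) * R) * Rvec R l) := (z.1.1.2, ((z.1.1.1, z.1.2), z.2)).
have mr : measurable_fun setT r.
  apply: measurable_fun_pair; first by do 2?apply: measurableT_comp => //.
  apply: measurable_fun_pair => //; apply: measurable_fun_pair.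
    by do 2?apply: measurableT_comp => //.
  by do 2?apply: measurableT_comp => //.
have mG1 : measurable_fun setT (fun x : (Omega * R) * R =>
    \int[Pi]_y (cutN f (x.1.2, ((x.1.1, x.2), y)) ^+ 2)%:E)%E.
  by apply: (measurable_tonelli1 Pi (measurableT_comp mc2 mr)) => z; exact: sq0.
have mG2 : measurable_fun setT (fun x : (Omega * R) =>
    \int[leb]_s \int[Pi]_y (cutN f (x.2, ((x.1, s), y)) ^+ 2)%:E)%E.
  apply: (measurable_tonelli1 leb mG1).
  by move=> x; apply: integral_ge0.
transitivity (\int[P]_w \int[leb]_t \int[leb]_s \int[Pi]_y (cutN f (t, ((w, s), y)) ^+ 2)%:E)%E.
  apply: eq_integral => w _; rewrite integral_mkcond; apply: eq_integral => t _.
  rewrite patchE; case: ifPn => tI.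
    rewrite integral_mkcond; apply: eq_integral => s _.
    rewrite patchE; case: ifPn => sI.
      by apply: eq_integral => y _; rewrite /cutN /cutI/= !indicE tI sI !mul1r.
    rewrite integral0_eq// => y _.
    by rewrite /cutN /cutI/= !indicE (negbTE sI) !(mul0r, mulr0) expr0n.
  rewrite integral0_eq// => s _; rewrite integral0_eq// => y _.
  by rewrite /cutN /cutI/= !indicE (negbTE tI) !(mul0r, mulr0) expr0n.
rewrite (@fubini_tonelli _ _ _ _ _ P leb (fun x : (Omega * R) =>
    \int[leb]_s \int[Pi]_y (cutN f (x.2, ((x.1, s), y)) ^+ 2)%:E)%E)//; last first.
  by move=> x; apply: integral_ge0 => s _; apply: integral_ge0.
rewrite (tonelli_sqr leb mI mc); apply: eq_integral => t _.
have mct : measurable_fun setT (fun z => cutN f (t, z)).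
  exact: (measurableT_comp mc (measurable_pair1 t)).
rewrite (tonelli_sqr mP Pi mct) tonelli1//.
- have mct2 : measurable_fun setT (fun z => (cutN f (t, z) ^+ 2)%:E).
    by apply/measurable_EFinP; exact: measurable_funX.
  exact: (measurable_tonelli1 Pi mct2).
- by move=> x; apply: integral_ge0.
Qed.

Lemma N2P f : N2 P F Pi f <-> N2_measurable f /\ sqint mN (cutN f).
Proof.
split => [[mf Lf]|[mf [_ Lf]]]; split => //.
  split; first exact: (measurable_cutN hF mf).
  by move: Lf; rewrite N2_normE// => /lt_poweR12.
by rewrite N2_normE//; apply/lt_poweR12.
Qed.

Lemma N2_norm_cvg (f : nat -> R -> integrand R Omega l) : (forall n, N2 P F Pi (f n)) ->
  (N2_norm P Pi (f n) @[n --> \oo] --> 0%E) <->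
  (ip mN (cutN (f n)) (cutN (f n)) @[n --> \oo] --> 0).
Proof.
move=> Lf.
have -> : (fun n => N2_norm P Pi (f n)) = (fun n => (\int[mN]_z (cutN (f n) z ^+ 2)%:E) `^ 2^-1)%E.
  by apply/funext => n; rewrite N2_normE//; have [] := Lf n.
rewrite poweR12_cvg0; last by move=> n; apply: integral_ge0 => z _; rewrite lee_fin sqr_ge0.
by apply: sqr_cvg_ip => n; have /N2P[] := Lf n.
Qed.

Lemma process_functionalE f g : sqint mP (cutP f) -> sqint mP (cutP g) ->
  process_functional P f g = ip mP (cutP f) (cutP g).
Proof.
move=> sf sg; rewrite /ip Rintegral_prod1; last exact: sqint_integrable.
apply: eq_Rintegral => w _; rewrite Rintegral_mkcond; apply: eq_Rintegral => t _.
by rewrite /cutP patchE indicE; case: ifPn; rewrite /= ?mul1r// ?mul0r.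
Qed.

Lemma integrand_functionalE f g :
  sqint mI (cutI `[0, 1] f) -> sqint mI (cutI `[0, 1] g) ->
  integrand_functional P Pi f g = ip mI (cutI `[0, 1] f) (cutI `[0, 1] g).
Proof.
move=> sf sg; have ii := sqint_integrable sf sg.
rewrite /ip (Rintegral_prod1 ii) Rintegral_prod1; last exact: (integrable_Rintegral1 ii).
apply: eq_Rintegral => w _; rewrite Rintegral_mkcond; apply: eq_Rintegral => t _.
rewrite /cutI patchE/= indicE; case: ifPn => _; rewrite /=.
  by apply: eq_Rintegral => y _; rewrite !mul1r.
by rewrite /Rintegral integral0_eq// => y _; rewrite !mul0r.
Qed.

End norms.

Lemma expr_interp {R : realFieldType} (K a : R) (q : nat) : 0 <= K -> 0 <= a ->
  K ^+ q * a ^+ 2 <= K ^+ q.+2 + a ^+ q.+2.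
Proof.
move=> K0 a0; have e x : x ^+ q.+2 = x ^+ q * x ^+ 2 :> R by rewrite -exprD addn2.
rewrite !e; have [aK|/ltW Ka] := leP a K.
  by rewrite (le_trans (_ : _ <= K ^+ q * K ^+ 2)) ?lerDl ?mulr_ge0 ?exprn_ge0// ler_wpM2l ?exprn_ge0// lerXn2r.
by rewrite (le_trans (_ : _ <= a ^+ q * a ^+ 2)) ?lerDr ?mulr_ge0 ?exprn_ge0// ler_wpM2r ?exprn_ge0// lerXn2r.
Qed.

(** * Comparison of the norms at exponent p with those at exponent 2 *)

Section sup_norm.
Context {R : realType} {d : measure_display} {Omega : measurableType d} {l : nat}.
Variables (P : probability Omega R) (F : R -> set (set Omega)).
Variable Pi : {sigma_finite_measure set (Rvec R l) -> \bar R}.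
Hypothesis hF : right_continuous_filtration F.

Local Notation leb := (@lebesgue_measure R).
Local Notation mP := (prodm P leb).
Local Notation mI := (prodm mP Pi).

Let leb01 : leb `[0, 1]%classic = 1%E.
Proof. by rewrite lebesgue_measure_itv/= lte_fin ltr01 sube0. Qed.

Lemma DH_norm_pow (p : nat) (f : process R Omega) : (0 < p)%N ->
  DH P F p f ->
  (\int[P]_w ereal_sup [set (`|f t w| ^+ p)%:E | t in `[0%R, 1%R]] =
   (fine (DH_norm P p f) ^+ p)%:E)%E.
Proof.
move=> p0 [_ _ fin].
have pn0 : p%:R != 0 :> R by rewrite pnatr_eq0 -lt0n.
set S := (\int[P]_w _)%E.
have S0 : (0 <= S)%E.
  apply: integral_ge0 => w _; apply: (le_trans _ (ereal_sup_ubound _)); last first.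
    by exists 0 => //=; rewrite in_itv/= lexx ler01.
  by rewrite lee_fin exprn_ge0.
have -> : S = (DH_norm P p f `^ p%:R)%E.
  by rewrite /DH_norm -poweRrM mulVf// poweRe1.
have /fineK <- : DH_norm P p f \is a fin_num.
  by rewrite ge0_fin_numE// poweR_ge0.
by rewrite poweR_EFin powR_mulrn//= fine_ge0// poweR_ge0.
Qed.

(* The bound follows from K^(p-2) a^2 <= K^p + a^p upon letting K decrease to the
   norm. *)
Lemma DH_L2 (p : nat) (f : process R Omega) : (2 <= p)%N -> DH P F p f ->
  sqint mP (cutP f) /\
  ip mP (cutP f) (cutP f) <= 2 * fine (DH_norm P p f) ^+ 2.
Proof.
move=> p2 Df; have [mf _ fin] := Df.
set D := fine _.
have D0 : 0 <= D by rewrite fine_ge0// poweR_ge0.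
have mc := measurable_cutP hF mf.
have [q pq] : exists q, p = q.+2 by case: p p2 {Df fin D D0} => [|[|q]]// _; exists q.
(* K stays above the norm [D], which may be 0, because the estimate is divided by K^q. *)
have key K : D < K -> (\int[mP]_z (cutP f z ^+ 2)%:E <= (2 * K ^+ 2)%:E)%E.
  move=> DK; have K0 : 0 < K by exact: le_lt_trans DK.
  have Kq : 0 < K ^+ q by rewrite exprn_gt0.
  have mc2 : measurable_fun setT (fun z => (cutP f z ^+ 2)%:E).
    by apply/measurable_EFinP; exact: measurable_funX.
  have mh : measurable_fun setT (fun w => \int[leb]_t (cutP f (w, t) ^+ 2)%:E)%E.
    by apply: (measurable_tonelli1 leb mc2) => z; rewrite lee_fin sqr_ge0.
  have h0 w : (0 <= \int[leb]_t (cutP f (w, t) ^+ 2)%:E)%E.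
    by apply: integral_ge0 => t _; rewrite lee_fin sqr_ge0.
  have : ((K ^+ q)%:E * \int[mP]_z (cutP f z ^+ 2)%:E <= (K ^+ p)%:E + (D ^+ p)%:E)%E.
    rewrite (tonelli_sqr P leb mc) -ge0_integralZl ?lee_fin ?(ltW Kq)//.
    rewrite -DH_norm_pow//; last exact: ltn_trans p2.
    apply: integral_le_cstD => //.
    - exact: probability_setT.
    - exact: measurable_funeM.
    - by move=> w _; rewrite mule_ge0// lee_fin ltW.
    - by rewrite exprn_ge0// ltW.
    - move=> w _; apply: (le_trans _ (ereal_sup_ubound _)); last first.
        by exists 0 => //=; rewrite in_itv/= lexx ler01.
      by rewrite lee_fin exprn_ge0.
    move=> w _; set S := ereal_sup _.
    have mw : measurable_fun setT (fun t => (cutP f (w, t) ^+ 2)%:E).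
      exact: (measurableT_comp mc2 (measurable_pair1 w)).
    have E : (\int[leb]_t ((K ^+ q)%:E * (cutP f (w, t) ^+ 2)%:E) =
        \int[leb]_(t in `[0%R, 1%R]) ((K ^+ q)%:E * (f t w ^+ 2)%:E))%E.
      rewrite [RHS]integral_mkcond; apply: eq_integral => t _.
      rewrite patchE /cutP indicE/=; case: (t \in _); rewrite ?mul1r//.
      by rewrite mul0r expr0n mule0.
    rewrite -ge0_integralZl ?lee_fin ?(ltW Kq)// ?E.
    - apply: (@le_trans _ _ (\int[leb]_(t in `[0%R, 1%R]) cst ((K ^+ p)%:E + S)%E t)%E).
      apply: ge0_le_integral_lower => t t01.
        by rewrite mule_ge0// lee_fin ?sqr_ge0// ltW.
      apply: (@le_trans _ _ ((K ^+ p)%:E + (`|f t w| ^+ p)%:E)%E); last first.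
        by apply: leeD => //; apply: ereal_sup_ubound; exists t.
      rewrite -EFinM -EFinD lee_fin -[f t w ^+ 2]real_normK ?num_real//.
      have := normr_ge0 (f t w); set a := `|f t w| => a0.
      by rewrite pq; apply: expr_interp => //; exact: ltW.
    - by rewrite integral_cst// [X in (_ * X)%E]leb01 mule1.
    - by move=> t _; rewrite lee_fin sqr_ge0.
  rewrite -EFinD; move: (\int[mP]_z _)%E => [r| |] h; last 2 first.
  - by move: h; rewrite gt0_muley// lte_fin.
  - by rewrite leNye.
  move: h; rewrite -EFinM !lee_fin => h.
  have DKp : D ^+ p <= K ^+ p by rewrite lerXn2r// ?nnegrE ltW.
  have e : K ^+ p = K ^+ q * K ^+ 2 by rewrite pq -exprD addn2.
  rewrite -(ler_pM2l Kq) (le_trans h)// (le_trans (lerD (lexx _) DKp))//.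
  by rewrite e; lra.
have sf : sqint mP (cutP f).
  by split=> //; apply: (le_lt_trans (key (D + 1) _)); rewrite ?ltry// ltrDl.
split => //; apply/ler_addgt0Pr => e e0.
have := sqint_ipE sf; set I := ip _ _ _ => IE.
have K2 K : D < K -> I <= 2 * K ^+ 2.
  by move=> /key; rewrite -lee_fin -IE.
(* Chosen so that 2 (D + h)^2 <= 2 D^2 + h (4 D + 2) <= 2 D^2 + e; the first inequality uses h <=
   1. *)
pose h := Num.min 1 (e / (2 * (2 * D + 1))).
have h0 : 0 < h by rewrite lt_min ltr01 divr_gt0// mulr_gt0//; lra.
have h1 : h <= 1 by rewrite ge_min lexx.
have h2 : h * (2 * (2 * D + 1)) <= e.
  by rewrite -ler_pdivlMr ?ge_min ?lexx ?orbT//; lra.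
have : I <= 2 * (D + h) ^+ 2 by apply: K2; rewrite ltrDl.
by move/le_trans; apply; nra.
Qed.

Lemma poweR_ge_sub1 (x : \bar R) (r : R) : (0 <= x)%E -> 1 <= r ->
  (x <= 1%:E + x `^ r)%E.
Proof.
move=> x0 r1; case: x x0 => [x|_|]//; last first.
  by rewrite poweRyr// gt_eqF// (lt_le_trans ltr01).
rewrite lee_fin poweR_EFin -EFinD lee_fin => x0.
have [x1|x1] := leP x 1; first by rewrite (le_trans x1)// lerDl powR_ge0.
by rewrite (le_trans (le1r_powR (ltW x1) r1))// lerDr.
Qed.

(** The bound x <= 1 + x^(p/2), at x = \int psi^2 dPi, is integrated over omega and t, where the
    total mass is 1. It is the second term of [Lp_norm] that controls the right-hand side. *)
Lemma Lp_Lp2 (p : nat) (f : integrand R Omega l) : (2 <= p)%N ->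
  Lp P F Pi p f -> Lp P F Pi 2 f.
Proof.
move=> p2 [mf Lf]; apply/(Lp2P _ _ hF); split => //.
have mc := measurable_cutI hF (measurable_itv `[0, 1]) (@subset_refl _ _) mf.
split=> //.
have mc2 : measurable_fun setT (fun z => (cutI `[0, 1] f z ^+ 2)%:E).
  by apply/measurable_EFinP; exact: measurable_funX.
have mG : measurable_fun setT (fun x : Omega * R => \int[Pi]_y (cutI `[0%R, 1%R] f (x, y) ^+ 2)%:E)%E.
  apply: (measurable_tonelli1 Pi mc2).
  by move=> z; rewrite lee_fin sqr_ge0.
have G0 x : (0 <= \int[Pi]_y (cutI `[0%R, 1%R] f (x, y) ^+ 2)%:E)%E.
  by apply: integral_ge0 => y _; rewrite lee_fin sqr_ge0.
rewrite (tonelli_sqr mP Pi mc) (tonelli1 P leb mG)//.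
have pn0 : p%:R^-1 != 0 :> R by rewrite invr_neq0// pnatr_eq0 -lt0n (ltn_trans _ p2).
have fin := lty_poweRy pn0 Lf.
have pos t w : (0 <= \int[Pi]_y (`|f t w y| ^+ p)%:E + (\int[Pi]_y (`|f t w y| ^+ 2)%:E) `^ (p%:R / 2))%E.
  by rewrite adde_ge0// ?poweR_ge0//; apply: integral_ge0 => y _; rewrite lee_fin exprn_ge0.
apply: (@le_lt_trans _ _ (1%:E + \int[P]_w \int[leb]_(t in `[0%R, 1%R])
   (\int[Pi]_y (`|f t w y| ^+ p)%:E + (\int[Pi]_y (`|f t w y| ^+ 2)%:E) `^ (p%:R / 2)))%E); last first.
  by rewrite lte_add_pinfty ?ltry.
apply: integral_le_cstD => //.
- exact: probability_setT.
- exact: (measurable_tonelli1 leb mG).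
- by move=> w _; apply: integral_ge0.
- by move=> w _; apply: integral_ge0.
move=> w _.
have mGw : measurable_fun setT (fun t => \int[Pi]_y (cutI `[0%R, 1%R] f ((w, t), y) ^+ 2)%:E)%E.
  exact: (measurableT_comp mG (measurable_pair1 w)).
have -> : (\int[leb]_t \int[Pi]_y (cutI `[0%R, 1%R] f ((w, t), y) ^+ 2)%:E =
  \int[leb]_(t in `[0%R, 1%R]) \int[Pi]_y (cutI `[0%R, 1%R] f ((w, t), y) ^+ 2)%:E)%E.
  rewrite [RHS]integral_mkcond; apply: eq_integral => t _.
  rewrite patchE; case: ifPn => // tI; rewrite integral0_eq// => y _.
  by rewrite /cutI indicE/= (negbTE tI) mul0r expr0n.
apply: integral_le_cstD => //.
  exact: measurable_funTS.
move=> t t01.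
have -> : (\int[Pi]_y (cutI `[0%R, 1%R] f ((w, t), y) ^+ 2)%:E = \int[Pi]_y (`|f t w y| ^+ 2)%:E)%E.
  apply: eq_integral => y _; rewrite /cutI indicE/= mem_set// mul1r.
  by rewrite real_normK// num_real.
have a0 : (0 <= \int[Pi]_y (`|f t w y| ^+ 2)%:E)%E.
  by apply: integral_ge0 => y _; rewrite lee_fin exprn_ge0.
apply: (le_trans (poweR_ge_sub1 (r := p%:R / 2) a0 _)).
  by rewrite ler_pdivlMr// mul1r ler_nat.
apply: leeD => //; apply: leeDr.
by apply: integral_ge0 => y _; rewrite lee_fin exprn_ge0.
Qed.

End sup_norm.

(** * Moments of the compensated Poisson measure *)

Lemma Rintegral_cst_prob {R : realType} {d : measure_display}
    {Omega : measurableType d} (P : probability Omega R) (c : R) :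
  \int[P]_w c = c.
Proof.
rewrite Rintegral_cst// -[RHS]mulr1; congr (_ * _).
by rewrite -[RHS]/(fine 1%E); congr fine; exact: probability_setT.
Qed.

Section poisson_moments.
Context {R : realType} {d : measure_display} {Omega : measurableType d}.
Variable P : probability Omega R.

Definition poisson_law (X : Omega -> \bar R) (r : R) :=
  forall k : nat, P [set w | X w = k%:R%:E] = poisson_prob r 0%N [set k].

Variables (X : Omega -> \bar R) (r : R).
Hypotheses (mX : measurable_fun setT X) (r0 : 0 <= r) (hX : poisson_law X r).

Let A (k : nat) := [set w | X w = k%:R%:E].

Let mA k : measurable (A k).
Proof.
rewrite (_ : A k = X @^-1` [set k%:R%:E])// -[X in measurable X]setTI.
exact: mX.
Qed.

Let tA : trivIset setT A.
Proof.
apply/trivIsetP => i j _ _ ij; apply/seteqP; split => // w [/= Ai].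
rewrite /A/= in Ai *; rewrite Ai => -[/eqP].
by rewrite eqr_nat (negbTE ij).
Qed.

(** The Poisson weights by their formula, which at rate 0 also gives the Dirac mass at 0, as 0^0 =
    1. *)
Let q (k : nat) : R := r ^+ k / k`!%:R * expR (- r).

Let q_ge0 k : 0 <= q k.
Proof. by rewrite mulr_ge0 ?expR_ge0// divr_ge0// exprn_ge0. Qed.

Let PA k : P (A k) = (q k)%:E.
Proof.
rewrite hX /poisson_prob /q; case: ifPn => r1.
  by rewrite esum_set1 ?lee_fin ?poisson_pmf_ge0// /poisson_pmf r1.
have -> : r = 0 by apply/eqP; rewrite eq_le r0 andbT leNgt.
rewrite oppr0 expR0 mulr1 diracE; case: k => [|k].
  by rewrite mem_set// expr0 fact0 divr1.
by rewrite memNset// exprS !mul0r.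
Qed.

Let sum_q : (\sum_(0 <= k <oo) (q k)%:E = 1)%E.
Proof.
rewrite -(@probability_setT _ _ _ (poisson_prob r 0)).
rewrite (_ : [set: nat] = \bigcup_k [set k]); last first.
  by apply/seteqP; split => // k _; exists k.
rewrite measure_bigcup//; last first.
  by apply/trivIsetP => i j _ _ ij; apply/seteqP; split => // w [] /= -> /eqP; rewrite (negbTE ij).
rewrite [RHS](eq_eseriesl (Q := xpredT)); last by move=> k; rewrite in_setT.
by apply: eq_eseriesr => k _; rewrite -PA hX.
Qed.

Let PbigA : P (~` \bigcup_k A k) = 0%E.
Proof.
rewrite probability_setC; last exact: bigcup_measurable.
rewrite measure_bigcup//.
rewrite (eq_eseriesl (Q := xpredT)); last by move=> k; rewrite in_setT.
transitivity (1 - \sum_(0 <= k <oo) (q k)%:E)%E; last by rewrite sum_q subee.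
by congr (1 - _)%E; apply: eq_eseriesr => k _; exact: PA.
Qed.

Lemma poisson_law_ae : {ae P, forall w, exists k : nat, X w = k%:R%:E}.
Proof.
exists (~` \bigcup_k A k); split.
- by apply: measurableC; exact: bigcup_measurable.
- exact: PbigA.
- by move=> w /= H [k _ /= Ak]; apply: H; exists k.
Qed.

Let ge0_integral_poisson (phi : R -> R) : measurable_fun setT phi ->
  (forall x, 0 <= phi x) ->
  (\int[P]_w (phi (fine (X w)))%:E = \sum_(0 <= k <oo) (phi k%:R * q k)%:E)%E.
Proof.
move=> mphi phi0.
have mf : measurable_fun setT (fun w => (phi (fine (X w)))%:E).
  apply/measurable_EFinP; apply: (measurableT_comp mphi).
  exact: measurableT_comp.
have mB : measurable (\bigcup_k A k) by exact: bigcup_measurable.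
have -> : (\int[P]_w (phi (fine (X w)))%:E =
    \int[P]_(w in \bigcup_k A k) (phi (fine (X w)))%:E)%E.
  rewrite (@ge0_negligible_integral _ _ _ P setT (~` \bigcup_k A k))//.
  - by rewrite setTD setCK.
  - exact: measurableC.
  - by move=> w _; rewrite lee_fin.
rewrite ge0_integral_bigcup//; [|exact: measurable_funTS|by move=> w _; rewrite lee_fin].
apply: eq_eseriesr => k _.
rewrite (eq_integral (fun=> (phi k%:R)%:E)); last first.
  by move=> w; rewrite inE => /= ->.
by rewrite integral_cst// EFinM; congr (_ * _)%E; exact: PA.
Qed.

Let sum_shift (u : nat -> R) : u 0%N = 0 -> (forall k, 0 <= u k) ->
  (\sum_(0 <= k <oo) (u k)%:E = \sum_(0 <= k <oo) (u k.+1)%:E)%E.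
Proof.
move=> u0 up; rewrite (nneseries_split 0 1); last by move=> k _; rewrite lee_fin.
rewrite big_nat1 u0 add0e add0n.
rewrite -(nneseries_addn 1); last by move=> k; rewrite lee_fin.
by apply: eq_eseriesr => k _; rewrite addn1.
Qed.

Let qS k : k.+1%:R * q k.+1 = r * q k.
Proof.
rewrite /q exprS factS natrM invfM.
have k1 : k.+1%:R != 0 :> R by rewrite pnatr_eq0.
have k2 : k`!%:R != 0 :> R by rewrite pnatr_eq0 -lt0n fact_gt0.
by field; rewrite k2 nat1r k1.
Qed.

(** The absolute values serve twice: the integrand becomes nonnegative, and the finite result proves
    integrability. They disappear almost surely, where X is a natural number. *)
Let mom1 : (\int[P]_w (`|fine (X w)|)%:E = r%:E)%E.
Proof.
rewrite (ge0_integral_poisson (phi := fun x => `|x|))//.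
rewrite sum_shift; [|by rewrite normr0 mul0r|by move=> k; rewrite mulr_ge0].
under eq_eseriesr do rewrite normr_nat qS EFinM.
rewrite nneseriesZl//; last by move=> k _; rewrite lee_fin.
by rewrite sum_q mule1.
Qed.

(** The factorial moment suits the weights, since k (k - 1) q_k = r^2 q_(k-2): two shifts of the
    series suffice. The variance comes from (n - r)^2 = n (n - 1) + (1 - 2 r) n + r^2. *)
Let mom2 : (\int[P]_w (`|fine (X w) * (fine (X w) - 1)|)%:E = (r ^+ 2)%:E)%E.
Proof.
rewrite (ge0_integral_poisson (phi := fun x => `|x * (x - 1)|))//; last first.
  apply: measurableT_comp => //; apply: measurable_funM => //.
  exact: measurable_funB.
rewrite sum_shift; [|by rewrite mul0r normr0 mul0r|by move=> k; rewrite mulr_ge0].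
rewrite sum_shift; [|by rewrite subrr mulr0 normr0 mul0r|by move=> k; rewrite mulr_ge0].
have e k : `|k.+2%:R * (k.+2%:R - 1)| * q k.+2 = r ^+ 2 * q k.
  have -> : k.+2%:R - 1 = k.+1%:R :> R by rewrite -[k.+2%:R]natr1 addrK.
  by rewrite -natrM normr_nat natrM (mulrC k.+2%:R) -mulrA qS mulrCA qS mulrA -expr2.
under eq_eseriesr do rewrite e EFinM.
rewrite nneseriesZl//; last by move=> k _; rewrite lee_fin.
by rewrite sum_q mule1.
Qed.

Definition centered w := fine (X w) - r.

Lemma poisson_centered : [/\ sqint P centered, \int[P]_w centered w = 0 &
  ip P centered centered = r].
Proof.
have mN : measurable_fun setT (fun w => fine (X w)) by exact: measurableT_comp.
pose n w := fine (X w).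
have i1 : P.-integrable setT (EFin \o n).
  apply/integrableP; split; first exact/measurable_EFinP.
  by rewrite (_ : (fun x => _) = (fun w => (`|fine (X w)|)%:E))// mom1 ltry.
have i2 : P.-integrable setT (EFin \o (fun w => n w * (n w - 1))).
  apply/integrableP; split.
    apply/measurable_EFinP/measurable_funM => //; exact: measurable_funB.
  by rewrite (_ : (fun x => _) = (fun w => (`|fine (X w) * (fine (X w) - 1)|)%:E))// mom2 ltry.
have ic c : P.-integrable setT (EFin \o (fun=> c : R)) by exact: finite_measure_integrable_cst.
have e1 : \int[P]_w n w = r.
  rewrite -[RHS]/(fine r%:E) -mom1; congr fine.
  apply: ae_eq_integral => //; [exact/measurable_EFinP|by apply/measurable_EFinP; exact: measurableT_comp|].
  apply: filterS poisson_law_ae => w [k Xk] _ /=.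
  by rewrite /n Xk/= normr_nat.
have e2 : \int[P]_w (n w * (n w - 1)) = r ^+ 2.
  rewrite -[RHS]/(fine (r ^+ 2)%:E) -mom2; congr fine.
  have mm : measurable_fun setT (fun w => n w * (n w - 1)).
    by apply/measurable_funM => //; exact: measurable_funB.
  apply: ae_eq_integral => //; [exact/measurable_EFinP|by apply/measurable_EFinP; exact: measurableT_comp|].
  apply: filterS poisson_law_ae => w [k Xk] _ /=.
  rewrite /n Xk/=; case: k Xk => [|k] _; first by rewrite !mul0r normr0.
  by rewrite -natr1 addrK natr1 -natrM normr_nat.
have c1 : P.-integrable setT (EFin \o centered).
  have := integrableB measurableT i1 (ic r).
  by apply: eq_integrable.
have c2E w : centered w * centered w = n w * (n w - 1) + (1 - 2 * r) * n w + r ^+ 2.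
  by rewrite /centered /n; ring.
have i3 : P.-integrable setT (EFin \o (fun w => n w * (n w - 1) + (1 - 2 * r) * n w)).
  have := integrableD measurableT i2 (integrableZl measurableT (1 - 2 * r) i1).
  by apply: eq_integrable.
have i4 : P.-integrable setT (EFin \o (fun w => n w * (n w - 1) + (1 - 2 * r) * n w + r ^+ 2)).
  have := integrableD measurableT i3 (ic (r ^+ 2)).
  by apply: eq_integrable.
have i5 : P.-integrable setT (EFin \o (fun w => (1 - 2 * r) * n w)).
  exact: (integrableZl measurableT (1 - 2 * r) i1).
split.
- split; first by apply: measurable_funB.
  under eq_integral do rewrite expr2 c2E.
  by apply: integrable_lty => //; exact: i4.
- by rewrite /centered RintegralB// e1 Rintegral_cst_prob subrr.
- rewrite /ip; under eq_Rintegral do rewrite c2E.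
  rewrite RintegralD//.
  by rewrite RintegralD// RintegralZl// e1 e2 Rintegral_cst_prob; ring.
Qed.

End poisson_moments.

(** * Expectation of products of independent variables, almost everywhere equality *)

Section independence.
Context {R : realType} {d : measure_display} {Omega : measurableType d}.
Variable P : probability Omega R.

Lemma sqint_cst (c : R) : sqint P (fun=> c).
Proof.
split=> //; rewrite integral_cst//; apply: lte_mul_pinfty => //.
by rewrite lee_fin sqr_ge0.
by rewrite ltey_eq; apply/orP; left; exact: fin_num_measure.
Qed.

Lemma sqint_prob_integrable (f : Omega -> R) : sqint P f ->
  P.-integrable setT (EFin \o f).
Proof.
move=> sf; have := sqint_integrable sf (sqint_cst 1).
by apply: eq_integrable => // w _; rewrite mulr1.
Qed.

Variables c Y : Omega -> R.
Hypotheses (ic : P.-integrable setT (EFin \o c))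
  (iY : P.-integrable setT (EFin \o Y))
  (icY : P.-integrable setT (fun w => (c w * Y w)%:E)).
Hypothesis indep : forall A B : set R, measurable A -> measurable B ->
  P (c @^-1` A `&` Y @^-1` B) = (P (c @^-1` A) * P (Y @^-1` B))%E.

(* By uniqueness of product measures, the joint law is the product of the laws. *)
Lemma ip_indep : ip P c Y = (\int[P]_w c w) * (\int[P]_w Y w).
Proof.
have mc : measurable_fun setT c by apply/measurable_EFinP; exact: measurable_int ic.
have mY : measurable_fun setT Y by apply/measurable_EFinP; exact: measurable_int iY.
pose cm : {mfun Omega >-> R} := HB.pack c (isMeasurableFun.Build _ _ _ _ c mc).
pose Ym : {mfun Omega >-> R} := HB.pack Y (isMeasurableFun.Build _ _ _ _ Y mY).
have mV : measurable_fun setT (fun w => (c w, Y w)) by exact: measurable_fun_pair.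
pose Vm : {mfun Omega >-> (R * R)%type} := HB.pack (fun w => (c w, Y w)) (isMeasurableFun.Build _ _ _ _ _ mV).
pose Dc := distribution P cm; pose DY := distribution P Ym; pose DV := distribution P Vm.
pose g (z : R * R) := z.1 * z.2.
have mg : measurable_fun setT (fun z => (g z)%:E).
  by apply/measurable_EFinP; exact: measurable_funM.
have DVE A : measurable A -> DV A = prodm Dc DY A.
  by move=> mA; apply/esym/product_measure_unique.
have ig : P.-integrable setT ((fun z => (g z)%:E) \o Vm) by exact: icY.
have igD : (prodm Dc DY).-integrable setT (EFin \o g).
  apply/integrableP; split => //.
  have -> : (\int[prodm Dc DY]_z `|(EFin \o g) z| = \int[DV]_z `|(EFin \o g) z|)%E.
    by apply: eq_measure_integral => A mA _; rewrite [RHS]DVE.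
  by have /integrableP[] := integrable_pushforward mV mg ig measurableT.
have EY : \int[DY]_y y = \int[P]_w Y w.
  congr fine; rewrite /DY (integral_distribution (X := Ym))//.
have Ec : \int[Dc]_y y = \int[P]_w c w.
  congr fine; rewrite /Dc (integral_distribution (X := cm))//.
have mid : measurable_fun setT (EFin \o (id : R -> R)) by exact/measurable_EFinP.
have iDY : DY.-integrable setT (EFin \o id).
  exact: (integrable_pushforward mY mid iY measurableT).
have iDc : Dc.-integrable setT (EFin \o id).
  exact: (integrable_pushforward mc mid ic measurableT).
transitivity (\int[DV]_z g z).
  by congr fine; rewrite /DV (integral_distribution (X := Vm)).
transitivity (\int[prodm Dc DY]_z g z).
  by congr fine; apply: eq_measure_integral => A mA _; exact: DVE.
rewrite (Rintegral_prod1 igD).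
under eq_Rintegral do rewrite RintegralZl// EY.
by rewrite RintegralZr// Ec.
Qed.

End independence.

Section almost_everywhere.
Context {d} {T : measurableType d} {R : realType}.
Variable m : {measure set T -> \bar R}.

Lemma ae_sqint (f g : T -> R) : measurable_fun setT f -> sqint m g ->
  {ae m, forall x, f x = g x} ->
  sqint m f /\ ip m (fun x => f x - g x) (fun x => f x - g x) = 0.
Proof.
move=> mf [mg Ig] fg.
have sqE : (\int[m]_x (f x ^+ 2)%:E = \int[m]_x (g x ^+ 2)%:E)%E.
  apply: ge0_ae_eq_integral => //.
  - by apply/measurable_EFinP; exact: measurable_funX.
  - by apply/measurable_EFinP; exact: measurable_funX.
  - by move=> x _; rewrite lee_fin sqr_ge0.
  - by move=> x _; rewrite lee_fin sqr_ge0.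
  - by apply: filterS fg => x -> _.
split; first by split=> //; rewrite sqE.
rewrite /ip /Rintegral (@ae_eq_integral _ _ _ m setT (cst 0%E)) ?integral0//.
  apply/measurable_EFinP; apply: measurable_funM; exact: measurable_funB.
by apply: filterS fg => x -> _; rewrite subrr mulr0.
Qed.

Lemma ae_ip (f g h : T -> R) : sqint m f -> sqint m g -> sqint m h ->
  {ae m, forall x, f x = g x} -> ip m f h = ip m g h.
Proof.
move=> sf sg sh fg; apply: ip_congr => //.
by have [_] := ae_sqint sf.1 sg fg.
Qed.

Lemma sqint_bounded (c f : T -> R) : measurable_fun setT c ->
  (exists C, forall x, `|c x| <= C) -> sqint m f -> sqint m (fun x => c x * f x).
Proof.
move=> mc [C hC] sf; apply: (sqint_le _ (sqintZ C sf)).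
  by apply: measurable_funM => //; exact: sf.1.
by move=> x; rewrite !normrM ler_wpM2r// (le_trans (hC x))// ler_norm.
Qed.

Lemma ip_mul (c f g : T -> R) :
  ip m (fun x => c x * f x) g = ip m f (fun x => c x * g x).
Proof. by rewrite /ip; apply: eq_Rintegral => x _; ring. Qed.

End almost_everywhere.

Lemma ip_mulDD {d} {T : measurableType d} {R : realType}
    (m : {measure set T -> \bar R}) (c f g h k : T -> R) :
  measurable_fun setT c -> (exists C, forall x, `|c x| <= C) ->
  sqint m f -> sqint m g -> sqint m h -> sqint m k ->
  ip m (fun x => c x * (f x + g x)) (fun x => h x + k x) =
  ip m (fun x => c x * f x) h + ip m (fun x => c x * f x) k +
  (ip m (fun x => c x * g x) h + ip m (fun x => c x * g x) k).
Proof.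
move=> mc bc sf sg sh sk.
have -> : (fun x => c x * (f x + g x)) = (fun x => c x * f x + c x * g x).
  by apply/funext => x; rewrite mulrDr.
have scf := sqint_bounded mc bc sf; have scg := sqint_bounded mc bc sg.
by rewrite ipDl ?ipDr//; exact: sqintD.
Qed.

Lemma lebesgue_measure_oc {R : realType} (a b : R) : a <= b ->
  lebesgue_measure `]a, b]%classic = (b - a)%:E.
Proof.
move=> ab; rewrite lebesgue_measure_itv/= lte_fin.
by case: ltgtP ab => // -> _; rewrite subrr.
Qed.

(** * Covariance of the increments of the compensated measure *)

Section compensated_measure.
Context {R : realType} {d : measure_display} {Omega : measurableType d} {l : nat}.
Variables (P : probability Omega R) (F : R -> set (set Omega)).
Variable Pi : {sigma_finite_measure set (Rvec R l) -> \bar R}.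
Variable N : R.-ker Omega ~> (R * Rvec R l)%type.
Hypothesis hF : right_continuous_filtration F.
Hypothesis hN : adapted_poisson_measure P F Pi N.

Local Notation leb := (@lebesgue_measure R).

(** The increment has the form found in [simple_integral], from which its adaptedness is read off.
    It equals N (]a, b] * A) minus its mean only where nu(b, A) is finite, hence almost surely; law
    and independence come from that second form. *)
Definition cpm (a b : R) (A : set (Rvec R l)) (w : Omega) : R :=
  nu_tilde Pi N b A w - nu_tilde Pi N a A w.

Let X (a b : R) (A : set (Rvec R l)) (w : Omega) : \bar R := N w (`]a, b] `*` A).

Let measurable_X a b A : measurable A -> measurable_fun setT (X a b A).
Proof. by move=> mA; apply: measurable_kernel; exact: measurableX. Qed.

Let rate a b A : 0 <= a -> a <= b -> b <= 1 -> measurable A -> (Pi A < +oo)%E ->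
  ((lebesgue_measure \x Pi) (`]a, b] `*` A) = ((b - a) * fine (Pi A))%:E)%E.
Proof.
move=> a0 ab b1 mA fA.
rewrite product_measure1E// EFinM fineK; last by rewrite ge0_fin_numE.
by congr (_ * _)%E; exact: lebesgue_measure_oc.
Qed.

Let poisson_X a b A : 0 <= a -> a <= b -> b <= 1 -> measurable A -> (Pi A < +oo)%E ->
  poisson_law P (X a b A) ((b - a) * fine (Pi A)).
Proof.
move=> a0 ab b1 mA fA k; have [[hp _] _ _] := hN.
rewrite hp//; first by rewrite rate.
- exact: measurableX.
- move=> [s y] [/= + _]; rewrite !in_itv/= => /andP[h1 h2]; split => //=.
  by rewrite (le_lt_trans a0 h1) (le_trans h2).
- by rewrite rate// ltry.
Qed.

Let rate_ge0 a b (A : set (Rvec R l)) : a <= b -> 0 <= (b - a) * fine (Pi A).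
Proof. by move=> ab; rewrite mulr_ge0 ?subr_ge0// fine_ge0. Qed.

Let X_fin a b A : 0 <= a -> a <= b -> b <= 1 -> measurable A -> (Pi A < +oo)%E ->
  {ae P, forall w, X a b A w \is a fin_num}.
Proof.
move=> a0 ab b1 mA fA.
have := poisson_law_ae (measurable_X a b mA) (rate_ge0 A ab) (poisson_X a0 ab b1 mA fA).
by apply: filterS => w [k ->].
Qed.

Let cpm_ae a b A : 0 <= a -> a <= b -> b <= 1 -> measurable A -> (Pi A < +oo)%E ->
  {ae P, forall w, cpm a b A w = centered (X a b A) ((b - a) * fine (Pi A)) w}.
Proof.
move=> a0 ab b1 mA fA.
have b0 : 0 <= b by exact: le_trans ab.
have := X_fin (lexx 0) b0 b1 mA fA; apply: filterS => w fin.
rewrite /cpm /nu_tilde /centered /nu -/(X 0 b A w) -/(X 0 a A w).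
have XE : X 0 b A w = (X 0 a A w + X a b A w)%E.
  rewrite /X -measureU//=.
  - congr (N w _); apply/seteqP; split => -[s y] /=; rewrite !in_itv/=.
      move=> [/andP[s0 sb] Ay]; have [sa|sa] := leP s a; first by left; rewrite s0.
      by right; rewrite sb.
    move=> [[/andP[s0 sa] Ay]|[/andP[sa sb] Ay]]; split => //; apply/andP; split => //.
      exact: le_trans sa ab.
    exact: le_lt_trans sa.
  - exact: measurableX.
  - exact: measurableX.
  - apply/seteqP; split => // -[s y] [[/= h1 _] [/= h2 _]].
    by move: h1 h2; rewrite !in_itv/= => /andP[_ sa] /andP[+ _]; rewrite ltNge sa.
move: fin; rewrite XE fin_numD => /andP[fin1 fin2].
by rewrite fineD//; ring.
Qed.

Lemma cpm_measurable a b A : 0 <= a -> a <= b -> b <= 1 -> measurable A ->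
  @measurable_fun _ _ (g_sigma_algebraType (F b)) R setT (cpm a b A).
Proof.
move=> a0 ab b1 mA; have [_ hm _] := hN.
have b0 : 0 <= b by exact: le_trans ab.
have mt t : 0 <= t -> t <= b -> @measurable_fun _ _ (g_sigma_algebraType (F b)) R setT (nu_tilde Pi N t A).
  move=> t0 tb; apply: measurable_funB => //.
  apply: measurableT_comp => //.
  apply: (filtration_measurable_fun hF t0 tb b1).
  by apply: hm => //; rewrite t0 (le_trans tb).
by apply: measurable_funB; apply: mt.
Qed.

Lemma cpm_moments a b A : 0 <= a -> a <= b -> b <= 1 -> measurable A ->
  (Pi A < +oo)%E ->
  sqint P (cpm a b A) /\ ip P (cpm a b A) (cpm a b A) = (b - a) * fine (Pi A).
Proof.
move=> a0 ab b1 mA fA.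
have [sc _ vc] := poisson_centered (measurable_X a b mA) (rate_ge0 A ab) (poisson_X a0 ab b1 mA fA).
have mc : measurable_fun setT (cpm a b A).
  apply: (@filtration_measurable_funT _ _ _ _ hF b); first by rewrite b1 (le_trans a0).
  exact: cpm_measurable.
have ae := cpm_ae a0 ab b1 mA fA.
have [s z] := ae_sqint mc sc ae; split => //.
by rewrite (ip_congr s sc s z) ipC (ip_congr s sc sc z).
Qed.

Lemma cpm_self a A w : cpm a a A w = 0.
Proof. by rewrite /cpm subrr. Qed.

Lemma cpm_split a b c A w : cpm a c A w = cpm a b A w + cpm b c A w.
Proof. by rewrite /cpm; ring. Qed.

(** V is independent of the increment over ]s, t], whose mean is 0. Independence is assumed for s <
    t only; for s = t the increment is 0. *)
Lemma cpm_orth s t A (V : Omega -> R) : 0 <= s -> s <= t -> t <= 1 ->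
  measurable A -> (Pi A < +oo)%E ->
  @measurable_fun _ _ (g_sigma_algebraType (F s)) R setT V -> sqint P V ->
  ip P V (cpm s t A) = 0.
Proof.
move=> s0 st t1 mA fA mV sV.
have [st1|] := ltP s t; last first.
  move=> ts; have -> : t = s by apply/eqP; rewrite eq_le ts st.
  by rewrite /ip; under eq_Rintegral do rewrite cpm_self mulr0; rewrite Rintegral_cst_prob.
have [sc ec vc] := poisson_centered (measurable_X s t mA) (rate_ge0 A st) (poisson_X s0 st t1 mA fA).
have [sZ _] := cpm_moments s0 st t1 mA fA.
rewrite ipC (ae_ip sZ sc sV (cpm_ae s0 st t1 mA fA)) ipC.
have s01 : 0 <= s <= 1 by rewrite s0 (le_trans st).
rewrite ip_indep ?ec ?mulr0//.
- exact: sqint_prob_integrable.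
- exact: sqint_prob_integrable.
- exact: sqint_integrable.
move=> B C mB mC; have [_ _ hi] := hN.
have := hi s t A s0 st1 t1 mA (V @^-1` B) ((fun x => fine x - (t - s) * fine (Pi A)) @^-1` C).
apply.
  by apply/(filtration_measurable hF _ s01); rewrite -[X in measurable X]setTI; exact: mV.
rewrite -[X in measurable X]setTI; apply: (measurable_funB (f := fine)) => //.
Qed.

(** The coefficient c is independent of the square of the centered increment, whose expectation is
    the Poisson variance. *)
Lemma cpm_sqr s t A (c : Omega -> R) : 0 <= s -> s <= t -> t <= 1 ->
  measurable A -> (Pi A < +oo)%E ->
  @measurable_fun _ _ (g_sigma_algebraType (F s)) R setT c ->
  (exists C, forall w, `|c w| <= C) ->
  ip P (fun w => c w * cpm s t A w) (cpm s t A) =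
  (\int[P]_w c w) * ((t - s) * fine (Pi A)).
Proof.
move=> s0 st t1 mA fA mc bc.
have [st1|] := ltP s t; last first.
  move=> ts; have -> : t = s by apply/eqP; rewrite eq_le ts st.
  rewrite /ip; under eq_Rintegral do rewrite cpm_self mulr0; rewrite Rintegral_cst_prob.
  by rewrite subrr mul0r mulr0.
have s01 : 0 <= s <= 1 by rewrite s0 (le_trans st).
have mcT := filtration_measurable_funT hF s01 mc.
have [sc ec vc] := poisson_centered (measurable_X s t mA) (rate_ge0 A st) (poisson_X s0 st t1 mA fA).
set Z := centered _ _ in sc ec vc.
have [sZ _] := cpm_moments s0 st t1 mA fA.
have ae := cpm_ae s0 st t1 mA fA.
have scZ := sqint_bounded mcT bc sZ.
have scZ' := sqint_bounded mcT bc sc.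
rewrite ipC (ae_ip sZ sc scZ ae) ipC ip_mul (ae_ip sZ sc scZ' ae) -vc -ip_mul.
have -> : ip P (fun w => c w * Z w) Z = ip P c (fun w => Z w * Z w).
  by rewrite /ip; apply: eq_Rintegral => w _; rewrite mulrA.
rewrite ip_indep//.
- have := sqint_bounded mcT bc (sqint_cst P 1) => /sqint_prob_integrable.
  by apply: eq_integrable => // w _; rewrite /= mulr1.
- exact: (sqint_integrable sc sc).
- have := sqint_integrable scZ' sc.
  by apply: eq_integrable => // w _; rewrite /= mulrA.
move=> B C mB mC; have [_ _ hi] := hN.
have := hi s t A s0 st1 t1 mA (c @^-1` B) ((fun x => (fine x - (t - s) * fine (Pi A)) * (fine x - (t - s) * fine (Pi A))) @^-1` C).
apply.
  by apply/(filtration_measurable hF _ s01); rewrite -[X in measurable X]setTI; exact: mc.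
rewrite -[X in measurable X]setTI.
have mf : measurable_fun setT (fun x : \bar R => fine x - (t - s) * fine (Pi A)).
  by apply: (measurable_funB (f := fine)).
exact: (measurable_funM mf mf).
Qed.

Lemma cpm_setU a b A B : 0 <= a -> a <= b -> b <= 1 -> measurable A -> measurable B ->
  (Pi A < +oo)%E -> (Pi B < +oo)%E -> A `&` B = set0 ->
  {ae P, forall w, cpm a b (A `|` B) w = cpm a b A w + cpm a b B w}.
Proof.
move=> a0 ab b1 mA mB fA fB AB.
have b0 : 0 <= b by exact: le_trans ab.
have a1 : a <= 1 by exact: le_trans b1.
have PU : (Pi (A `|` B) = Pi A + Pi B)%E by rewrite measureU.
have Xa := X_fin (lexx 0) a0 a1 mA fA; have Xb := X_fin (lexx 0) b0 b1 mA fA.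
have Ya := X_fin (lexx 0) a0 a1 mB fB; have Yb := X_fin (lexx 0) b0 b1 mB fB.
have nuU t w : X 0 t A w \is a fin_num -> X 0 t B w \is a fin_num ->
    nu_tilde Pi N t (A `|` B) w = nu_tilde Pi N t A w + nu_tilde Pi N t B w.
  move=> f1 f2; rewrite /nu_tilde /nu PU.
  have -> : N w (`]0, t] `*` (A `|` B)) = (X 0 t A w + X 0 t B w)%E.
    rewrite /X -measureU//=; first by congr (N w _); apply/seteqP; split => -[s y]/=; tauto.
    - exact: measurableX.
    - exact: measurableX.
    - apply/seteqP; split => // -[s y] [[/= _ h1] [/= _ h2]].
      by have : (A `&` B) y by []; rewrite AB.
  rewrite (fineD f1 f2) fineD ?ge0_fin_numE//; rewrite /X; ring.
apply: filterS (filterI (filterI Xa Xb) (filterI Ya Yb)) => w [[xa xb] [ya yb]].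
by rewrite /cpm !nuU//; ring.
Qed.

(** By polarization: for disjoint C and D the second moment over their union is the sum of the two
    second moments, so the cross term vanishes. Then A and B are both split along their
    intersection. *)
Lemma cpm_cov s t A B (c : Omega -> R) : 0 <= s -> s <= t -> t <= 1 ->
  measurable A -> (Pi A < +oo)%E -> measurable B -> (Pi B < +oo)%E ->
  @measurable_fun _ _ (g_sigma_algebraType (F s)) R setT c ->
  (exists C, forall w, `|c w| <= C) ->
  ip P (fun w => c w * cpm s t A w) (cpm s t B) =
  (\int[P]_w c w) * ((t - s) * fine (Pi (A `&` B))).
Proof.
move=> s0 st t1 mA fA mB fB mc bc.
have s01 : 0 <= s <= 1 by rewrite s0 (le_trans st).
have mcT := filtration_measurable_funT hF s01 mc.
have fS C D : measurable C -> measurable D -> C `<=` D -> (Pi D < +oo)%E -> (Pi C < +oo)%E.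
  by move=> mC mD CD; apply: le_lt_trans; rewrite le_measure ?inE.
have sM C : measurable C -> (Pi C < +oo)%E -> sqint P (cpm s t C).
  by move=> mC fC; have [] := cpm_moments s0 st t1 mC fC.
have sc C : measurable C -> (Pi C < +oo)%E -> sqint P (fun w => c w * cpm s t C w).
  by move=> mC fC; apply: sqint_bounded => //; exact: sM.
have orth C D : measurable C -> measurable D -> (Pi C < +oo)%E -> (Pi D < +oo)%E ->
    C `&` D = set0 -> ip P (fun w => c w * cpm s t C w) (cpm s t D) = 0.
  move=> mC mD fC fD CD.
  have mU : measurable (C `|` D) by exact: measurableU.
  have PU : (Pi (C `|` D) = Pi C + Pi D)%E by rewrite measureU.
  have fU : (Pi (C `|` D) < +oo)%E by rewrite PU lte_add_pinfty.
  have ae := cpm_setU s0 st t1 mC mD fC fD CD.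
  have sD := sqintD (sM _ mC fC) (sM _ mD fD).
  have := cpm_sqr s0 st t1 mU fU mc bc.
  rewrite ipC (ae_ip (sM _ mU fU) sD (sc _ mU fU) ae) ipC ip_mul.
  rewrite (ae_ip (sM _ mU fU) sD (sqint_bounded mcT bc sD) ae).
  rewrite -ip_mul ip_mulDD ?cpm_sqr//; try exact: sM.
  rewrite [ip P (fun w => c w * cpm s t D w) _]ip_mul [ip P (cpm s t D) _]ipC.
  by rewrite PU fineD ?ge0_fin_numE// => h; lra.
have mI : measurable (A `&` B) by exact: measurableI.
have mAB : measurable (A `\` B) by exact: measurableD.
have mBA : measurable (B `\` A) by exact: measurableD.
have fI : (Pi (A `&` B) < +oo)%E by apply: (fS _ A) => //; exact: subIsetl.
have fAB : (Pi (A `\` B) < +oo)%E by apply: (fS _ A) => //; exact: subDsetl.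
have fBA : (Pi (B `\` A) < +oo)%E by apply: (fS _ B) => //; exact: subDsetl.
have aeA : {ae P, forall w, cpm s t A w = cpm s t (A `&` B) w + cpm s t (A `\` B) w}.
  have := cpm_setU s0 st t1 mI mAB fI fAB; rewrite setUIDK; apply.
  by apply/seteqP; split => // y /=; tauto.
have aeB : {ae P, forall w, cpm s t B w = cpm s t (A `&` B) w + cpm s t (B `\` A) w}.
  rewrite setIC in mI fI *.
  have := cpm_setU s0 st t1 mI mBA fI fBA; rewrite setUIDK; apply.
  by apply/seteqP; split => // y /=; tauto.
have sA' := sqintD (sM _ mI fI) (sM _ mAB fAB).
have sB' := sqintD (sM _ mI fI) (sM _ mBA fBA).
rewrite ipC (ae_ip (sM _ mB fB) sB' (sc _ mA fA) aeB) ipC ip_mul.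
rewrite (ae_ip (sM _ mA fA) sA' (sqint_bounded mcT bc sB') aeA) -ip_mul.
rewrite ip_mulDD; try exact: sM; try done.
rewrite cpm_sqr// !orth// ?addr0//.
- by apply/seteqP; split => // y /= [[? ?] []].
- by apply/seteqP; split => // y /= [[? ?] []].
- by apply/seteqP; split => // y /= [[? ?] []].
Qed.

End compensated_measure.

(** * The isometry of the stochastic integral *)

Lemma ip_tensor {d1 d2} {T1 : measurableType d1} {T2 : measurableType d2}
    {R : realType} (m1 : {sigma_finite_measure set T1 -> \bar R})
    (m2 : {sigma_finite_measure set T2 -> \bar R}) (f f' : T1 -> R) (g g' : T2 -> R) :
  sqint m1 f -> sqint m2 g -> sqint m1 f' -> sqint m2 g' ->
  ip (prodm m1 m2) (fun z => f z.1 * g z.2) (fun z => f' z.1 * g' z.2) =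
  ip m1 f f' * ip m2 g g'.
Proof.
move=> sf sg sf' sg'; rewrite ip_prod1; [|exact: sqint_prod_indep|exact: sqint_prod_indep].
under eq_Rintegral => x _.
  rewrite /= ipZl//; last exact: sqintZ.
  rewrite ipZr// mulrA.
  over.
by rewrite RintegralZr//; exact: sqint_integrable.
Qed.

Lemma sqint_indic {d} {T : measurableType d} {R : realType}
    (m : {measure set T -> \bar R}) (A : set T) : measurable A ->
  (m A < +oo)%E -> sqint m (\1_A : T -> R).
Proof.
move=> mA fA; split; first exact: measurable_indic.
under eq_integral => x _.
  rewrite (_ : (\1_A x ^+ 2 : R) = \1_A x); last by rewrite indicE; case: (_ \in _); rewrite ?expr1n ?expr0n.
  over.
by rewrite integral_indic// setIT.
Qed.

Lemma ip_indic {d} {T : measurableType d} {R : realType}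
    (m : {measure set T -> \bar R}) (A B : set T) : measurable A -> measurable B ->
  ip m (\1_A : T -> R) (\1_B) = fine (m (A `&` B)).
Proof.
move=> mA mB; rewrite /ip.
under eq_Rintegral do rewrite -[_ * _]/((\1_A \* \1_B) _) -indicI.
by rewrite /Rintegral integral_indic ?setIT//; exact: measurableI.
Qed.

Section simple_isometry.
Context {R : realType} {d : measure_display} {Omega : measurableType d} {l : nat}.
Variables (P : probability Omega R) (F : R -> set (set Omega)).
Variable Pi : {sigma_finite_measure set (Rvec R l) -> \bar R}.
Variable N : R.-ker Omega ~> (R * Rvec R l)%type.
Hypothesis hF : right_continuous_filtration F.
Hypothesis hN : adapted_poisson_measure P F Pi N.

Local Notation leb := (@lebesgue_measure R).
Local Notation mP := (prodm P leb).
Local Notation mI := (prodm mP Pi).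
Local Notation cpm := (cpm Pi N).
Local Notation adm := (admissible F Pi).

Let adm01 e : adm e -> 0 <= el_start e <= 1.
Proof. by move=> [[h1 h2 h3] _ _ _ _]; rewrite h1 (le_trans h2). Qed.

Let adm_coefT e : adm e -> measurable_fun setT (el_coef e).
Proof.
by move=> ae; have [_ mc _ _ _] := ae; exact: (filtration_measurable_funT hF (adm01 ae) mc).
Qed.

Let sqint_coef e : adm e -> sqint P (el_coef e).
Proof.
move=> ae; have [_ _ bc _ _] := ae.
have := sqint_bounded (adm_coefT ae) bc (sqint_cst P 1).
by under eq_fun do rewrite mulr1.
Qed.

Let sqint_term e : adm e ->
  sqint P (fun w => el_coef e w * cpm (el_start e) (el_stop e) (el_set e) w).
Proof.
move=> ae; have [[h1 h2 h3] _ bc mA fA] := ae.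
apply: sqint_bounded => //; first exact: adm_coefT.
by have [] := cpm_moments hF hN h1 h2 h3 mA fA.
Qed.

(** As a <= a', the product of the coefficients is known at time a'. With v = min (b, b'), the
    interval ]a, b] is cut at a' and v, and ]a', b'] at v. Increments over successive intervals are
    orthogonal, one of ]v, b] and ]v, b'] is empty, and only the common part ]a', v] contributes,
    through [cpm_cov]. *)
Let cov_ordered e e' : adm e -> adm e' -> el_start e <= el_start e' ->
  ip P (fun w => el_coef e w * cpm (el_start e) (el_stop e) (el_set e) w)
       (fun w => el_coef e' w * cpm (el_start e') (el_stop e') (el_set e') w) =
  ip P (el_coef e) (el_coef e') *
  fine (leb (`]el_start e, el_stop e] `&` `]el_start e', el_stop e'])) *
  fine (Pi (el_set e `&` el_set e')).
Proof.
move=> ae ae'.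
have mcT := adm_coefT ae; have mcT' := adm_coefT ae'.
have [[a0 ab b1] mc [C hC] mA fA] := ae; have [[a0' ab' b1'] mc' [C' hC'] mA' fA'] := ae'.
have a1 : el_start e <= 1 by exact: le_trans b1.
have a1' : el_start e' <= 1 by exact: le_trans b1'.
move: (el_coef e) (el_start e) (el_stop e) (el_set e) (el_coef e') (el_start e') (el_stop e') (el_set e')
  a1 a1' mcT mcT' a0 ab b1 mc hC mA fA a0' ab' b1' mc' hC' mA' fA' => {ae ae' e e'}.
move=> c a b A c' a' b' A' a1 a1' mcT mcT' a0 ab b1 mc hC mA fA a0' ab' b1' mc' hC' mA' fA' aa'.
have b0' : 0 <= b' by exact: le_trans ab'.
pose k w := c w * c' w.
have kE f g : ip P (fun w => c w * f w) (fun w => c' w * g w) = ip P (fun w => k w * f w) g.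
  by rewrite /ip; apply: eq_Rintegral => w _; rewrite /k; ring.
rewrite kE.
have bk : exists C, forall w, `|k w| <= C.
  exists (C * C') => w; rewrite normrM ler_pM//.
have mk : @measurable_fun _ _ (g_sigma_algebraType (F a')) R setT k.
  apply: measurable_funM => //.
  exact: (filtration_measurable_fun hF a0 aa' a1' mc).
have mkt t : a' <= t -> t <= 1 -> @measurable_fun _ _ (g_sigma_algebraType (F t)) R setT k.
  by move=> at' t1; exact: (filtration_measurable_fun hF a0' at' t1 mk).
have mkT : measurable_fun setT k by exact: measurable_funM.
have sM s t B : 0 <= s -> s <= t -> t <= 1 -> measurable B -> (Pi B < +oo)%E -> sqint P (cpm s t B).
  by move=> s0 st t1 mB fB; have [] := cpm_moments hF hN s0 st t1 mB fB.
have sk f : sqint P f -> sqint P (fun w => k w * f w) by exact: sqint_bounded.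
have orth s t u B D : 0 <= s -> s <= t -> t <= u -> u <= 1 -> a' <= t ->
    measurable B -> (Pi B < +oo)%E -> measurable D -> (Pi D < +oo)%E ->
    ip P (fun w => k w * cpm s t B w) (cpm t u D) = 0.
  move=> s0 st tu u1 at' mB fB mD fD.
  have t1 : t <= 1 by exact: le_trans u1.
  apply: (cpm_orth hF hN) => //.
  - exact: le_trans st.
  - by apply: measurable_funM; [exact: mkt|exact: (cpm_measurable hF hN)].
  - by apply: sk; exact: sM.
have [ba'|a'b] := leP b a'.
  have -> : `]a, b]%classic `&` `]a', b'] = set0 :> set R.
    apply/seteqP; split => // s []/=; rewrite !in_itv/= => /andP[_ sb] /andP[+ _].
    by rewrite ltNge (le_trans sb).
  rewrite measure0 mulr0 mul0r.
  have a'0 : 0 <= b by exact: le_trans ab.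
  apply: (cpm_orth hF hN) => //; last by apply: sk; exact: sM.
  apply: measurable_funM => //.
  apply: (filtration_measurable_fun hF a'0 ba' a1').
  exact: (cpm_measurable hF hN).
pose v := Num.min b b'.
have va' : a' <= v by rewrite le_min (ltW a'b) ab'.
have vb : v <= b by rewrite ge_min lexx.
have vb' : v <= b' by rewrite ge_min lexx orbT.
have v0 : 0 <= v by exact: le_trans va'.
have v1 : v <= 1 by exact: le_trans vb b1.
have -> : `]a, b]%classic `&` `]a', b'] = `]a', v]%classic :> set R.
  apply/seteqP; split => s /=; rewrite !in_itv/= le_min.
    by move=> [/andP[_ ->] /andP[-> ->]].
  by move=> /andP[as' /andP[-> ->]]; rewrite as' (le_lt_trans aa').
rewrite lebesgue_measure_oc//=.
have -> : cpm a b A = (fun w => cpm a a' A w + (cpm a' v A w + cpm v b A w)).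
  by apply/funext => w; rewrite -!cpm_split.
have sA1 : sqint P (cpm a a' A) by exact: sM.
have sA2 : sqint P (cpm a' v A) by exact: sM.
have sA3 : sqint P (cpm v b A) by exact: sM.
have sB1 : sqint P (cpm a' v A') by exact: sM.
have sB2 : sqint P (cpm v b' A') by exact: sM.
have sB : sqint P (cpm a' b' A') by exact: sM.
have -> : (fun w => k w * (cpm a a' A w + (cpm a' v A w + cpm v b A w))) =
   (fun w => k w * cpm a a' A w + k w * (cpm a' v A w + cpm v b A w)).
  by apply/funext => w; rewrite mulrDr.
rewrite ipDl//; [|exact: sk|by apply: sk; exact: sqintD].
rewrite (orth a a' b')// add0r.
have -> : cpm a' b' A' = (fun w => cpm a' v A' w + cpm v b' A' w).
  by apply/funext => w; rewrite -cpm_split.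
rewrite ip_mulDD//.
rewrite (cpm_cov hF hN)// (orth a' v b')// addr0.
have -> : ip P (fun x => k x * cpm v b A x) (cpm a' v A') = 0.
  by rewrite ipC -ip_mul orth.
have -> : ip P (fun x => k x * cpm v b A x) (cpm v b' A') = 0.
  rewrite /ip; under eq_Rintegral => w _.
    rewrite (_ : _ * _ = 0); last first.
      have [bb'|bb'] := leP b b'.
        have -> : v = b by rewrite /v min_l.
        by rewrite cpm_self mulr0 mul0r.
      have -> : v = b' by rewrite /v min_r// ltW.
      by rewrite [cpm b' b' A' w]cpm_self mulr0.
    over.
  by rewrite Rintegral_cst_prob.
by rewrite !addr0 mulrA.
Qed.

Let cov e e' : adm e -> adm e' ->
  ip P (fun w => el_coef e w * cpm (el_start e) (el_stop e) (el_set e) w)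
       (fun w => el_coef e' w * cpm (el_start e') (el_stop e') (el_set e') w) =
  ip P (el_coef e) (el_coef e') *
  fine (leb (`]el_start e, el_stop e] `&` `]el_start e', el_stop e'])) *
  fine (Pi (el_set e `&` el_set e')).
Proof.
move=> ae ae'; have [h|/ltW h] := leP (el_start e) (el_start e').
  exact: cov_ordered.
by rewrite ipC cov_ordered// (ipC _ (el_coef e')) (setIC (el_set e')) (setIC `]el_start e', _]%classic).
Qed.

Definition el_integrand (e : @elementary R d Omega l) (z : (Omega * R) * Rvec R l) : R :=
  el_coef e z.1.1 * \1_(`]el_start e, el_stop e]) z.1.2 * \1_(el_set e) z.2.

Let sqint_oc a b : sqint leb (\1_(`]a, b]%classic) : R -> R).
Proof.
apply: sqint_indic => //; have [ab|ba] := leP a b.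
  by have := lebesgue_measure_oc ab => /= ->; rewrite ltry.
rewrite set_itv_ge ?measure0// bnd_simp -leNgt; exact: ltW.
Qed.

Lemma sqint_el_integrand e : adm e -> sqint mI (el_integrand e).
Proof.
move=> ae; have [_ _ _ mA fA] := ae.
exact: (sqint_prod_indep (sqint_prod_indep (sqint_coef ae) (sqint_oc _ _)) (sqint_indic mA fA)).
Qed.

Let el_isometry e e' : adm e -> adm e' ->
  ip P (fun w => el_coef e w * cpm (el_start e) (el_stop e) (el_set e) w)
       (fun w => el_coef e' w * cpm (el_start e') (el_stop e') (el_set e') w) =
  ip mI (el_integrand e) (el_integrand e').
Proof.
move=> ae ae'; have [_ _ _ mA fA] := ae; have [_ _ _ mA' fA'] := ae'.
rewrite cov// /el_integrand.
have h e1 : adm e1 -> sqint mP (fun z => el_coef e1 z.1 * \1_(`]el_start e1, el_stop e1]) z.2).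
  by move=> ae1; apply: (sqint_prod_indep (sqint_coef ae1)); exact: sqint_oc.
rewrite (ip_tensor (h _ ae) (sqint_indic mA fA) (h _ ae') (sqint_indic mA' fA')).
rewrite (ip_tensor (sqint_coef ae) (sqint_oc _ _) (sqint_coef ae') (sqint_oc _ _)).
by rewrite !ip_indic.
Qed.

(** Stopping at t becomes a change of the elementary integrand. When t precedes the start, the
    maximum produces an empty interval instead of a reversed one, so that admissibility is kept. *)
Definition el_cut (t : R) (e : @elementary R d Omega l) :=
  Elementary (el_coef e) (el_start e)
    (Num.max (el_start e) (Num.min (el_stop e) t)) (el_set e).

Let adm_cut t e : t <= 1 -> adm e -> adm (el_cut t e).
Proof.
move=> t1 [[h1 h2 h3] mc bc mA fA]; split => //; split => //=.
- by rewrite le_max lexx.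
- by rewrite ge_max (le_trans h2 h3) ge_min h3.
Qed.

Let simple_integralE n e t w : (forall i, (i < n)%N -> adm (e i)) ->
  simple_integral Pi N n e t w = \sum_(i < n)
    el_coef (el_cut t (e i)) w *
    cpm (el_start (el_cut t (e i))) (el_stop (el_cut t (e i))) (el_set (el_cut t (e i))) w.
Proof.
move=> he; apply: eq_bigr => i _; congr (_ * _) => /=.
have [[_ ab _] _ _ _ _] := he i (ltn_ord i).
move: (el_start _) (el_stop _) ab => a b ab; rewrite /cpm.
have [ta|at_] := ltP t a.
  by rewrite (min_r (ltW (lt_le_trans ta ab))) (max_l (ltW ta)) !subrr.
by rewrite max_r// le_min ab.
Qed.

Let cut_simpleE n e t z : (forall i, (i < n)%N -> adm (e i)) ->
  cutI `]0, t] (simple_integrand n e) z = \sum_(i < n) el_integrand (el_cut t (e i)) z.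
Proof.
move=> he; rewrite /cutI /simple_integrand mulr_sumr; apply: eq_bigr => i _.
rewrite /el_integrand/= !mulrA; congr (_ * _); rewrite mulrAC mulrC; congr (_ * _).
have [[a0 ab _] _ _ _ _] := he i (ltn_ord i).
move: (el_start _) (el_stop _) a0 ab => a b a0 ab.
rewrite !indicE -natrM mulnb; congr (nat_of_bool _)%:R.
apply/andP/idP => [[/set_mem/= + /set_mem/=]|/set_mem/=].
  rewrite !in_itv/= => /andP[s0 st] /andP[as_ sb]; apply/mem_set => /=.
  by rewrite in_itv/= as_ le_max le_min sb st orbT.
rewrite in_itv/= le_max le_min => /andP[as_].
rewrite leNgt as_/= => /andP[sb st].
by split; apply/mem_set => /=; rewrite in_itv/= ?as_ ?sb ?st ?(le_lt_trans a0 as_).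
Qed.

Lemma sqint_simple_integral n e t : 0 <= t <= 1 ->
  (forall i, (i < n)%N -> adm (e i)) -> sqint P (simple_integral Pi N n e t).
Proof.
move=> /andP[t0 t1] he.
rewrite (funext (fun w => simple_integralE t w he)).
by apply: sqint_sum => i; exact/sqint_term/adm_cut/he.
Qed.

Lemma sqint_simple_integrand n e t : 0 <= t <= 1 ->
  (forall i, (i < n)%N -> adm (e i)) ->
  sqint mI (cutI `]0, t] (simple_integrand n e)).
Proof.
move=> /andP[t0 t1] he.
rewrite (funext (fun w => cut_simpleE t w he)).
by apply: sqint_sum => i; exact/sqint_el_integrand/adm_cut/he.
Qed.

Lemma simple_isometry n e t n' e' t' : 0 <= t <= 1 -> 0 <= t' <= 1 ->
  (forall i, (i < n)%N -> adm (e i)) -> (forall i, (i < n')%N -> adm (e' i)) ->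
  ip P (simple_integral Pi N n e t) (simple_integral Pi N n' e' t') =
  ip mI (cutI `]0, t] (simple_integrand n e)) (cutI `]0, t'] (simple_integrand n' e')).
Proof.
move=> t01 t01' he he'; have sS := sqint_simple_integral t01' he'.
have sE := sqint_simple_integrand t01' he'.
have [/andP[t0 t1] /andP[t0' t1']] := (t01, t01').
rewrite (funext (fun w => simple_integralE t w he)).
rewrite (funext (fun w => cut_simpleE t w he)).
rewrite ip_suml//; last by move=> i; exact/sqint_term/adm_cut/he.
rewrite ip_suml//; last by move=> i; exact/sqint_el_integrand/adm_cut/he.
apply: eq_bigr => i _.
rewrite (funext (fun w => simple_integralE t' w he')).
rewrite (funext (fun w => cut_simpleE t' w he')).
rewrite ip_sumr; [|by move=> j; exact/sqint_term/adm_cut/he'|exact/sqint_term/adm_cut/he].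
rewrite ip_sumr; [|by move=> j; exact/sqint_el_integrand/adm_cut/he'|exact/sqint_el_integrand/adm_cut/he].
by apply: eq_bigr => j _; rewrite el_isometry//; apply: adm_cut => //; [exact: he|exact: he'].
Qed.

End simple_isometry.

Section adapted.
Context {R : realType} {d : measure_display} {Omega : measurableType d} {l : nat}.
Variables (F : R -> set (set Omega)).
Hypothesis hF : right_continuous_filtration F.

Lemma BF_section f t : BF_measurable F f -> 0 <= t <= 1 ->
  @measurable_fun _ _ (g_sigma_algebraType (F t)) R setT (f t).
Proof.
move=> mf t01 _ Y mY; rewrite setTI.
have mD : @measurable _ (BF F) [set z : R * Omega | 0 <= z.1 <= 1].
  have := @BF_domain _ _ _ F _ (measurable_itv `[0, 1]).
  congr (measurable _); apply/seteqP; split => -[s w] /=; rewrite in_itv/=.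
  - by case.
  - by [].
have /BF_measurableE/(_ t t01) := mf mD Y mY.
set A := (_ `&` _) => mA.
have mp : measurable_fun setT (fun w : g_sigma_algebraType (F t) => (t, w)).
  exact: measurable_fun_pair.
have := mp measurableT _ mA; rewrite setTI.
congr (measurable _); apply/seteqP; split => w /=.
  by case=> -[].
move=> Yw; split; split => //=.
by rewrite in_itv/= lexx andbT; case/andP: t01.
Qed.

(** On [0, t] the function is measurable for [F t] if a <= t, and it is identically 0 if t < a. *)
Lemma BF_measurable_adapted (I : set R) (a : R) (c : Omega -> R) :
  measurable I -> 0 <= a <= 1 -> (forall s, I s -> a <= s) ->
  @measurable_fun _ _ (g_sigma_algebraType (F a)) R setT c ->
  @measurable_fun _ _ (BF F) R setT (fun z : R * Omega => \1_I z.1 * c z.2).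
Proof.
move=> mI a01 Ia mc _ Y mY; rewrite setTI; apply/BF_measurableE => t t01.
have mt : @measurable _ (R * g_sigma_algebraType (F t))%type (`[0, t]%classic `*` setT).
  exact: (@measurable_timeX _ _ (g_sigma_algebraType (F t))).
have [/andP[a0 a1] /andP[t0 t1]] := (a01, t01).
have [at_|ta] := leP a t.
  apply: measurableI => //.
  have mct := filtration_measurable_fun hF a0 at_ t1 mc.
  have : measurable_fun setT (fun z : R * g_sigma_algebraType (F t) => \1_I z.1 * c z.2).
    apply: measurable_funM; first exact: measurable_indic01.
    exact: (measurableT_comp mct).
  by move=> /(_ measurableT Y mY); rewrite setTI.
have zero s w : s <= t -> \1_I s * c w = 0.
  move=> st; rewrite indicE memNset ?mul0r// => /Ia.
  by rewrite leNgt (le_lt_trans st ta).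
have [Y0|Y0] := pselect (Y 0).
  rewrite (_ : _ `&` _ = `[0, t]%classic `*` setT)//.
  apply/seteqP; split => -[s w] /= []// h _.
  by split => //; rewrite zero//; move: h; rewrite in_itv/= => /andP[].
rewrite (_ : _ `&` _ = set0)//.
apply/seteqP; split => -[s w] //= [+ [+ _]].
by rewrite in_itv/= => + /andP[_ st]; rewrite zero.
Qed.

Lemma BFl_measurable_simple (Pi : {sigma_finite_measure set (Rvec R l) -> \bar R}) n e :
  (forall i, (i < n)%N -> admissible F Pi (e i)) ->
  BFl_measurable F (simple_integrand n e).
Proof.
move=> he; apply: measurable_funTS; rewrite /simple_integrand.
apply: measurable_sum => i.
have [[a0 ab b1] mc _ mA _] := he i (ltn_ord i).
apply: measurable_funM; last first.
  have mI : measurable_fun setT (\1_(el_set (e i)) : Rvec R l -> R) by exact: measurable_indic.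
  exact: (measurableT_comp mI measurable_snd).
have := @BF_measurable_adapted `]el_start (e i), el_stop (e i)]%classic (el_start (e i)) (el_coef (e i)).
have h1 : 0 <= el_start (e i) <= 1 by rewrite a0 (le_trans ab).
have h2 s : `]el_start (e i), el_stop (e i)]%classic s -> el_start (e i) <= s.
  by rewrite /= in_itv/= => /andP[/ltW].
move=> /(_ (measurable_itv _) h1 h2 mc) mg.
have := measurableT_comp mg (@measurable_fst _ _ (BF F) (Rvec R l)).
apply: eq_measurable_fun => z _ /=; by rewrite mulrC.
Qed.

End adapted.

Section restriction.
Context {d} {T : measurableType d} {R : realType}.
Variable m : {measure set T -> \bar R}.

Lemma sqint_indic_mul (A : set T) (f : T -> R) : measurable A -> sqint m f ->
  sqint m (fun x => \1_A x * f x).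
Proof.
move=> mA sf; apply: sqint_bounded => //.
by exists 1 => x; rewrite indicE; case: (_ \in _); rewrite ?normr1 ?normr0.
Qed.

Lemma ip_indic_le (A : set T) (f : T -> R) : measurable A -> sqint m f ->
  ip m (fun x => \1_A x * f x) (fun x => \1_A x * f x) <= ip m f f.
Proof.
move=> mA sf; apply: le_Rintegral => //.
- by apply: sqint_integrable; exact: sqint_indic_mul.
- exact: sqint_integrable.
move=> x _; rewrite indicE; case: (_ \in _); rewrite ?mul1r ?mul0r//.
by rewrite -expr2 sqr_ge0.
Qed.

End restriction.

(** * Passage from simple integrands to the integral [J] *)

Section isometry.
Context {R : realType} {d : measure_display} {Omega : measurableType d} {l : nat}.
Variables (P : probability Omega R) (F : R -> set (set Omega)).
Variable Pi : {sigma_finite_measure set (Rvec R l) -> \bar R}.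
Variable N : R.-ker Omega ~> (R * Rvec R l)%type.
Variable J : integrand R Omega l -> process R Omega.
Hypothesis hF : right_continuous_filtration F.
Hypothesis hN : adapted_poisson_measure P F Pi N.
Hypothesis hJ : stochastic_integration P F Pi N J.

Local Notation leb := (@lebesgue_measure R).
Local Notation mP := (prodm P leb).
Local Notation mI := (prodm mP Pi).

Lemma measurable_time (A : set R) : measurable A ->
  measurable [set z : (Omega * R) * Rvec R l | A z.1.2].
Proof.
move=> mA.
have mf : measurable_fun setT (fun z : (Omega * R) * Rvec R l => z.1.2).
  exact: (measurableT_comp measurable_snd).
by have := mf measurableT A mA; rewrite setTI.
Qed.

Lemma cutI_sub (A B : set R) (f : integrand R Omega l) : B `<=` A ->
  cutI B f = (fun z => \1_[set z : (Omega * R) * Rvec R l | B z.1.2] z * cutI A f z).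
Proof.
move=> BA; apply/funext => z; rewrite /cutI mulrA; congr (_ * _).
rewrite !indicE (_ : (z \in [set z | B z.1.2]) = (z.1.2 \in B)); last first.
  by apply/idP/idP => /set_mem/= h; apply/mem_set.
have [/set_mem zB|zB] := boolP (z.1.2 \in B); last by rewrite mul0r.
by rewrite mem_set ?mul1r//; exact: BA.
Qed.

Lemma sqint_cutI (A : set R) (f : integrand R Omega l) : measurable A ->
  A `<=` `[0, 1] -> Lp P F Pi 2 f -> sqint mI (cutI A f).
Proof.
move=> mA A01 /(Lp2P _ _ hF)[_ sf]; rewrite (cutI_sub _ A01).
by apply: sqint_indic_mul => //; exact: measurable_time.
Qed.

Lemma oc_sub01 (t : R) : t <= 1 -> `]0, t]%classic `<=` `[0, 1]%classic.
Proof.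
by move=> t1 s /=; rewrite !in_itv/= => /andP[/ltW-> st]; exact: le_trans st t1.
Qed.

(** Intervals ]a, b] with a >= 0 never contain the time 0. This links [Lp], taken over [0, 1], to
    the isometry, stated over ]0, t]. *)
Let cut_simple01 n e : (forall i, (i < n)%N -> admissible F Pi (e i)) ->
  cutI `[0, 1] (simple_integrand n e) = cutI `]0, 1] (simple_integrand n e).
Proof.
move=> he; apply/funext => -[[w s] y]; rewrite /cutI/=.
have [->|s0] := eqVneq s 0.
  rewrite /simple_integrand big1 ?mulr0// => i _.
  have [[a0 _ _] _ _ _ _] := he i (ltn_ord i).
  rewrite [\1__ 0]indicE memNset ?mulr0 ?mul0r//= in_itv/=.
  by move=> /andP[]; rewrite ltNge a0.
congr (_ * _); rewrite !indicE; congr (nat_of_bool _)%:R.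
by apply/idP/idP => /set_mem/=; rewrite in_itv/= => h; apply/mem_set => /=;
  rewrite in_itv/=; move: h; rewrite lt_neqAle eq_sym s0.
Qed.

Let Lp2_simple n e : (forall i, (i < n)%N -> admissible F Pi (e i)) ->
  Lp P F Pi 2 (simple_integrand n e).
Proof.
move=> he; apply/(Lp2P _ _ hF); split; first exact: (BFl_measurable_simple hF he).
rewrite cut_simple01//; apply: (sqint_simple_integrand P hF) => //.
by rewrite ler01 lexx.
Qed.

Lemma Lp2_sub f g : Lp P F Pi 2 f -> Lp P F Pi 2 g ->
  Lp P F Pi 2 (fun s w y => f s w y - g s w y).
Proof.
move=> /(Lp2P _ _ hF)[mf sf] /(Lp2P _ _ hF)[mg sg]; apply/(Lp2P _ _ hF).
split; first exact: measurable_funB.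
have := sqintB sf sg.
by congr (sqint _ _); apply/funext => z; rewrite /cutI mulrBr.
Qed.

Let J_approx f t : Lp P F Pi 2 f -> 0 <= t <= 1 ->
  sqint P (J f t) /\
  exists (K : nat -> nat) (e : nat -> nat -> elementary),
    [/\ forall n i, (i < K n)%N -> admissible F Pi (e n i),
       ip P (fun w => simple_integral Pi N (K n) (e n) t w - J f t w)
            (fun w => simple_integral Pi N (K n) (e n) t w - J f t w) @[n --> \oo] --> 0 &
       ip mI (fun z => cutI `]0, t] (simple_integrand (K n) (e n)) z - cutI `]0, t] f z)
             (fun z => cutI `]0, t] (simple_integrand (K n) (e n)) z - cutI `]0, t] f z)
         @[n --> \oo] --> 0].
Proof.
move=> Lf t01; have [mJ _ [K [e [he cI cJ]]]] := hJ Lf.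
have /andP[t0 t1] := t01.
have mJt : measurable_fun setT (J f t).
  by apply: (filtration_measurable_funT hF t01); exact: BF_section.
have ss n : sqint P (simple_integral Pi N (K n) (e n) t).
  by apply: (sqint_simple_integral hF hN t01); exact: he.
(* Convergence to 0 makes at least one distance to a simple integral finite, and simple integrals
   are square integrable. *)
have sJ : sqint P (J f t).
  have /fine_cvgP[[n _ /(_ n (leqnn _))/= fin _]] := cJ t t01.
  have sd : sqint P (fun w => simple_integral Pi N (K n) (e n) t w - J f t w).
    split; first by apply: measurable_funB => //; exact: (ss n).1.
    by rewrite -ge0_fin_numE//; apply: integral_ge0 => w _; rewrite lee_fin sqr_ge0.
  have := sqintB (ss n) sd.
  by under eq_fun do rewrite subKr.
split => //; exists K, e; split => //.
  by apply/sqr_cvg_ip; [move=> n; exact: sqintB|exact: cJ].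
have Ld n : Lp P F Pi 2 (fun s w y => simple_integrand (K n) (e n) s w y - f s w y).
  exact: (Lp2_sub (Lp2_simple (he n)) Lf).
have cI' := (Lp2_norm_cvg hF Ld).1 cI.
(* Cutting down from [0, 1] to ]0, t] can only decrease the norm of the error. *)
apply: (squeeze_cvgr _ (cvg_cst 0) cI').
apply: nearW => n; rewrite ip_ge0/=.
have /(Lp2P _ _ hF)[_ sd] := Ld n.
have -> : (fun z => cutI `]0, t] (simple_integrand (K n) (e n)) z - cutI `]0, t] f z) =
    cutI `]0, t] (fun s w y => simple_integrand (K n) (e n) s w y - f s w y).
  by apply/funext => z; rewrite /cutI mulrBr.
rewrite (cutI_sub _ (oc_sub01 t1)).
by apply: (@ip_indic_le _ _ _ mI) => //; exact: measurable_time.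
Qed.

Lemma sqint_J f t : Lp P F Pi 2 f -> 0 <= t <= 1 -> sqint P (J f t).
Proof. by move=> Lf t01; have [] := J_approx Lf t01. Qed.

Lemma J_isometry f g t t' : Lp P F Pi 2 f -> Lp P F Pi 2 g ->
  0 <= t <= 1 -> 0 <= t' <= 1 ->
  ip P (J f t) (J g t') = ip mI (cutI `]0, t] f) (cutI `]0, t'] g).
Proof.
move=> Lf Lg t01 t01'.
have [sJ [K [e [he c1 c2]]]] := J_approx Lf t01.
have [sJ' [K' [e' [he' c1' c2']]]] := J_approx Lg t01'.
have [/andP[_ t1] /andP[_ t1']] := (t01, t01').
have C1 := ip_cvg (fun n => sqint_simple_integral hF hN t01 (he n))
  (fun n => sqint_simple_integral hF hN t01' (he' n)) sJ sJ' c1 c1'.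
have C2 := ip_cvg (fun n => sqint_simple_integrand P hF t01 (he n))
  (fun n => sqint_simple_integrand P hF t01' (he' n))
  (sqint_cutI (measurable_itv _) (oc_sub01 t1) Lf)
  (sqint_cutI (measurable_itv _) (oc_sub01 t1') Lg) c2 c2'.
move: C1; rewrite (_ : (fun n => ip P _ _) = (fun n => ip mI
    (cutI `]0, t] (simple_integrand (K n) (e n)))
    (cutI `]0, t'] (simple_integrand (K' n) (e' n))))).
  by move=> C1; exact: (cvg_unique _ C1 C2).
by apply/funext => n; exact: (simple_isometry hF hN t01 t01' (he n) (he' n)).
Qed.

End isometry.

(** * Step functions *)

Section step_functions.
Context {R : realType} {d : measure_display} {Omega : measurableType d} {l : nat}.
Variables (P : probability Omega R) (F : R -> set (set Omega)).
Variable Pi : {sigma_finite_measure set (Rvec R l) -> \bar R}.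
Hypothesis hF : right_continuous_filtration F.

Local Notation leb := (@lebesgue_measure R).
Local Notation mP := (prodm P leb).
Local Notation mI := (prodm mP Pi).
Local Notation mN := (prodm leb mI).

Section locate.
Variable m : @step R d Omega l.
Hypothesis hm : T2 P F Pi m.

Lemma T2_node_lt i j : (i < j)%N -> (j <= st_size m)%N -> st_node m i < st_node m j.
Proof.
have [_ _ lt_node _ _] := hm.
elim: j => // j IHj; rewrite ltnS leq_eqVlt => /predU1P[->|ij] jn; first exact: lt_node.
exact: lt_trans (IHj ij (ltnW jn)) (lt_node _ jn).
Qed.

Lemma T2_node01 k : (k <= st_size m)%N -> 0 <= st_node m k <= 1.
Proof.
have [n0 n1 _ _ _] := hm; move=> kn; apply/andP; split.
  by case: k kn => [|k] kn; rewrite -?n0//; apply: ltW; exact: T2_node_lt.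
move: kn; rewrite leq_eqVlt => /predU1P[->|kn]; first by rewrite n1.
by rewrite -[leRHS]n1; apply: ltW; exact: T2_node_lt.
Qed.

Lemma T2_locate t : 0 <= t < 1 ->
  exists2 k, (k < st_size m)%N & st_node m k <= t < st_node m k.+1.
Proof.
move=> /andP[t0 t1]; have [n0 n1 _ _ _] := hm.
have : t < st_node m (st_size m) by rewrite n1.
elim: (st_size m) => [|n IHn] tn; first by move: tn; rewrite n0 ltNge t0.
have [nt|/IHn[k kn kt]] := leP (st_node m n) t; first by exists n => //; rewrite nt.
by exists k => //; rewrite leqW.
Qed.

Lemma T2_sumE (V : nat -> R) k t : (k < st_size m)%N ->
  st_node m k <= t < st_node m k.+1 ->
  \sum_(j < st_size m) \1_(`[st_node m j, st_node m j.+1[) t * V j = V k.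
Proof.
move=> kn /andP[kt tk]; rewrite (bigD1 (Ordinal kn))//= big1 ?addr0.
  by rewrite indicE mem_set ?mul1r//= in_itv/= kt tk.
move=> j /eqP jk; rewrite indicE memNset ?mul0r//= in_itv/= => /andP[jt tj].
have [kj|jk'|kj] := ltngtP k j; last by apply: jk; apply/val_inj.
- have : st_node m k.+1 <= st_node m j.
    move: kj; rewrite leq_eqVlt => /predU1P[->//|kj]; apply/ltW/T2_node_lt => //; exact/ltnW.
  by move=> /(lt_le_trans tk); rewrite ltNge jt.
- have : st_node m j.+1 <= st_node m k.
    move: jk'; rewrite leq_eqVlt => /predU1P[->//|jk']; apply/ltW/T2_node_lt => //; exact/ltnW.
  by move=> /(lt_le_trans tj); rewrite ltNge kt.
Qed.

(** The last interval is open at 1, so every step function vanishes at t = 1; this time needs a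
    separate case in the pointwise statements below. *)
Lemma T2_sum1 (V : nat -> R) :
  \sum_(j < st_size m) \1_(`[st_node m j, st_node m j.+1[) 1 * V j = 0.
Proof.
apply: big1 => j _; rewrite indicE memNset ?mul0r//= in_itv/= => /andP[_].
by have /andP[_] := T2_node01 (ltn_ord j); rewrite leNgt => /negbTE->.
Qed.

End locate.

Lemma integral_cutI_sqr (A : set R) f : measurable A -> A `<=` `[0, 1] ->
  BFl_measurable F f ->
  (\int[mI]_z (cutI A f z ^+ 2)%:E =
   \int[P]_w \int[leb]_(s in A) \int[Pi]_y (f s w y ^+ 2)%:E)%E.
Proof.
move=> mA A01 mf; have mc := measurable_cutI hF mA A01 mf.
have mc2 : measurable_fun setT (fun z => (cutI A f z ^+ 2)%:E).
  by apply/measurable_EFinP; exact: measurable_funX.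
rewrite (tonelli_sqr mP Pi mc) tonelli1; last 2 first.
- by apply: (measurable_tonelli1 Pi mc2) => z; rewrite lee_fin sqr_ge0.
- by move=> x; apply: integral_ge0 => y _; rewrite lee_fin sqr_ge0.
apply: eq_integral => w _; rewrite [RHS]integral_mkcond; apply: eq_integral => t _.
rewrite patchE; case: ifPn => tI.
  by apply: eq_integral => y _; rewrite /cutI/= indicE tI mul1r.
rewrite integral0_eq// => y _.
by rewrite /cutI/= indicE (negbTE tI) mul0r expr0n.
Qed.

Lemma cutI_vanish (t : R) (f : integrand R Omega l) : 0 <= t <= 1 ->
  (forall s w y, t < s <= 1 -> f s w y = 0) ->
  cutI `[0, 1] f = cutI `[0, t] f.
Proof.
move=> /andP[t0 t1] ft; apply/funext => -[[w s] y]; rewrite /cutI/= !indicE.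
have [/set_mem/=|s1] := boolP (s \in `[0, 1]%classic).
  rewrite in_itv/= => /andP[s0 s1]; have [ts|st] := ltP t s.
    by rewrite ft ?ts// !mulr0.
  by rewrite [s \in _]mem_set//= in_itv/= s0.
rewrite [s \in `[0, t]%classic]memNset// => /=; rewrite in_itv/= => /andP[s0 st].
by move: s1; rewrite mem_set//= in_itv/= s0 (le_trans st).
Qed.

Lemma Lp2_vanish (t : R) f : 0 <= t <= 1 ->
  (forall s w y, t < s <= 1 -> f s w y = 0) ->
  Lp P F Pi 2 f <-> BFl_measurable F f /\
    (\int[P]_w \int[leb]_(s in `[0%R, t]) \int[Pi]_y (f s w y ^+ 2)%:E < +oo)%E.
Proof.
move=> t01 ft; have t01' : `[0, t]%classic `<=` `[0, 1]%classic.
  move=> s /=; rewrite !in_itv/= => /andP[-> st]; apply: le_trans st _.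
  by case/andP: t01.
split => [/(Lp2P _ _ hF)[mf [_]]|[mf]].
  by rewrite (cutI_vanish t01 ft) integral_cutI_sqr.
move=> fin; apply/(Lp2P _ _ hF); split=> //; rewrite (cutI_vanish t01 ft).
by split; [exact: (measurable_cutI hF)|rewrite integral_cutI_sqr].
Qed.

Lemma T2_coef m k : T2 P F Pi m -> (k < st_size m)%N -> Lp P F Pi 2 (st_coef m k).
Proof.
move=> hm kn; have [_ _ _ _ /(_ k kn)[mf ft fin]] := hm.
by apply/(Lp2_vanish (T2_node01 hm (ltnW kn)) ft).
Qed.

Lemma N2_measurable_cst (a : integrand R Omega l) :
  BFl_measurable F a -> N2_measurable F (fun=> a).
Proof.
move=> ma.
have ms : @measurable_fun _ _ (R * (BF F * Rvec R l))%type (BF F * Rvec R l)%type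
    [set z : R * ((R * Omega) * Rvec R l) | [/\ 0 <= z.2.1.1, z.2.1.1 <= z.1 & z.1 <= 1]]
    (fun z => z.2).
  by apply: measurable_funTS; exact: measurable_snd.
apply: (measurable_comp (@BFl_domain _ _ _ _ F) _ ma ms).
by move=> _ [z [z0 zt t1] <-]/=; rewrite z0/=; exact: le_trans zt t1.
Qed.

Lemma N2_measurable_step m : T2 P F Pi m -> N2_measurable F (step_fun m).
Proof.
move=> hm; apply: measurable_sum => k; have [mf _] := T2_coef hm (ltn_ord k).
apply: measurable_funM.
  apply: measurable_funTS; apply: measurable_indic01 => //.
exact: N2_measurable_cst mf.
Qed.

Lemma sqint_leb_indic (A : set R) : measurable A -> A `<=` `[0, 1] ->
  sqint leb (\1_A : R -> R).
Proof.
move=> mA A01; apply: sqint_indic => //.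
apply: (@le_lt_trans _ _ (leb `[0%R, 1%R]%classic)).
  by apply: le_measure => //; rewrite inE//=; exact: measurable_itv.
by rewrite /= lebesgue_measure_itv/= lte_fin ltr01 oppr0 adde0 ltry.
Qed.

(** Without the constraint s <= t, the sum is made of products of a function of t and a function of
    (omega, s, y), each square integrable, and it dominates [cutN mu]. This serves both for step
    functions and for functions constant in t. *)
Lemma sqint_cutN_tensor (mu : R -> integrand R Omega l) n (A : nat -> set R)
    (a : nat -> integrand R Omega l) :
  N2_measurable F mu ->
  (forall k, (k < n)%N -> measurable (A k) /\ Lp P F Pi 2 (a k)) ->
  (forall t s w y, 0 <= s -> s <= t -> t <= 1 ->
     mu t s w y = \sum_(k < n) \1_(A k) t * a k s w y) ->
  sqint mN (cutN mu).
Proof.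
move=> mm ha muE.
apply: (@sqint_le _ _ _ mN _ (fun z => \sum_(k < n)
   \1_(A k `&` `[0, 1]) z.1 * cutI `[0, 1] (a k) z.2)).
- exact: (measurable_cutN hF mm).
- apply: sqint_sum => k; have [mA /(Lp2P _ _ hF)[_ sa]] := ha k (ltn_ord k).
  apply: sqint_prod_indep => //; apply: sqint_leb_indic; last exact: subIsetr.
  exact: measurableI.
move=> -[t [[w s] y]]; rewrite /cutN /cutI/=.
rewrite [\1_(`[0, 1]%classic) t]indicE; have [/set_mem/=|_] := boolP (t \in _); last first.
  by rewrite mul0r normr0.
rewrite in_itv/= => /andP[t0 t1].
rewrite [\1_(`[0, t]%classic) s]indicE; have [/set_mem/=|_] := boolP (s \in _); last first.
  by rewrite mul0r mulr0 normr0.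
rewrite in_itv/= => /andP[s0 st]; rewrite !mul1r muE//.
rewrite (_ : \sum_(k < n) _ = \sum_(k < n) \1_(A k `&` `[0, 1]) t * (\1_(`[0, 1]) s * a k s w y))//.
apply: eq_bigr => k _; rewrite indicI/= [\1_(`[0, 1]%classic) t]indicE mem_set ?mulr1; last first.
  by rewrite /= in_itv/= t0.
by rewrite [\1_(`[0, 1]%classic) s]indicE mem_set ?mul1r//= in_itv/= s0 (le_trans st).
Qed.

Lemma N2_step m : T2 P F Pi m -> N2 P F Pi (step_fun m).
Proof.
move=> hm; apply/(N2P _ _ hF); have mm := N2_measurable_step hm; split => //.
apply: (sqint_cutN_tensor (n := st_size m) (a := st_coef m)
  (A := fun k => `[st_node m k, st_node m k.+1[%classic)) => //.
by move=> k kn; split; [exact: measurable_itv|exact: (T2_coef hm)].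
Qed.

Lemma N2_cst a : Lp P F Pi 2 a -> N2 P F Pi (fun=> a).
Proof.
move=> La; have [ma _] := La; apply/(N2P _ _ hF).
have mm := N2_measurable_cst ma.
split => //.
apply: (sqint_cutN_tensor (n := 1%N) (a := fun=> a) (A := fun=> setT)) => //.
by move=> t s w y _ _ _; rewrite big_ord1 indicT mul1r.
Qed.

End step_functions.

(** * Pairs of a process and its integrand *)

Section isometric_pairs.
Context {R : realType} {d : measure_display} {Omega : measurableType d} {l : nat}.
Variables (P : probability Omega R) (F : R -> set (set Omega)).
Variable Pi : {sigma_finite_measure set (Rvec R l) -> \bar R}.
Variable N : R.-ker Omega ~> (R * Rvec R l)%type.
Variable J : integrand R Omega l -> process R Omega.
Hypothesis hF : right_continuous_filtration F.
Hypothesis hN : adapted_poisson_measure P F Pi N.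
Hypothesis hJ : stochastic_integration P F Pi N J.

Local Notation leb := (@lebesgue_measure R).
Local Notation mP := (prodm P leb).
Local Notation mI := (prodm mP Pi).
Local Notation mN := (prodm leb mI).

(* The linear span of the pairs of a stochastic integral and its integrand, at a
   fixed time; it makes the isometry closed under linear combinations. *)
Inductive integral_at : (Omega -> R) -> ((Omega * R) * Rvec R l -> R) -> Prop :=
| integral_at0 : integral_at (fun=> 0) (fun=> 0)
| integral_atD c a u X Y : Lp P F Pi 2 a -> 0 <= u <= 1 -> integral_at X Y ->
    integral_at (fun w => c * J a u w + X w)
                (fun z => c * cutI `]0, u] a z + Y z).

Lemma integral_at_J a u : Lp P F Pi 2 a -> 0 <= u <= 1 ->
  integral_at (J a u) (cutI `]0, u] a).
Proof.
move=> La u01; have := integral_atD 1 La u01 integral_at0.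
by congr integral_at; apply/funext => z; rewrite mul1r addr0.
Qed.

Lemma integral_at_lin c X Y X' Y' : integral_at X Y -> integral_at X' Y' ->
  integral_at (fun w => c * X w + X' w) (fun z => c * Y z + Y' z).
Proof.
move=> iX iX'; elim: iX => [|b a u {}X {}Y La u01 _ IH].
  have -> : (fun w => c * 0 + X' w) = X' by apply/funext => w; rewrite mulr0 add0r.
  by have -> : (fun z => c * 0 + Y' z) = Y' by apply/funext => z; rewrite mulr0 add0r.
have := integral_atD (c * b) La u01 IH.
by congr integral_at; apply/funext => z; rewrite mulrDr addrA mulrA.
Qed.

Lemma integral_at_sum n (c : nat -> R) X Y :
  (forall k, (k < n)%N -> integral_at (X k) (Y k)) ->
  integral_at (fun w => \sum_(k < n) c k * X k w) (fun z => \sum_(k < n) c k * Y k z).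
Proof.
elim: n => [|n IHn] iXY.
  under [X in integral_at X]eq_fun do rewrite big_ord0.
  under [X in integral_at _ X]eq_fun do rewrite big_ord0.
  exact: integral_at0.
under [X in integral_at X]eq_fun do rewrite big_ord_recr/= addrC.
under [X in integral_at _ X]eq_fun do rewrite big_ord_recr/= addrC.
apply: integral_at_lin; first exact: iXY.
by apply: IHn => k kn; apply: iXY; exact: ltnW.
Qed.

Let sqint_cut a u : Lp P F Pi 2 a -> 0 <= u <= 1 -> sqint mI (cutI `]0, u] a).
Proof.
move=> La /andP[_ u1]; exact: (sqint_cutI hF (measurable_itv _) (oc_sub01 u1) La).
Qed.

Lemma integral_at_sqint X Y : integral_at X Y -> sqint P X /\ sqint mI Y.
Proof.
elim=> [|c a u {}X {}Y La u01 _ [sX sY]]; first by split; exact: sqint0.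
split; apply: sqintD => //; apply: sqintZ; first exact: (sqint_J hF hN hJ La u01).
exact: sqint_cut.
Qed.

Lemma integral_at_ip X Y X' Y' : integral_at X Y -> integral_at X' Y' ->
  ip P X X' = ip mI Y Y'.
Proof.
move=> iX iX'; have [sX' sY'] := integral_at_sqint iX'.
elim: iX => [|c a u {}X {}Y La u01 iX IH]; first by rewrite !ip0l.
have [sX sY] := integral_at_sqint iX.
have sJ := sqint_J hF hN hJ La u01; have sc := sqint_cut La u01.
rewrite ipDl ?ipZl ?ipDl ?ipZl//; [|exact: sqintZ|exact: sqintZ].
rewrite IH; congr (_ * _ + _).
elim: iX' sX' sY' {IH} => [|c' a' u' {}X' {}Y' La' u01' iX' IH] _ _.
  by rewrite ipC ip0l ipC ip0l.
have [sX' sY'] := integral_at_sqint iX'.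
have sJ' := sqint_J hF hN hJ La' u01'; have sc' := sqint_cut La' u01'.
rewrite ipDr ?ipZr ?ipDr ?ipZr//; [|exact: sqintZ|exact: sqintZ].
by rewrite IH// (J_isometry hF hN hJ La La' u01 u01').
Qed.

Definition integral_pair (f : process R Omega) (mu : R -> integrand R Omega l) :=
  forall t, 0 <= t <= 1 -> integral_at (f t) (cutI `]0, t] (mu t)).

Lemma integral_pair_lin c f mu g eta : integral_pair f mu -> integral_pair g eta ->
  integral_pair (fun t w => c * f t w + g t w)
                (fun t s w y => c * mu t s w y + eta t s w y).
Proof.
move=> pf pg t t01; have := integral_at_lin c (pf t t01) (pg t t01).
by congr integral_at; apply/funext => z; rewrite /cutI mulrDr mulrCA.
Qed.

Lemma integral_pairB f mu g eta : integral_pair f mu -> integral_pair g eta ->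
  integral_pair (fun t w => f t w - g t w)
                (fun t s w y => mu t s w y - eta t s w y).
Proof.
move=> pf pg; have := integral_pair_lin (-1) pg pf.
congr integral_pair; apply/funext => t; apply/funext => s.
  by rewrite mulN1r addrC.
by apply/funext => w; apply/funext => y; rewrite mulN1r addrC.
Qed.

Lemma integral_pair_J a : Lp P F Pi 2 a -> integral_pair (J a) (fun=> a).
Proof. by move=> La t t01; exact: integral_at_J. Qed.

(** [P_tilde_step] evaluates the integral of alpha_k at t_k rather than at t. Since alpha_k vanishes
    on ]t_k, 1], its cuts at t_k and at any t in [t_k, t_(k+1)[ coincide. *)
Lemma integral_pair_step m : T2 P F Pi m ->
  integral_pair (P_tilde_step J m) (step_fun m).
Proof.
move=> hm t /andP[t0 t1].
have hk k : (k < st_size m)%N ->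
    integral_at (J (st_coef m k) (st_node m k)) (cutI `]0, st_node m k] (st_coef m k)).
  by move=> kn; apply: integral_at_J; [exact: (T2_coef hF hm)|exact/(T2_node01 hm)/ltnW].
have := @integral_at_sum (st_size m)
  (fun k => \1_(`[st_node m k, st_node m k.+1[) t)
  (fun k => J (st_coef m k) (st_node m k))
  (fun k => cutI `]0, st_node m k] (st_coef m k)) hk.
congr integral_at; apply/funext => z; rewrite /cutI /step_fun mulr_sumr.
apply: eq_bigr => k _; rewrite [RHS]mulrCA.
rewrite [\1__ t]indicE; have [/set_mem/=|_] := boolP (t \in _); last by rewrite !mul0r.
rewrite in_itv/= !mul1r => /andP[kt _].
have [_ _ _ _ /(_ k (ltn_ord k))[_ vk _]] := hm.
rewrite !indicE; have [/set_mem/=|s0] := boolP (z.1.2 \in `]0, t]%classic).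
  rewrite in_itv/= => /andP[s0 st]; have [ks|sk] := ltP (st_node m k) z.1.2.
    by rewrite vk ?mulr0// ks (le_trans st).
  by rewrite mem_set//= in_itv/= s0.
rewrite [_ \in `]0, st_node _ _]%classic]memNset//= in_itv/= => /andP[s0' sk].
by move: s0; rewrite mem_set//= in_itv/= s0' (le_trans sk).
Qed.

Lemma ip_ae_eq {d'} {T : measurableType d'} (m : {measure set T -> \bar R})
    (f g f' g' : T -> R) :
  measurable_fun setT f -> measurable_fun setT g ->
  measurable_fun setT f' -> measurable_fun setT g' ->
  {ae m, forall x, f x = f' x} -> {ae m, forall x, g x = g' x} ->
  ip m f g = ip m f' g'.
Proof.
move=> mf mg mf' mg' ff' gg'; congr fine; apply: ae_eq_integral => //.
- by apply/measurable_EFinP; exact: measurable_funM.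
- by apply/measurable_EFinP; exact: measurable_funM.
by apply: filterS2 ff' gg' => x -> ->.
Qed.

Lemma ae_time_neq (t : R) : {ae mI, forall z : (Omega * R) * Rvec R l, z.1.2 != t}.
Proof.
exists (([set: Omega] `*` [set t]) `*` [set: Rvec R l]); split.
- by apply: measurableX => //; exact: measurableX.
- rewrite [LHS]product_measure1E//; last exact: measurableX.
  rewrite [X in (X * _)%E]product_measure1E//.
  rewrite [X in (_ * X * _)%E](_ : _ = 0%E) ?mule0 ?mul0e//.
  exact: lebesgue_measure_set1.
by move=> z /= /negP; rewrite negbK => /eqP zt; split.
Qed.

(** [cutN] keeps the time s = 0, whereas stochastic integrals run over ]0, t]; the two cuts differ
    on a null set only. *)
Lemma ip_cutN_section t mu eta : 0 <= t <= 1 ->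
  N2_measurable F mu -> N2_measurable F eta ->
  ip mI (fun z => cutN mu (t, z)) (fun z => cutN eta (t, z)) =
  ip mI (cutI `]0, t] (mu t)) (cutI `]0, t] (eta t)).
Proof.
move=> t01 mmu meta.
have E f : (fun z => cutN f (t, z)) = cutI `[0, t] (f t).
  by apply/funext => z; rewrite /cutN/= indicE mem_set ?mul1r//= in_itv.
have mE f : N2_measurable F f -> measurable_fun setT (cutI `[0, t] (f t)).
  move=> mf; rewrite -E.
  exact: (measurableT_comp (measurable_cutN hF mf) (measurable_pair1 t)).
have sub : `]0, t]%classic `<=` `[0, t]%classic.
  by move=> s /=; rewrite !in_itv/= => /andP[/ltW-> ->].
have mE' f : N2_measurable F f -> measurable_fun setT (cutI `]0, t] (f t)).
  move=> mf; rewrite (cutI_sub _ sub); apply: measurable_funM; last exact: mE.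
  by apply: measurable_indic; exact: measurable_time.
have ae f : {ae mI, forall z, cutI `[0, t] (f t) z = cutI `]0, t] (f t) z}.
  have [Z [mZ Z0 ZP]] := ae_time_neq 0; exists Z; split => // z /= nz; apply: ZP => z0.
  apply: nz; rewrite /cutI !indicE.
  congr ((nat_of_bool _)%:R * _); apply/idP/idP => /set_mem/=; rewrite in_itv/= => /andP[h1 h2].
    by apply/mem_set; rewrite /= in_itv/= lt_neqAle eq_sym z0 h1.
  by apply/mem_set; rewrite /= in_itv/= ltW.
by rewrite !E; apply: ip_ae_eq => //; [exact: mE|exact: mE|exact: mE'|exact: mE'|exact: ae|exact: ae].
Qed.

Lemma integral_pair_L2 f mu : BF_measurable F f -> N2 P F Pi mu ->
  integral_pair f mu -> L2 P F f.
Proof.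
move=> mf /(N2P _ _ hF)[mmu smu] pf; apply/(L2P _ hF); split => //.
have mc := measurable_cutP hF mf; split => //.
rewrite (tonelli_sqr2 P leb mc); case: smu => mN' ; apply: le_lt_trans.
rewrite (tonelli_sqr leb mI mN'); apply: ge0_le_integral_lower.
  by move=> t _; apply: integral_ge0 => w _; rewrite lee_fin sqr_ge0.
move=> t _; have [t01|t01] := boolP (t \in `[0, 1]%classic); last first.
  rewrite integral0_eq; last by move=> w _; rewrite /cutP/= indicE (negbTE t01) mul0r expr0n.
  by apply: integral_ge0 => w _; rewrite lee_fin sqr_ge0.
have {}t01 : 0 <= t <= 1 by move: t01; rewrite inE/= in_itv.
have pft := pf t t01; have [sX sY] := integral_at_sqint pft.
have -> : (\int[P]_w (cutP f (w, t) ^+ 2)%:E = \int[P]_w (f t w ^+ 2)%:E)%E.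
  by apply: eq_integral => w _; rewrite /cutP/= indicE mem_set ?mul1r//= in_itv.
rewrite (sqint_ipE sX) (integral_at_ip pft pft) -(sqint_ipE sY).
apply: ge0_le_integral_lower => z _; rewrite lee_fin ?sqr_ge0//.
rewrite /cutN /cutI/= [\1_(`[0, 1]%classic) t]indicE mem_set ?mul1r//= ?in_itv//.
rewrite !indicE; have [/set_mem/=|_] := boolP (z.1.2 \in `]0, t]%classic); last first.
  by rewrite mul0r expr0n sqr_ge0.
by rewrite in_itv/= => /andP[/ltW s0 st]; rewrite mem_set//= in_itv/= s0.
Qed.

Lemma integral_pair_ip f mu g eta : L2 P F f -> N2 P F Pi mu ->
  L2 P F g -> N2 P F Pi eta -> integral_pair f mu -> integral_pair g eta ->
  ip mP (cutP f) (cutP g) = ip mN (cutN mu) (cutN eta).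
Proof.
move=> /(L2P _ hF)[mf sf] /(N2P _ _ hF)[mmu smu] /(L2P _ hF)[mg sg] /(N2P _ _ hF)[meta seta] pf pg.
rewrite (ip_prod2 sf sg) (ip_prod1 smu seta); apply: eq_Rintegral => t _.
have [t01|t01] := boolP (t \in `[0, 1]%classic); last first.
  have z f' g' : ip P (fun w => cutP f' (w, t)) (fun w => cutP g' (w, t)) = 0.
    by rewrite -[RHS](ip0l P (fun w => cutP g' (w, t))); congr ip; apply/funext => w;
      rewrite /cutP/= indicE (negbTE t01) mul0r.
  rewrite z -[LHS](ip0l mI (fun z => cutN eta (t, z))); congr ip; apply/funext => w.
  by rewrite /cutN/= indicE (negbTE t01) mul0r.
have {}t01 : 0 <= t <= 1 by move: t01; rewrite inE/= in_itv.
rewrite ip_cutN_section// -(integral_at_ip (pf t t01) (pg t t01)).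
by congr ip; apply/funext => w; rewrite /cutP/= indicE mem_set ?mul1r//= in_itv.
Qed.

Lemma BF_measurable_P_tilde_step m : T2 P F Pi m ->
  BF_measurable F (P_tilde_step J m).
Proof.
move=> hm; apply: measurable_funTS; apply: measurable_sum => k.
have k01 := T2_node01 hm (ltnW (ltn_ord k)).
have [mJ _ _] := hJ (T2_coef hF hm (ltn_ord k)).
apply: (BF_measurable_adapted hF (measurable_itv _) k01 _ (BF_section mJ k01)).
by move=> s /=; rewrite in_itv/= => /andP[].
Qed.

Lemma L2_P_tilde_step m : T2 P F Pi m -> L2 P F (P_tilde_step J m).
Proof.
move=> hm; apply: (@integral_pair_L2 _ (step_fun m)).
- exact: BF_measurable_P_tilde_step.
- exact: (N2_step hF hm).
- exact: integral_pair_step.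
Qed.

End isometric_pairs.

(** * Common refinements and linear combinations of step functions *)

Lemma increasing_enumeration {R : realDomainType} (r : seq R) :
  0 \in r -> 1 \in r -> (forall x, x \in r -> 0 <= x <= 1) ->
  exists n (u : nat -> R), [/\ u 0%N = 0, u n = 1,
    forall k, (k < n)%N -> u k < u k.+1 &
    forall x, x \in r -> exists2 k, (k <= n)%N & x = u k].
Proof.
move=> r0 r1 r01; pose L := sort <=%R (undup r).
have memL x : (x \in L) = (x \in r) by rewrite mem_sort mem_undup.
have ltL : sorted <%R L by rewrite sort_lt_sorted undup_uniq.
have leL : sorted <=%R L by exact: sort_le_sorted.
have L0 : (0 < size L)%N by rewrite lt0n size_eq0; apply/eqP => L0; move: (memL 0); rewrite L0 r0.
have sL : (size L).-1.+1 = size L by rewrite prednK.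
have memn k : (k < size L)%N -> nth 1 L k \in r by move=> kL; rewrite -memL mem_nth.
have mono i j : (i <= j)%N -> (j < size L)%N -> nth 1 L i <= nth 1 L j.
  move=> ij jL; apply: (sorted_leq_nth le_trans le_refl) => //.
  by rewrite inE (leq_ltn_trans ij).
have idx x : x \in r -> exists2 k, (k <= (size L).-1)%N & x = nth 1 L k.
  rewrite -memL => xL; exists (index x L); last by rewrite nth_index.
  by rewrite -ltnS sL index_mem.
exists (size L).-1, (nth 1 L); split => //.
- have [k kn k0] := idx _ r0; apply/le_anti/andP; split.
    by rewrite [leRHS]k0 mono// -sL ltnS.
  by have /andP[] := r01 _ (memn 0%N L0).
- have [k kn k1] := idx _ r1; apply/le_anti/andP; split.
    by have /andP[] := r01 _ (memn _ (ltac:(by rewrite sL) : ((size L).-1 < size L)%N)).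
  by rewrite [leLHS]k1 mono// sL.
- by move=> k kn; apply: (sortedP 1 ltL); rewrite -sL ltnS.
Qed.

Section combination.
Context {R : realType} {d : measure_display} {Omega : measurableType d} {l : nat}.
Variables (P : probability Omega R) (F : R -> set (set Omega)).
Variable Pi : {sigma_finite_measure set (Rvec R l) -> \bar R}.
Hypothesis hF : right_continuous_filtration F.

Local Notation leb := (@lebesgue_measure R).
Local Notation mP := (prodm P leb).
Local Notation mI := (prodm mP Pi).
Local Notation mN := (prodm leb mI).

Lemma Lp2_sum n (c : nat -> R) (a : nat -> integrand R Omega l) :
  (forall k, (k < n)%N -> Lp P F Pi 2 (a k)) ->
  Lp P F Pi 2 (fun s w y => \sum_(k < n) c k * a k s w y).
Proof.
move=> ha; apply/(Lp2P _ _ hF).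
have h (k : 'I_n) := (Lp2P P Pi hF (a k)).1 (ha k (ltn_ord k)).
split.
  apply: measurable_sum => k; apply: measurable_funM => //.
  by have [] := h k.
have : sqint mI (fun z => \sum_(k < n) c k * cutI `[0, 1] (a k) z).
  by apply: sqint_sum => k; apply: sqintZ; have [] := h k.
congr sqint; apply/funext => z; rewrite /cutI mulr_sumr.
by apply: eq_bigr => k _; rewrite mulrCA.
Qed.

Lemma Lp2_lin c f g : Lp P F Pi 2 f -> Lp P F Pi 2 g ->
  Lp P F Pi 2 (fun s w y => f s w y + c * g s w y).
Proof.
move=> Lf Lg; have := @Lp2_sum 2 (fun k => if k == 0%N then 1 else c)
  (fun k => if k == 0%N then f else g).
have h k : (k < 2)%N -> Lp P F Pi 2 (if k == 0%N then f else g).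
  by move=> _; case: (k == 0%N); [exact: Lf|exact: Lg].
move=> /(_ h); congr (Lp _ _ _ _ _).
apply/funext => s; apply/funext => w; apply/funext => y.
by rewrite !big_ord_recr big_ord0/= add0r mul1r.
Qed.

Lemma Lp2_step_fun (m : step) x : T2 P F Pi m -> Lp P F Pi 2 (step_fun m x).
Proof.
move=> hm; apply: (@Lp2_sum _ (fun k => \1_(`[st_node m k, st_node m k.+1[) x)).
by move=> k kn; exact: (T2_coef hF hm).
Qed.

Lemma step_fun_vanish (m : step) x s w y : T2 P F Pi m -> x < s <= 1 ->
  step_fun m x s w y = 0.
Proof.
move=> hm /andP[xs s1]; apply: big1 => k _; rewrite indicE.
have [/set_mem/=|_] := boolP (x \in _); last by rewrite mul0r.
rewrite in_itv/= => /andP[kx _].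
have [_ _ _ _ /(_ k (ltn_ord k))[_ vk _]] := hm.
by rewrite vk ?mulr0// (le_lt_trans kx xs).
Qed.

Lemma T2_size_gt0 (m : step) : T2 P F Pi m -> (0 < st_size m)%N.
Proof.
move=> [n0 n1 _ _ _]; rewrite lt0n; apply/eqP => s0.
by move: n1; rewrite s0 n0 => /eqP; rewrite eq_sym oner_eq0.
Qed.

Lemma step_fun0 (m : step) s w y : T2 P F Pi m -> 0 <= s <= 1 ->
  step_fun m 0 s w y = 0.
Proof.
move=> hm s01; have [n0 _ hlt c0 _] := hm; have m0 := T2_size_gt0 hm.
have := T2_sumE hm (fun k => st_coef m k s w y) m0 (t := 0).
rewrite n0 lexx -[X in X < _]n0 hlt// => /(_ isT).
by rewrite /step_fun => ->; exact: c0.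
Qed.

(** The second hypothesis says that no node lies in ]x, t]. *)
Lemma step_fun_constant (m : step) x t : x <= t ->
  (forall j, (j <= st_size m)%N -> st_node m j <= t -> st_node m j <= x) ->
  step_fun m t = step_fun m x :> integrand R Omega l.
Proof.
move=> xt hx; apply/funext => s; apply/funext => w; apply/funext => y.
apply: eq_bigr => j _; congr (_ * _); rewrite !indicE; congr (nat_of_bool _)%:R.
apply/idP/idP => /set_mem/=; rewrite in_itv/= => /andP[h1 h2]; apply/mem_set;
  rewrite /= in_itv/=.
  by rewrite (hx _ (ltnW (ltn_ord j)) h1) (le_lt_trans xt).
rewrite (le_trans h1 xt)/= ltNge; apply/negP => /(hx _ (ltn_ord j)).
by rewrite leNgt h2.
Qed.

(** On the common refinement, the coefficient of each interval is the combination evaluated at its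
    left end u k. The first one is 0 because step functions vanish at t = 0, and the k-th one
    vanishes after u k because step functions vanish for s > t. *)
Lemma T2_lin c (m m' : step) : T2 P F Pi m -> T2 P F Pi m' ->
  exists2 m'' : step, T2 P F Pi m'' & forall t s w y, 0 <= t <= 1 ->
    step_fun m'' t s w y = step_fun m t s w y + c * step_fun m' t s w y.
Proof.
move=> hm hm'.
pose r := mkseq (st_node m) (st_size m).+1 ++ mkseq (st_node m') (st_size m').+1.
have nr j : (j <= st_size m)%N -> st_node m j \in r.
  by move=> jm; rewrite mem_cat map_f// mem_iota.
have nr' j : (j <= st_size m')%N -> st_node m' j \in r.
  by move=> jm; rewrite mem_cat [X in _ || X]map_f ?orbT// mem_iota.
have [n0 n1 _ _ _] := hm.
have [||x|n [u [u0 un hlt hu]]] := @increasing_enumeration _ r.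
- by rewrite -n0 nr.
- by rewrite -n1 nr.
- rewrite mem_cat => /orP[|] /mapP[k]; rewrite mem_iota/= add0n ltnS => kn ->.
    exact: (T2_node01 hm kn).
  exact: (T2_node01 hm' kn).
pose m'' := Step n u (fun k s w y => step_fun m (u k) s w y + c * step_fun m' (u k) s w y).
have umono i j : (i <= j)%N -> (j <= n)%N -> u i <= u j.
  move=> ij; elim: j ij => [|j IHj]; first by rewrite leqn0 => /eqP->.
  rewrite leq_eqVlt => /predU1P[->//|ij] jn; apply: le_trans (IHj ij (ltnW jn)) _.
  exact/ltW/hlt.
have u01 k : (k <= n)%N -> 0 <= u k <= 1.
  by move=> kn; rewrite -u0 -un !umono.
have hm'' : T2 P F Pi m''.
  split => //=.
    by move=> s w y s01; rewrite u0 !step_fun0// mulr0 addr0.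
  move=> k kn.
  have van s w y : u k < s <= 1 -> step_fun m (u k) s w y + c * step_fun m' (u k) s w y = 0.
    by move=> us; rewrite !step_fun_vanish// mulr0 addr0.
  have Lc : Lp P F Pi 2 (fun s w y => step_fun m (u k) s w y + c * step_fun m' (u k) s w y).
    by apply: Lp2_lin; exact: Lp2_step_fun.
  have [mc fin] := (@Lp2_vanish _ _ _ _ P F Pi hF (u k) _ (u01 _ (ltnW kn)) van).1 Lc.
  by split.
exists m'' => // t s w y /andP[t0]; rewrite le_eqVlt => /predU1P[->|t1].
  rewrite /step_fun (T2_sum1 hm'' (fun k => st_coef m'' k s w y)).
  rewrite (T2_sum1 hm (fun k => st_coef m k s w y)).
  by rewrite (T2_sum1 hm' (fun k => st_coef m' k s w y)) mulr0 addr0.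
have [k kn kt] := T2_locate hm'' (ltac:(by rewrite t0) : 0 <= t < 1).
rewrite [LHS](T2_sumE hm'' (fun j => st_coef m'' j s w y) kn kt).
have /andP[/= ut tu] := kt.
(* No node of either step function lies in ]u k, t], so both keep on [u k, t] their value at u k. *)
have low x : x \in r -> x <= t -> x <= u k.
  move=> /hu[i in_ ->] it; have [/umono->//|ki] := leqP i k; first exact: ltnW.
  by move: (umono _ _ ki in_) => /le_trans/(_ it); rewrite leNgt tu.
rewrite (@step_fun_constant m (u k) t)//; last by move=> j jm; exact/low/nr.
by rewrite (@step_fun_constant m' (u k) t)// => j jm; exact/low/nr'.
Qed.

End combination.

(** * Approximation of an integrand constant in t along uniform subdivisions *)

Section uniform_steps.
Context {R : realType} {d : measure_display} {Omega : measurableType d} {l : nat}.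
Variables (P : probability Omega R) (F : R -> set (set Omega)).
Variable Pi : {sigma_finite_measure set (Rvec R l) -> \bar R}.
Hypothesis hF : right_continuous_filtration F.

Local Notation leb := (@lebesgue_measure R).
Local Notation mP := (prodm P leb).
Local Notation mI := (prodm mP Pi).
Local Notation mN := (prodm leb mI).

Lemma cutPB (f g : process R Omega) :
  cutP (fun t w => f t w - g t w) = (fun z => cutP f z - cutP g z).
Proof. by apply/funext => z; rewrite /cutP mulrBr. Qed.

Lemma cutNB (f g : R -> integrand R Omega l) :
  cutN (fun t s w y => f t s w y - g t s w y) = (fun z => cutN f z - cutN g z).
Proof. by apply/funext => z; rewrite /cutN /cutI !mulrBr. Qed.

Lemma L2B f g : L2 P F f -> L2 P F g -> L2 P F (fun t w => f t w - g t w).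
Proof.
move=> /(L2P _ hF)[mf sf] /(L2P _ hF)[mg sg]; apply/(L2P _ hF); split.
  exact: measurable_funB.
by rewrite cutPB; exact: sqintB.
Qed.

Lemma N2B f g : N2 P F Pi f -> N2 P F Pi g ->
  N2 P F Pi (fun t s w y => f t s w y - g t s w y).
Proof.
move=> /(N2P _ _ hF)[mf sf] /(N2P _ _ hF)[mg sg]; apply/(N2P _ _ hF); split.
  exact: measurable_funB.
by rewrite cutNB; exact: sqintB.
Qed.

Lemma cutP_lin c (f g : process R Omega) :
  cutP (fun t w => c * f t w + g t w) = (fun z => c * cutP f z + cutP g z).
Proof. by apply/funext => z; rewrite /cutP mulrDr mulrCA. Qed.

Lemma L2_lin c f g : L2 P F f -> L2 P F g -> L2 P F (fun t w => c * f t w + g t w).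
Proof.
move=> /(L2P _ hF)[mf sf] /(L2P _ hF)[mg sg]; apply/(L2P _ hF); split.
  by apply: measurable_funD => //; apply: measurable_funM.
by rewrite cutP_lin; apply: sqintD => //; exact: sqintZ.
Qed.

Lemma N2_lin c f g : N2 P F Pi f -> N2 P F Pi g ->
  N2 P F Pi (fun t s w y => c * f t s w y + g t s w y).
Proof.
move=> /(N2P _ _ hF)[mf sf] /(N2P _ _ hF)[mg sg]; apply/(N2P _ _ hF); split.
  by apply: measurable_funD => //; apply: measurable_funM.
rewrite (_ : cutN _ = fun z => c * cutN f z + cutN g z); last first.
  by apply/funext => z; rewrite /cutN /cutI; ring.
by apply: sqintD => //; exact: sqintZ.
Qed.

(** The k-th coefficient is a cut at the node k / (n + 1). The factor 0 < k is there for k = 0,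
    where the cut would still keep the time s = 0, while [T2] requires the first coefficient to
    vanish. *)
Definition uniform_step (n : nat) (a : integrand R Omega l) : step :=
  Step n.+1 (fun k => k%:R / n.+1%:R)
    (fun k s w y => (0 < k)%N%:R * (\1_(`[0, k%:R / n.+1%:R]) s * a s w y)).

Lemma Lp2_time_indic c (A : set R) a : measurable A -> Lp P F Pi 2 a ->
  Lp P F Pi 2 (fun s w y => c * (\1_A s * a s w y)).
Proof.
move=> mA /(Lp2P _ _ hF)[ma sa]; apply/(Lp2P _ _ hF); split.
  apply: measurable_funM => //; apply: measurable_funM => //.
  apply: measurable_funTS; apply: measurable_indic01 => //.
  exact: (measurableT_comp (@BF_time _ _ _ F) measurable_fst).
have : sqint mI (fun z => c * (\1_[set z : (Omega * R) * Rvec R l | A z.1.2] z * cutI `[0, 1] a z)).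
  by apply: sqintZ; apply: sqint_indic_mul => //; exact: measurable_time.
congr sqint; apply/funext => z; rewrite /cutI [RHS]mulrCA; congr (_ * _).
by rewrite [RHS]mulrCA; congr (_ * _); rewrite !indicE; congr (nat_of_bool _)%:R.
Qed.

Lemma T2_uniform_step n a : Lp P F Pi 2 a -> T2 P F Pi (uniform_step n a).
Proof.
move=> La; have n0 : 0 < n.+1%:R :> R by rewrite ltr0n.
split => /=.
- by rewrite mul0r.
- by rewrite divff// gt_eqF.
- by move=> k kn; rewrite ltr_pM2r ?invr_gt0// ltr_nat.
- by move=> s w y _; rewrite mul0r.
move=> k kn.
have k01 : 0 <= (k%:R / n.+1%:R : R) <= 1.
  by rewrite divr_ge0//= ler_pdivrMr// mul1r ler_nat ltnW.
have van s w y : k%:R / n.+1%:R < s <= 1 ->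
    (0 < k)%N%:R * (\1_(`[0, k%:R / n.+1%:R]) s * a s w y) = 0.
  move=> /andP[ks _]; rewrite indicE memNset ?mul0r ?mulr0//= in_itv/=.
  by move=> /andP[_]; rewrite leNgt ks.
have Lk : Lp P F Pi 2 (fun s w y => (0 < k)%N%:R * (\1_(`[0, k%:R / n.+1%:R]) s * a s w y)).
  exact: (Lp2_time_indic _ (measurable_itv _) La).
by have [mc fin] := (@Lp2_vanish _ _ _ _ P F Pi hF _ _ k01 van).1 Lk; split.
Qed.

(** When t exceeds s by more than the mesh, the node preceding t lies beyond s, so the cut keeps
    a. *)
Lemma uniform_step_fun n a t s w y : Lp P F Pi 2 a ->
  0 <= s -> s <= t -> t < 1 -> s + n.+1%:R^-1 < t ->
  step_fun (uniform_step n a) t s w y = a s w y.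
Proof.
move=> La s0 st t1 gap; have hm := T2_uniform_step n La.
have n0 : 0 < n.+1%:R :> R by rewrite ltr0n.
have [k kn kt] := T2_locate hm (ltac:(by rewrite (le_trans s0 st)) : 0 <= t < 1).
rewrite [LHS](T2_sumE hm (fun j => st_coef (uniform_step n a) j s w y) kn kt)/=.
have /andP[_ /= tk] := kt.
have sk : s < k%:R / n.+1%:R.
  by have := lt_trans gap tk; rewrite -(natr1 k) mulrDl mul1r ltrD2r.
have k0 : (0 < k)%N.
  by rewrite lt0n; apply/eqP => k0; move: sk; rewrite k0 mul0r ltNge s0.
by rewrite k0 mul1r indicE mem_set ?mul1r//= in_itv/= s0 ltW.
Qed.

Lemma uniform_step_le n a t s w y : Lp P F Pi 2 a -> 0 <= t <= 1 ->
  (step_fun (uniform_step n a) t s w y - a s w y) ^+ 2 <= a s w y ^+ 2.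
Proof.
move=> La /andP[t0]; have hm := T2_uniform_step n La.
rewrite le_eqVlt => /predU1P[->|t1].
  by rewrite /step_fun (T2_sum1 hm (fun j => st_coef (uniform_step n a) j s w y)) sub0r sqrrN.
have [k kn kt] := T2_locate hm (ltac:(by rewrite t0) : 0 <= t < 1).
rewrite /step_fun (T2_sumE hm (fun j => st_coef (uniform_step n a) j s w y) kn kt)/=.
rewrite indicE; case: (_ \in _); case: (0 < k)%N;
  by rewrite ?mul1r ?mul0r ?subrr ?sub0r ?sqrrN// expr0n sqr_ge0.
Qed.

(** For fixed (omega, s, y) the error is at most a^2, and it lives on s <= t <= s + 1 / (n + 1)
    apart from the time t = 1. Integrating first in t therefore produces the factor 1 / (n + 1). *)
Lemma uniform_step_ip n a : Lp P F Pi 2 a ->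
  ip mN (cutN (fun t s w y => step_fun (uniform_step n a) t s w y - a s w y))
        (cutN (fun t s w y => step_fun (uniform_step n a) t s w y - a s w y)) <=
  n.+1%:R^-1 * ip mI (cutI `[0, 1] a) (cutI `[0, 1] a).
Proof.
move=> La; have hm := T2_uniform_step n La.
have /(N2P _ _ hF)[_ sD] := N2B (N2_step hF hm) (N2_cst hF La).
have /(Lp2P _ _ hF)[_ sa] := La.
set D := (fun t s w y => _) in sD *.
rewrite -lee_fin EFinM -(sqint_ipE sa) -(sqint_ipE sD).
rewrite (tonelli_sqr2 leb mI sD.1).
have n0 : 0 <= n.+1%:R^-1 :> R by rewrite invr_ge0.
rewrite -ge0_integralZl_EFin//; last 2 first.
- by move=> z _; rewrite lee_fin sqr_ge0.
- by apply/measurable_EFinP; apply: measurable_funX; exact: sa.1.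
apply: ge0_le_integral_lower => z _.
  by apply: integral_ge0 => t _; rewrite lee_fin sqr_ge0.
(* The point 1 is added to E because the step function vanishes at t = 1 whatever s is; it has
   measure 0. *)
set c := cutI `[0, 1] a z ^+ 2; pose E := `[z.1.2, z.1.2 + n.+1%:R^-1]%classic `|` [set 1].
have mE : measurable E by apply: measurableU => //; exact: measurable_itv.
apply: (@le_trans _ _ (\int[leb]_t (c%:E * (\1_E t)%:E))%E).
  apply: ge0_le_integral_lower => t _; rewrite lee_fin ?sqr_ge0//.
  rewrite /cutN [\1_(`[0, 1]%classic) t]indicE.
  have [/set_mem/=|_] := boolP (t \in _); last first.
    by rewrite mul0r expr0n mulr_ge0 ?sqr_ge0// indicE.
  rewrite in_itv/= mul1r => /andP[t0 t1].
  rewrite /cutI [\1_(`[0, t]%classic) z.1.2]indicE.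
  have [/set_mem/=|_] := boolP (z.1.2 \in _); last first.
    by rewrite mul0r expr0n mulr_ge0 ?sqr_ge0// indicE.
  rewrite in_itv/= mul1r => /andP[s0 st]; rewrite /D.
  have cE : c = a z.1.2 z.1.1 z.2 ^+ 2.
    by rewrite /c /cutI indicE mem_set ?mul1r//= in_itv/= s0 (le_trans st).
  rewrite indicE; have [_|] := boolP (t \in E).
    by rewrite mulr1 cE uniform_step_le// t0.
  rewrite mulr0 => /negP tE; rewrite uniform_step_fun// ?subrr ?expr0n//.
    rewrite lt_neqAle t1 andbT; apply/eqP => t1'; apply: tE.
    by rewrite inE; right.
  rewrite ltNge; apply/negP => h; apply: tE.
  by rewrite inE; left; rewrite /= in_itv/= st.
rewrite ge0_integralZl_EFin ?sqr_ge0//; last first.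
  by apply/measurable_EFinP; exact: measurable_indic.
rewrite integral_indic// setIT muleC; apply: lee_wpmul2r; first by rewrite lee_fin sqr_ge0.
have mS := measurable_itv `[z.1.2, z.1.2 + n.+1%:R^-1].
apply: (le_trans (@measureU2 _ _ _ leb _ _ mS (measurable_set1 1))).
rewrite [X in (_ + X)%E](_ : _ = 0%E) ?adde0; last exact: lebesgue_measure_set1.
rewrite /= lebesgue_measure_itv/= lte_fin ltrDl.
case: ifP => _; last by rewrite lee_fin.
by rewrite -EFinB lee_fin addrAC subrr add0r.
Qed.

End uniform_steps.

Section integral_in_L2_nu.
Context {R : realType} {d : measure_display} {Omega : measurableType d} {l : nat}.
Variables (P : probability Omega R) (F : R -> set (set Omega)).
Variable Pi : {sigma_finite_measure set (Rvec R l) -> \bar R}.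
Variable N : R.-ker Omega ~> (R * Rvec R l)%type.
Variable J : integrand R Omega l -> process R Omega.
Hypothesis hF : right_continuous_filtration F.
Hypothesis hN : adapted_poisson_measure P F Pi N.
Hypothesis hJ : stochastic_integration P F Pi N J.

Local Notation leb := (@lebesgue_measure R).
Local Notation mP := (prodm P leb).
Local Notation mI := (prodm mP Pi).
Local Notation mN := (prodm leb mI).

Lemma L2_J a : Lp P F Pi 2 a -> L2 P F (J a).
Proof.
move=> La; have [mJ _ _] := hJ La.
exact: (integral_pair_L2 hF hN hJ mJ (N2_cst hF La) (integral_pair_J _ La)).
Qed.

Lemma P_tilde_J a : Lp P F Pi 2 a -> P_tilde P F Pi J (fun=> a) (J a).
Proof.
move=> La; pose m n := uniform_step n a.
have hm n : T2 P F Pi (m n) by exact: T2_uniform_step.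
have ND n := N2B hF (N2_step hF (hm n)) (N2_cst hF La).
have cN : ip mN (cutN (fun t s w y => step_fun (m n) t s w y - a s w y))
    (cutN (fun t s w y => step_fun (m n) t s w y - a s w y)) @[n --> \oo] --> 0.
  have c0 : n.+1%:R^-1 * ip mI (cutI `[0, 1] a) (cutI `[0, 1] a) @[n --> \oo] --> 0.
    move: (ip _ _ _) => K; have h : n.+1%:R^-1 @[n --> \oo] --> (0 : R) by exact: cvg_harmonic.
    rewrite -(mul0r K); exact: (cvgM h (cvg_cst K)).
  apply: (squeeze_cvgr _ (cvg_cst 0) c0); apply: nearW => n.
  by rewrite ip_ge0/= (uniform_step_ip hF).
have cN2 := (N2_norm_cvg hF ND).2 cN.
have LS n := L2_P_tilde_step hF hN hJ (hm n).
have LD n := L2B hF (LS n) (L2_J La).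
split.
- by split; [exact: (N2_cst hF La)|exists m; split].
- exact: L2_J.
exists m; split; [exact: hm|exact: cN2|apply: (L2_norm_cvg hF LD).2].
rewrite (_ : (fun n => ip mP _ _) = (fun n => ip mN
    (cutN (fun t s w y => step_fun (m n) t s w y - a s w y))
    (cutN (fun t s w y => step_fun (m n) t s w y - a s w y))))//.
apply/funext => n.
(* The error of the processes is the integral of the error of the integrands, so the two errors have
   the same norm. *)
have pD := integral_pairB (integral_pair_step J hF (hm n)) (integral_pair_J J La).
exact: (integral_pair_ip hF hN hJ (LD n) (ND n) (LD n) (ND n) pD pD).
Qed.

End integral_in_L2_nu.

(** * The Volterra integral *)

Section unconditional_scaling.
Context {d} {T : measurableType d} {R : realType}.
Variable m : {measure set T -> \bar R}.

(** If the extended integral is finite, so are those of the positive and negative parts, and f is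
    integrable; otherwise it is infinite and [fine] sends it to 0. *)
Lemma Rintegral_nonintegrable (f : T -> R) : measurable_fun setT f ->
  ~ m.-integrable setT (EFin \o f) -> \int[m]_x f x = 0.
Proof.
move=> mf nif; rewrite /Rintegral.
have mF : measurable_fun setT (EFin \o f) by exact/measurable_EFinP.
have [fin|] := boolP ((\int[m]_x (f x)%:E)%E \is a fin_num); last first.
  by case: (\int[m]_x _)%E => [r| |].
case: nif; apply/integrableP; split => //.
move: fin; rewrite integralE fin_numB => /andP[fp fn].
have -> : (fun x => `|(EFin \o f) x|)%E = ((EFin \o f)^\+ \+ (EFin \o f)^\-)%E.
  by rewrite -fune_abse.
rewrite ge0_integralD//; [|exact: measurable_funepos|exact: measurable_funeneg].
by rewrite ltey_eq fin_numD fp fn.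
Qed.

(* Valid without integrability, because of the value 0 of the integral then. *)
Lemma Rintegral_scale (f : T -> R) (c : R) : measurable_fun setT f ->
  \int[m]_x (f x * c) = (\int[m]_x f x) * c.
Proof.
move=> mf; have [->|c0] := eqVneq c 0.
  by rewrite mulr0 /Rintegral integral0_eq// => x _; rewrite mulr0.
have [fi|nfi] := pselect (m.-integrable setT (EFin \o f)); first exact: RintegralZr.
rewrite !Rintegral_nonintegrable ?mul0r//; first exact: measurable_funM.
move=> fi; apply: nfi; have := integrableZl measurableT c^-1 fi.
apply: eq_integrable => // x _ /=.
by rewrite -EFinM mulrCA mulVf// mulr1.
Qed.

End unconditional_scaling.

(** Integrability is not assumed: Tonelli applies to the positive and the negative part separately,
    and the difference remains measurable with the conventions for infinite values. *)
Lemma measurable_Rintegral1 {d1 d2} {T1 : measurableType d1} {T2 : measurableType d2}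
    {R : realType} (m : {sigma_finite_measure set T1 -> \bar R}) (g : T1 * T2 -> R) :
  measurable_fun setT g -> measurable_fun setT (fun y => \int[m]_x g (x, y)).
Proof.
move=> mg; have mE : measurable_fun setT (EFin \o g) by exact/measurable_EFinP.
apply: measurableT_comp => //.
have hp : measurable_fun setT (fubini_G m ((EFin \o g)^\+)%E).
  by apply: measurable_fun_fubini_tonelli_G => //; exact: measurable_funepos.
have hn : measurable_fun setT (fubini_G m ((EFin \o g)^\-)%E).
  by apply: measurable_fun_fubini_tonelli_G => //; exact: measurable_funeneg.
have := emeasurable_funB hp hn; congr measurable_fun; apply/funext => y /=.
rewrite /fubini_G [RHS]integralE; congr (_ - _)%E; apply: eq_integral => x _.
  by rewrite !funeposE.
by rewrite !funenegE.
Qed.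

Section volterra_operator.
Context {R : realType} {d : measure_display} {Omega : measurableType d} {l : nat}.
Variables (P : probability Omega R) (F : R -> set (set Omega)).
Variable Pi : {sigma_finite_measure set (Rvec R l) -> \bar R}.
Hypothesis hF : right_continuous_filtration F.

Local Notation leb := (@lebesgue_measure R).
Local Notation mP := (prodm P leb).
Local Notation mI := (prodm mP Pi).
Local Notation mN := (prodm leb mI).

Let D : set (R * ((R * Omega) * Rvec R l)) :=
  [set z | [/\ 0 <= z.2.1.1, z.2.1.1 <= z.1 & z.1 <= 1]].

(** [cutN] only retains measurability for the ambient sigma-field. Here the cut to the triangle is
    made over R * (BF F * Rvec R l), and integrating out the first variable preserves progressive
    measurability in the others. *)
Lemma BFl_measurable_volterra mu : N2_measurable F mu ->
  BFl_measurable F (volterra_integral mu : integrand R Omega l).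
Proof.
move=> mmu.
pose g (z : R * ((R * Omega) * Rvec R l)) : R :=
  \1_D z * mu z.1 z.2.1.1 z.2.1.2 z.2.2.
have mg : @measurable_fun _ _ (R * (BF F * Rvec R l))%type R setT g.
  exact: (measurable_indic_mul (@N2_domain _ _ _ _ F) mmu).
have mGE := measurable_Rintegral1 leb mg.
have := @measurable_funTS _ _ (BF F * Rvec R l)%type R [set z | 0 <= z.1.1 <= 1] _ mGE.
apply: eq_measurable_fun => -[[t w] y] /set_mem/= /andP[t0 t1].
rewrite /volterra_integral [RHS]Rintegral_mkcond; congr fine; apply: eq_integral => s _.
rewrite patchE /g /D indicE; case: ifPn => [/set_mem/=|s1].
  by rewrite in_itv/= => /andP[ts s1]; rewrite mem_set ?mul1r.
rewrite memNset ?mul0r//= => -[_ ts s1']; move: s1.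
by rewrite mem_set//= in_itv/= ts.
Qed.

Lemma cutI_volterra (mu : R -> integrand R Omega l) z : cutI `[0, 1] (volterra_integral mu) z =
  \int[leb]_s cutN mu (s, z).
Proof.
rewrite /cutI /volterra_integral indicE.
have [/set_mem/=|t01] := boolP (z.1.2 \in `[0, 1]%classic).
  rewrite in_itv/= => /andP[t0 t1]; rewrite mul1r Rintegral_mkcond.
  apply: eq_Rintegral => s _; rewrite patchE /cutN /cutI/= !indicE mulrA -natrM mulnb.
  case: ifPn => [/set_mem/=|s1].
    rewrite in_itv/= => /andP[ts s1]; rewrite !mem_set ?mul1r//= in_itv/= ?t0 ?ts//.
    by rewrite s1 (le_trans t0).
  case: (boolP (_ && _)) => [/andP[/set_mem/= + /set_mem/=]|_]; last by rewrite mul0r.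
  rewrite !in_itv/= => /andP[_ s1'] /andP[_ ts]; move: s1.
  by rewrite mem_set//= in_itv/= ts.
rewrite mul0r /Rintegral integral0_eq// => s _; congr EFin.
rewrite /cutN /cutI/= !indicE mulrA -natrM mulnb.
case: (boolP (_ && _)) => [/andP[/set_mem/= + /set_mem/=]|_]; last by rewrite mul0r.
rewrite !in_itv/= => /andP[_ s1] /andP[t0 ts]; move: t01.
by rewrite mem_set//= in_itv/= t0 (le_trans ts).
Qed.

Let measurable_section (mu : R -> integrand R Omega l) z : N2_measurable F mu ->
  measurable_fun setT (fun s => cutN mu (s, z) : R).
Proof.
move=> mmu; exact: (measurableT_comp (measurable_cutN hF mmu) (measurable_pair2 z)).
Qed.

(** The constant is 1 because the indicator of [0, 1], against which Cauchy-Schwarz is applied, has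
    norm 1. An infinite right-hand side is disposed of first. *)
Lemma sqr_volterra_le (mu : R -> integrand R Omega l) z : N2_measurable F mu ->
  ((cutI `[0%R, 1%R] (volterra_integral mu) z ^+ 2)%:E <=
   \int[leb]_s (cutN mu (s, z) ^+ 2)%:E)%E.
Proof.
move=> mmu; have ms := measurable_section z mmu.
rewrite cutI_volterra; have [fin|] := boolP (\int[leb]_s (cutN mu (s, z) ^+ 2)%:E < +oo)%E; last first.
  by rewrite -leNgt leye_eq => /eqP ->; rewrite leey.
have ss : sqint leb (fun s => cutN mu (s, z)) by [].
have s1 : sqint leb (\1_(`[0, 1]%classic) : R -> R).
  by apply: sqint_leb_indic => //; exact: measurable_itv.
rewrite (sqint_ipE ss) lee_fin.
have e1 : ip leb (\1_(`[0, 1]%classic) : R -> R) (\1_(`[0, 1]%classic) : R -> R) = 1.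
  rewrite ip_indic//; try exact: measurable_itv.
  by rewrite setIid /= lebesgue_measure_itv/= lte_fin ltr01 oppr0 adde0.
have := ip_CS s1 ss; rewrite e1 mul1r; apply: le_trans.
rewrite le_eqVlt; apply/orP; left; apply/eqP; congr (_ ^+ 2).
by apply: eq_Rintegral => s _; rewrite /cutN !indicE; case: (_ \in _); rewrite ?mul1r ?mul0r.
Qed.

Lemma Lp2_volterra mu : N2 P F Pi mu ->
  Lp P F Pi 2 (volterra_integral mu) /\
  ip mI (cutI `[0, 1] (volterra_integral mu)) (cutI `[0, 1] (volterra_integral mu)) <=
  ip mN (cutN mu) (cutN mu).
Proof.
move=> /(N2P _ _ hF)[mmu smu]; have mb := BFl_measurable_volterra mmu.
have mc := measurable_cutI hF (measurable_itv `[0, 1]) (@subset_refl _ _) mb.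
have le : (\int[mI]_z (cutI `[0%R, 1%R] (volterra_integral mu) z ^+ 2)%:E <=
    (ip mN (cutN mu) (cutN mu))%:E)%E.
  rewrite -(sqint_ipE smu) (tonelli_sqr2 leb mI smu.1).
  apply: ge0_le_integral_lower => z _; first by rewrite lee_fin sqr_ge0.
  exact: sqr_volterra_le.
have sb : sqint mI (cutI `[0, 1] (volterra_integral mu)).
  by split => //; apply: le_lt_trans le _; rewrite ltry.
split; first exact/(Lp2P _ _ hF).
by rewrite -lee_fin -(sqint_ipE sb).
Qed.

Lemma ip_volterra mu a : N2 P F Pi mu -> Lp P F Pi 2 a ->
  ip mN (cutN mu) (cutN (fun=> a)) =
  ip mI (cutI `[0, 1] (volterra_integral mu)) (cutI `[0, 1] a).
Proof.
move=> /(N2P _ _ hF)[mmu smu] La; have /(N2P _ _ hF)[ma sa] := N2_cst hF La.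
rewrite (ip_prod2 smu sa); apply: eq_Rintegral => z _.
(* The identity is wanted for every z, including those for which the section of mu in s fails to be
   integrable. *)
rewrite cutI_volterra -(@Rintegral_scale _ _ _ leb (fun s => cutN mu (s, z)) (cutI `[0, 1] a z)); last first.
  exact: measurable_section.
apply: eq_Rintegral => s _; rewrite /cutN /cutI.
rewrite !indicE; case: (boolP (s \in `[0, 1]%classic)) => [/set_mem/=|_]; last by rewrite !mul0r.
rewrite in_itv/= => /andP[s0 s1]; rewrite !mul1r.
have [/set_mem/=|_] := boolP (z.1.2 \in `[0, s]%classic); last by rewrite !mul0r.
rewrite in_itv/= => /andP[t0 ts]; congr (_ * _).
by rewrite [z.1.2 \in _]mem_set//= in_itv/= t0 (le_trans ts).
Qed.

End volterra_operator.

(** * The extension of the integral to the closure of step functions *)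

Section extension.
Context {R : realType} {d : measure_display} {Omega : measurableType d} {l : nat}.
Variables (P : probability Omega R) (F : R -> set (set Omega)).
Variable Pi : {sigma_finite_measure set (Rvec R l) -> \bar R}.
Variable N : R.-ker Omega ~> (R * Rvec R l)%type.
Variable J : integrand R Omega l -> process R Omega.
Hypothesis hF : right_continuous_filtration F.
Hypothesis hN : adapted_poisson_measure P F Pi N.
Hypothesis hJ : stochastic_integration P F Pi N J.

Local Notation leb := (@lebesgue_measure R).
Local Notation mP := (prodm P leb).
Local Notation mI := (prodm mP Pi).
Local Notation mN := (prodm leb mI).

Lemma P_tilde_approx mu f : P_tilde P F Pi J mu f ->
  exists m : nat -> step, [/\ forall n, T2 P F Pi (m n),
    ip mN (fun z => cutN (step_fun (m n)) z - cutN mu z)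
          (fun z => cutN (step_fun (m n)) z - cutN mu z) @[n --> \oo] --> 0 &
    ip mP (fun z => cutP (P_tilde_step J (m n)) z - cutP f z)
          (fun z => cutP (P_tilde_step J (m n)) z - cutP f z) @[n --> \oo] --> 0].
Proof.
move=> [[Nmu _] Lf [m [hm cN cP]]]; exists m; split=> //.
- have ND n := N2B hF (N2_step hF (hm n)) Nmu.
  have := (N2_norm_cvg hF ND).1 cN.
  by under eq_fun do rewrite cutNB.
- have LD n := L2B hF (L2_P_tilde_step hF hN hJ (hm n)) Lf.
  have := (L2_norm_cvg hF LD).1 cP.
  by under eq_fun do rewrite cutPB.
Qed.

Lemma P_tilde_ip mu f eta g : P_tilde P F Pi J mu f -> P_tilde P F Pi J eta g ->
  ip mP (cutP f) (cutP g) = ip mN (cutN mu) (cutN eta).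
Proof.
move=> hf hg; have [m [hm cN cP]] := P_tilde_approx hf.
have [m' [hm' cN' cP']] := P_tilde_approx hg.
have [[Nmu _] Lf _] := hf; have [[Neta _] Lg _] := hg.
have sP k (hk : T2 P F Pi k) := ((L2P P hF _).1 (L2_P_tilde_step hF hN hJ hk)).2.
have sN k (hk : T2 P F Pi k) := ((N2P P Pi hF _).1 (N2_step hF hk)).2.
have C1 := ip_cvg (fun n => sP _ (hm n)) (fun n => sP _ (hm' n))
  ((L2P P hF _).1 Lf).2 ((L2P P hF _).1 Lg).2 cP cP'.
have C2 := ip_cvg (fun n => sN _ (hm n)) (fun n => sN _ (hm' n))
  ((N2P P Pi hF _).1 Nmu).2 ((N2P P Pi hF _).1 Neta).2 cN cN'.
have E : (fun n => ip mP (cutP (P_tilde_step J (m n))) (cutP (P_tilde_step J (m' n)))) =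
    (fun n => ip mN (cutN (step_fun (m n))) (cutN (step_fun (m' n)))).
  apply/funext => n; apply: (integral_pair_ip hF hN hJ).
  - exact: (L2_P_tilde_step hF hN hJ (hm n)).
  - exact: (N2_step hF (hm n)).
  - exact: (L2_P_tilde_step hF hN hJ (hm' n)).
  - exact: (N2_step hF (hm' n)).
  - exact: (integral_pair_step J hF (hm n)).
  - exact: (integral_pair_step J hF (hm' n)).
by rewrite E in C1; exact: (cvg_unique _ C1 C2).
Qed.

Lemma L2_nu_perp_ip chi g : L2_nu_perp P F Pi J chi -> L2_nu P F Pi J g ->
  ip mP (cutP chi) (cutP g) = 0.
Proof.
move=> [Lchi perp] hg; have [mu [_ Lg _]] := hg.
rewrite -(process_functionalE ((L2P P hF _).1 Lchi).2 ((L2P P hF _).1 Lg).2).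
exact: perp.
Qed.

Lemma decomposition_ip chi chi1 mu eta g : L2 P F chi ->
  decomposition P F Pi J chi chi1 mu -> P_tilde P F Pi J eta g ->
  ip mP (cutP chi) (cutP g) = ip mN (cutN mu) (cutN eta).
Proof.
move=> Lchi [perp hmu] hg; have [Lchi1 _] := perp; have [_ Lg _] := hg.
rewrite -(P_tilde_ip hmu hg) cutPB ipBl; try by apply/(L2P _ hF).
- by rewrite (L2_nu_perp_ip perp) ?subr0//; exists eta.
- by have /(L2P _ hF)[] := Lchi.
- by have /(L2P _ hF)[] := Lchi1.
- by have /(L2P _ hF)[] := Lg.
Qed.

(** With f = chi - chi1, one has <chi, f> = |f|^2 = |||mu|||^2, so that 0 <= |chi - f|^2 = |chi|^2 -
    |||mu|||^2. *)
Lemma decomposition_le chi chi1 mu : L2 P F chi ->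
  decomposition P F Pi J chi chi1 mu ->
  ip mN (cutN mu) (cutN mu) <= ip mP (cutP chi) (cutP chi).
Proof.
move=> Lchi dec; have [perp hmu] := dec; have [Lchi1 _] := perp; have [_ Lf _] := hmu.
have h1 := decomposition_ip Lchi dec hmu.
have h2 := P_tilde_ip hmu hmu.
have /(L2P _ hF)[_ sc] := Lchi; have /(L2P _ hF)[_ sf] := Lf.
have := ip_ge0 mP (fun z => cutP chi z - cutP (fun t w => chi t w - chi1 t w) z).
rewrite ipB2// h1 h2; lra.
Qed.

Lemma process_functional_J chi chi1 mu a : L2 P F chi ->
  decomposition P F Pi J chi chi1 mu -> Lp P F Pi 2 a ->
  process_functional P chi (J a) =
  integrand_functional P Pi (volterra_integral mu) a.
Proof.
move=> Lchi dec La; have [_ [[Nmu _] _ _]] := dec.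
have [Lv _] := Lp2_volterra hF Nmu.
rewrite (process_functionalE ((L2P P hF _).1 Lchi).2 ((L2P P hF _).1 (L2_J hF hN hJ La)).2).
rewrite (decomposition_ip Lchi dec (P_tilde_J hF hN hJ La)) (ip_volterra hF Nmu La).
by rewrite (integrand_functionalE ((Lp2P P Pi hF _).1 Lv).2 ((Lp2P P Pi hF _).1 La).2).
Qed.

(** [J] selects versions and need not be linear as a map on functions. The difference J (c a + b) -
    (c J a + J b) is paired with the integrand 0, so by the isometry it has norm 0 and chi does not
    see it. *)
Lemma process_functional_J_lin chi c a b : L2 P F chi -> Lp P F Pi 2 a -> Lp P F Pi 2 b ->
  process_functional P chi (J (fun s w y => c * a s w y + b s w y)) =
  c * process_functional P chi (J a) + process_functional P chi (J b).
Proof.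
move=> Lchi La Lb.
have Lab : Lp P F Pi 2 (fun s w y => c * a s w y + b s w y).
  have := Lp2_lin hF c Lb La; congr (Lp _ _ _ _ _).
  by apply/funext => s; apply/funext => w; apply/funext => y; rewrite addrC.
have sJ e (Le : Lp P F Pi 2 e) := ((L2P P hF _).1 (L2_J hF hN hJ Le)).2.
have /(L2P _ hF)[_ sc] := Lchi.
have sa := sJ _ La; have sb := sJ _ Lb; have sab := sJ _ Lab.
rewrite !process_functionalE// -ipZr// -ipDr//; last exact: sqintZ.
have sl := sqintD (sqintZ c sa) sb.
rewrite ipC [RHS]ipC; apply: (ip_congr sab sl sc).
have pD := integral_pairB (integral_pair_J J Lab)
  (integral_pair_lin c (integral_pair_J J La) (integral_pair_J J Lb)).
have Ll := L2_lin hF c (L2_J hF hN hJ La) (L2_J hF hN hJ Lb).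
have LD := L2B hF (L2_J hF hN hJ Lab) Ll.
have ND := N2B hF (N2_cst hF Lab) (N2_cst hF Lab).
have := integral_pair_ip hF hN hJ LD ND LD ND pD pD.
rewrite cutPB cutP_lin => ->; rewrite (_ : cutN _ = fun=> 0) ?ip0l//.
by apply/funext => z; rewrite /cutN /cutI subrr !mulr0.
Qed.

End extension.

(** * Bounds of the functionals on DH_p *)

Section duals.
Context {R : realType} {d : measure_display} {Omega : measurableType d} {l : nat}.
Variables (P : probability Omega R) (F : R -> set (set Omega)).
Hypothesis hF : right_continuous_filtration F.

Local Notation leb := (@lebesgue_measure R).
Local Notation mP := (prodm P leb).

(** Cauchy-Schwarz, with the factor 2 inherited from [DH_L2]. *)
Lemma process_functional_le (p : nat) chi f : (2 <= p)%N -> L2 P F chi -> DH P F p f ->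
  (`|process_functional P chi f|%:E <=
   (Num.sqrt (2 * ip mP (cutP chi) (cutP chi)))%:E * DH_norm P p f)%E.
Proof.
move=> p2 /(L2P _ hF)[_ sc] Df; have [sf le] := DH_L2 hF p2 Df; have [_ _ fin] := Df.
have n0 : (0 <= DH_norm P p f)%E by exact: poweR_ge0.
rewrite -[X in (_ * X)%E]fineK ?ge0_fin_numE// -EFinM lee_fin.
have D0 : 0 <= fine (DH_norm P p f) by exact: fine_ge0.
rewrite process_functionalE// -(ger0_norm D0) -[X in _ * X]sqrtr_sqr -sqrtrM.
  rewrite -sqrtr_sqr ler_wsqrtr// (le_trans (ip_CS sc sf))//.
  by rewrite -mulrA mulrCA ler_wpM2l ?ip_ge0.
by rewrite mulr_ge0// ip_ge0.
Qed.

Lemma DH_dual_process_functional (p : nat) chi : (2 <= p)%N -> L2 P F chi ->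
  DH_dual P F p (process_functional P chi).
Proof.
move=> p2 Lchi; have /(L2P _ hF)[_ sc] := Lchi; split.
  move=> a f g Df Dg; have [sf _] := DH_L2 hF p2 Df; have [sg _] := DH_L2 hF p2 Dg.
  have sl : sqint mP (cutP (fun t w => a * f t w + g t w)).
    by rewrite cutP_lin; apply: sqintD => //; exact: sqintZ.
  rewrite !process_functionalE// cutP_lin ipDr ?ipZr//; exact: sqintZ.
exists (Num.sqrt (2 * ip mP (cutP chi) (cutP chi))) => f Df.
exact: process_functional_le.
Qed.

End duals.

(** * Existence of the decomposition by projection onto L_2(nu) *)

Lemma ip_cvgl {d} {T : measurableType d} {R : realType} (m : {measure set T -> \bar R})
    (f_ : nat -> T -> R) (f g : T -> R) :
  (forall n, sqint m (f_ n)) -> sqint m f -> sqint m g ->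
  ip m (fun x => f_ n x - f x) (fun x => f_ n x - f x) @[n --> \oo] --> 0 ->
  ip m (f_ n) g @[n --> \oo] --> ip m f g.
Proof.
move=> sf_ sf sg cf; apply: (ip_cvg sf_ (fun=> sg) sf sg cf).
have -> : ip m (fun x => g x - g x) (fun x => g x - g x) = 0.
  by rewrite -[RHS](ip0l m (fun x => g x - g x)); congr ip; apply/funext => x; rewrite subrr.
exact: cvg_cst.
Qed.

(** The formula for the limit commutes with the cut. Hence the limit of cut functions is the cut of
    the same formula applied to the processes, where progressive measurability is visible. *)
Lemma indic_limn_esup {T : Type} {R : realType} (A : set T) (x : T) (u : nat -> R) :
  \1_A x * fine (limn_esup (fun k => (u k)%:E)) =
  fine (limn_esup (fun k => (\1_A x * u k)%:E)).
Proof.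
rewrite indicE; case: (x \in A); first by under [in RHS]eq_fun do rewrite mul1r; rewrite mul1r.
under [in RHS]eq_fun do rewrite mul0r.
by rewrite mul0r (cvg_limn_einf_sup (cvg_cst 0%E)).2.
Qed.

Section orthogonal_projection.
Context {R : realType} {d : measure_display} {Omega : measurableType d} {l : nat}.
Variables (P : probability Omega R) (F : R -> set (set Omega)).
Variable Pi : {sigma_finite_measure set (Rvec R l) -> \bar R}.
Variable N : R.-ker Omega ~> (R * Rvec R l)%type.
Variable J : integrand R Omega l -> process R Omega.
Hypothesis hF : right_continuous_filtration F.
Hypothesis hN : adapted_poisson_measure P F Pi N.
Hypothesis hJ : stochastic_integration P F Pi N J.

Local Notation leb := (@lebesgue_measure R).
Local Notation mP := (prodm P leb).
Local Notation mI := (prodm mP Pi).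
Local Notation mN := (prodm leb mI).

Lemma L2_limit (f : nat -> process R Omega) : (forall n, L2 P F (f n)) ->
  (forall e, 0 < e -> exists n0, forall i j, (n0 <= i)%N -> (n0 <= j)%N ->
     ip mP (fun z => cutP (f i) z - cutP (f j) z)
           (fun z => cutP (f i) z - cutP (f j) z) <= e) ->
  exists2 g, L2 P F g &
    ip mP (fun z => cutP (f n) z - cutP g z)
          (fun z => cutP (f n) z - cutP g z) @[n --> \oo] --> 0.
Proof.
move=> Lf Cf.
have [phi] := L2_complete (fun n => ((L2P P hF _).1 (Lf n)).2) Cf.
pose g t w := fine (limn_esup (fun k => (f (phi k) t w)%:E)).
rewrite (_ : (fun z => fine _) = cutP g); last first.
  by apply/funext => z; rewrite /cutP indic_limn_esup.
move=> [sg cg]; exists g => //; apply/(L2P _ hF); split => //.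
apply: measurableT_comp => //; apply: measurable_fun_limn_esup => k.
by apply/measurable_EFinP; have [] := Lf (phi k).
Qed.

Lemma N2_limit (f : nat -> R -> integrand R Omega l) : (forall n, N2 P F Pi (f n)) ->
  (forall e, 0 < e -> exists n0, forall i j, (n0 <= i)%N -> (n0 <= j)%N ->
     ip mN (fun z => cutN (f i) z - cutN (f j) z)
           (fun z => cutN (f i) z - cutN (f j) z) <= e) ->
  exists2 g, N2 P F Pi g &
    ip mN (fun z => cutN (f n) z - cutN g z)
          (fun z => cutN (f n) z - cutN g z) @[n --> \oo] --> 0.
Proof.
move=> Lf Cf.
have [phi] := L2_complete (fun n => ((N2P P Pi hF _).1 (Lf n)).2) Cf.
pose g t s w y := fine (limn_esup (fun k => (f (phi k) t s w y)%:E)).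
rewrite (_ : (fun z => fine _) = cutN g); last first.
  by apply/funext => z; rewrite /cutN /cutI !indic_limn_esup.
move=> [sg cg]; exists g => //; apply/(N2P _ _ hF); split => //.
apply: measurableT_comp => //; apply: measurable_fun_limn_esup => k.
by apply/measurable_EFinP; have [] := Lf (phi k).
Qed.

Lemma Lp2_0 : Lp P F Pi 2 (fun=> fun=> fun=> 0).
Proof.
have := @Lp2_sum _ _ _ _ P F Pi hF 0 (fun=> 0) (fun=> fun=> fun=> fun=> 0).
move=> /(_ (ltac:(by []))); congr (Lp _ _ _ _ _).
by apply/funext => s; apply/funext => w; apply/funext => y; rewrite big_ord0.
Qed.

(** On [0, 1] the step functions combine exactly, by [T2_lin], but their integrals involve [J] at
    different coefficients. The difference of the integrals is paired with an integrand whose cut is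
    0, hence has norm 0. *)
Lemma P_tilde_step_lin c m m' : T2 P F Pi m -> T2 P F Pi m' ->
  exists2 m'', T2 P F Pi m'' &
    ip mP (fun z => cutP (P_tilde_step J m'') z -
             (cutP (P_tilde_step J m) z + c * cutP (P_tilde_step J m') z))
          (fun z => cutP (P_tilde_step J m'') z -
             (cutP (P_tilde_step J m) z + c * cutP (P_tilde_step J m') z)) = 0.
Proof.
move=> hm hm'; have [m'' hm'' stepE] := T2_lin hF c hm hm'; exists m'' => //.
have Lm := L2_P_tilde_step hF hN hJ hm; have Lm' := L2_P_tilde_step hF hN hJ hm'.
have Lm'' := L2_P_tilde_step hF hN hJ hm''.
have pD := integral_pairB (integral_pair_step J hF hm'')
  (integral_pair_lin c (integral_pair_step J hF hm') (integral_pair_step J hF hm)).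
have LD := L2B hF Lm'' (L2_lin hF c Lm' Lm).
have ND := N2B hF (N2_step hF hm'') (N2_lin hF c (N2_step hF hm') (N2_step hF hm)).
have := integral_pair_ip hF hN hJ LD ND LD ND pD pD.
rewrite cutPB cutP_lin.
rewrite (_ : cutN _ = fun=> 0) ?ip0l => [<-|].
  by congr ip; apply/funext => z; congr (_ - _); rewrite addrC.
apply/funext => -[t z]; rewrite /cutN/= indicE.
have [/set_mem/=|_] := boolP (t \in `[0, 1]%classic); last by rewrite mul0r.
by rewrite in_itv/= => t01; rewrite /cutI stepE// [X in _ - X]addrC subrr !mulr0.
Qed.

(** One sequence of steps nearly minimizes the distance to chi. By the isometry it is Cauchy on the
    integrand side too, and its limits f and mu on the two sides are related by [P_tilde].
    Orthogonality of chi - f to the integrals of steps then passes to all of [L2_nu] by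
    continuity. *)
Lemma decomposition_exists chi : L2 P F chi ->
  exists chi1 mu, decomposition P F Pi J chi chi1 mu.
Proof.
move=> Lchi; have /(L2P _ hF)[_ sc] := Lchi.
pose I := {m | T2 P F Pi m}; pose V (i : I) := cutP (P_tilde_step J (sval i)).
(* The infimum of the distances needs a nonempty family; the zero integrand provides a member. *)
have i0 : I by exact: (exist _ _ (T2_uniform_step hF 0 Lp2_0)).
have LV (i : I) : L2 P F (P_tilde_step J (sval i)) by exact: (L2_P_tilde_step hF hN hJ (svalP i)).
have NV (i : I) : N2 P F Pi (step_fun (sval i)) by exact: (N2_step hF (svalP i)).
have pV (i : I) := integral_pair_step J hF (svalP i).
have sV i : sqint mP (V i) by have /(L2P _ hF)[] := LV i.
have linV a i j : exists k, ip mP (fun x => V k x - (V i x + a * V j x))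
    (fun x => V k x - (V i x + a * V j x)) = 0.
  have [m hm mE] := P_tilde_step_lin a (svalP i) (svalP j).
  by exists (exist _ m hm).
have [s [Cs orth]] := L2_projection i0 sV sc linV.
have [f Lf cf] := L2_limit (fun n => LV (s n)) Cs.
have Cs' e : 0 < e -> exists n0, forall i j, (n0 <= i)%N -> (n0 <= j)%N ->
     ip mN (fun z => cutN (step_fun (sval (s i))) z - cutN (step_fun (sval (s j))) z)
           (fun z => cutN (step_fun (sval (s i))) z - cutN (step_fun (sval (s j))) z) <= e.
  move=> /Cs[n0 hn0]; exists n0 => i j ni nj; apply: le_trans (hn0 i j ni nj).
  rewrite -cutNB /V -cutPB le_eqVlt; apply/orP; left; apply/eqP/esym.
  have LD := L2B hF (LV (s i)) (LV (s j)); have ND := N2B hF (NV (s i)) (NV (s j)).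
  have pD := integral_pairB (pV (s i)) (pV (s j)).
  exact: (integral_pair_ip hF hN hJ LD ND LD ND pD pD).
have [mu Nmu cmu] := N2_limit (fun n => NV (s n)) Cs'.
have hT n : T2 P F Pi (sval (s n)) by exact: svalP.
have cN : N2_norm P Pi (fun t s0 w y => step_fun (sval (s n)) t s0 w y - mu t s0 w y)
    @[n --> \oo] --> 0%E.
  apply: (N2_norm_cvg hF (fun n => N2B hF (NV (s n)) Nmu)).2.
  by under eq_fun do rewrite cutNB.
have Pmu : P_tilde P F Pi J mu f.
  split => //.
    by split => //; exists (fun n => sval (s n)); split.
  exists (fun n => sval (s n)); split; [exact: hT|exact: cN|].
  apply: (L2_norm_cvg hF (fun n => L2B hF (LV (s n)) Lf)).2.
  by under eq_fun do rewrite cutPB.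
have /(L2P _ hF)[_ sf] := Lf.
have ortho m : T2 P F Pi m ->
    ip mP (fun z => cutP chi z - cutP f z) (cutP (P_tilde_step J m)) = 0.
  move=> hm; have c1 := orth (exist _ m hm : I).
  have c2 : ip mP (fun z => cutP chi z - V (s n) z) (V (exist _ m hm)) @[n --> \oo] -->
      ip mP (fun z => cutP chi z - cutP f z) (V (exist _ m hm)).
    apply: ip_cvgl => // [n||]; [exact: sqintB|exact: sqintB|].
    have -> : (fun n => ip mP (fun z => cutP chi z - V (s n) z - (cutP chi z - cutP f z))
        (fun z => cutP chi z - V (s n) z - (cutP chi z - cutP f z))) =
      (fun n => ip mP (fun z => V (s n) z - cutP f z) (fun z => V (s n) z - cutP f z)).
      by apply/funext => n; apply: eq_Rintegral => z _; ring.
    exact: cf.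
  exact: (cvg_unique _ c2 c1).
exists (fun t w => chi t w - f t w), mu; split; last first.
  by under eq_fun do under eq_fun do rewrite subKr.
split; first exact: L2B.
move=> g [eta hg]; have [m [hm _ cg]] := P_tilde_approx hF hN hJ hg.
have [_ Lg _] := hg; have /(L2P _ hF)[_ sg] := Lg.
have sD := ((L2P P hF _).1 (L2B hF Lchi Lf)).2.
rewrite -[LHS]/(process_functional P (fun t w => chi t w - f t w) g) process_functionalE//.
have c1 : ip mP (cutP (P_tilde_step J (m n))) (cutP (fun t w => chi t w - f t w))
    @[n --> \oo] --> ip mP (cutP g) (cutP (fun t w => chi t w - f t w)).
  by apply: ip_cvgl => // n; exact: (sV (exist _ (m n) (hm n))).
have c0 : (fun n => ip mP (cutP (P_tilde_step J (m n))) (cutP (fun t w => chi t w - f t w))) =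
    (fun=> 0) by apply/funext => n; rewrite ipC cutPB ortho.
rewrite c0 in c1; rewrite ipC; apply/esym.
by apply: (cvg_unique _ _ c1) => //; exact: cvg_cst.
Qed.

End orthogonal_projection.

(** The factor sqrt 2 is the one of [Lp2_normE]; between the Hilbert norms the constant is 1. *)
Lemma Lp2_norm_le_L2_norm {R : realType} {d : measure_display} {Omega : measurableType d}
    {l : nat} (P : probability Omega R) (F : R -> set (set Omega))
    (Pi : {sigma_finite_measure set (Rvec R l) -> \bar R}) beta chi :
  right_continuous_filtration F -> Lp P F Pi 2 beta -> L2 P F chi ->
  ip (prodm (prodm P lebesgue_measure) Pi) (cutI `[0, 1] beta) (cutI `[0, 1] beta) <=
  ip (prodm P lebesgue_measure) (cutP chi) (cutP chi) ->
  (Lp_norm P Pi 2 beta <= (Num.sqrt 2)%:E * L2_norm P chi)%E.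
Proof.
move=> hF /(Lp2P _ _ hF)[mb sb] /(L2P _ hF)[mc sc] le.
rewrite (Lp2_normE _ _ hF mb) (L2_normE _ hF mc) (sqint_ipE sb) (sqint_ipE sc).
rewrite -EFinM !poweR_EFin -EFinM lee_fin !powR12_sqrt ?mulr_ge0 ?ip_ge0//.
by rewrite -sqrtrM// ler_wsqrtr// ler_pM2l.
Qed.

Theorem theorem21 (R : realType) (d : measure_display)
    (Omega : measurableType d) (P : probability Omega R)
    (F : R -> set (set Omega)) (l : nat)
    (Pi : {sigma_finite_measure set (Rvec R l) -> \bar R})
    (N : R.-ker Omega ~> (R * Rvec R l)%type)
    (J : integrand R Omega l -> process R Omega) (p : nat)
    (hP : measure_is_complete P)
    (hF : right_continuous_filtration F)
    (hN : adapted_poisson_measure P F Pi N)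
    (hJ : stochastic_integration P F Pi N J)
    (hJp : bounded_Lp_DH P F Pi p J)
    (hp : (2 <= p)%N) (hpe : ~~ odd p) :
  (forall chi, L2 P F chi ->
     DH_dual P F p (process_functional P chi) /\
     Lp_dual P F Pi p (adjoint J (process_functional P chi))) /\
  (exists C : R, forall chi, L2 P F chi ->
     exists beta, [/\ Lp P F Pi 2 beta,
       (forall alpha, Lp P F Pi p alpha ->
          adjoint J (process_functional P chi) alpha =
          integrand_functional P Pi beta alpha) &
       (Lp_norm P Pi 2 beta <= C%:E * L2_norm P chi)%E]) /\
  (forall chi, L2 P F chi ->
     (exists chi1 mu, decomposition P F Pi J chi chi1 mu) /\
     (forall chi1 mu, decomposition P F Pi J chi chi1 mu ->
        Lp P F Pi 2 (volterra_integral mu) /\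
        (forall alpha, Lp P F Pi p alpha ->
           adjoint J (process_functional P chi) alpha =
           integrand_functional P Pi (volterra_integral mu) alpha))).
Proof.
have L2p := Lp_Lp2 hF hp.
have main chi chi1 mu : L2 P F chi -> decomposition P F Pi J chi chi1 mu ->
    Lp P F Pi 2 (volterra_integral mu) /\
    (forall alpha, Lp P F Pi p alpha ->
       adjoint J (process_functional P chi) alpha =
       integrand_functional P Pi (volterra_integral mu) alpha).
  move=> Lchi dec; have [_ [[Nmu _] _ _]] := dec.
  split; first by have [] := Lp2_volterra hF Nmu.
  by move=> alpha /L2p La; exact: (process_functional_J hF hN hJ Lchi dec La).
split; [move=> chi Lchi|split; [|move=> chi Lchi]].
- have dual := DH_dual_process_functional hF hp Lchi; split => //; split.
    move=> a f g /L2p Lf /L2p Lg.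
    exact: (process_functional_J_lin hF hN hJ a Lchi Lf Lg).
  have [_ [C bC]] := dual; have [JDH [K bK]] := hJp.
  (* C is not known to be nonnegative, and the bound of [J] can only be multiplied by a nonnegative
     constant. *)
  exists (Num.max C 0 * K) => f Lf; have Df := JDH _ Lf.
  have C0 : (0 <= (Num.max C 0)%:E)%E by rewrite lee_fin le_max lexx orbT.
  rewrite EFinM -muleA; apply: le_trans (lee_wpmul2l C0 (bK _ Lf)).
  apply: (le_trans (bC _ Df)); apply: lee_wpmul2r; first exact: poweR_ge0.
  by rewrite lee_fin le_max lexx.
- exists (Num.sqrt 2) => chi Lchi.
  have [chi1 [mu dec]] := decomposition_exists hF hN hJ Lchi.
  have [Lv ad] := main _ _ _ Lchi dec; exists (volterra_integral mu); split => //.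
  have [_ [[Nmu _] _ _]] := dec; have [_ le] := Lp2_volterra hF Nmu.
  apply: (Lp2_norm_le_L2_norm hF Lv Lchi); apply: le_trans le _.
  exact: (decomposition_le hF hN hJ Lchi dec).
- split; first exact: (decomposition_exists hF hN hJ Lchi).
  by move=> chi1 mu dec; exact: (main _ _ _ Lchi dec).
Qed.
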